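(* Consider the saddle-point problem $\min_{x\in\mathcal X}\max_{y\in\mathcal Y}S(x,y)$ and the stochastic primal-dual algorithm described in the context (with $\mu\ge0$, in particular $\mu=0$ allowed). Assume that $\Omega_{h_{\mathcal X}}<+\infty$ and $\Omega_{h_{\mathcal Y}}<+\infty$, and that the gradient noises are conditionally unbiased, i.e., almost surely for all $t\ge1$, $\mathbb E_{t-1}[\delta_{y,\Phi}^t]=0$, $\mathbb E_{t-1}[\delta_{x,\Phi}^t]=0$ and $\mathbb E_{t-1}[\delta_{x,f}^t]=0$. For every $t\in\mathbb N=\{1,2,\dots\}$ choose $$\theta_t=\frac{t-1}t,\quad\beta_t=\frac2{t+1},\quad\alpha_t=\frac1{16\left(L_{yx}+L_{yy}+\rho\sigma_{y,\Phi}\sqrt t\right)},\quad\tau_t=\frac t{2\left(2L+(L_{xx}+L_{yx})t+\rho'(\sigma_{x,\Phi}+\sigma_{x,f})t^{3/2}\right)},$$ where $\rho,\rho'>0$ are constants independent of $(L,L_{xx},L_{yx},L_{yy},\sigma_{x,f},\sigma_{x,\Phi},\sigma_{y,\Phi},t)$. (A) If the gradient noises also have bounded variance, i.e., almost surely for all $t\ge1$, $\mathbb E_{t-1}[\|\delta_{y,\Phi}^t\|_*^2]\le\sigma_{y,\Phi}^2$, $\mathbb E_{t-1}[\|\delta_{x,\Phi}^t\|_*^2]\le\sigma_{x,\Phi}^2$ and $\mathbb E_{t-1}[\|\delta_{x,f}^t\|_*^2]\le\sigma_{x,f}^2$, then for any $T\ge3$, $$\begin{aligned}\mathbb E[G(\bar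 x^T,\bar y^T)]\le B_{\rm E}(T)\triangleq{}&\frac{16L}{T(T-1)}\Omega_{h_{\mathcal X}}+\frac{8(L_{xx}+L_{yx})}T\Omega_{h_{\mathcal X}}+\frac{128(L_{yx}+L_{yy})}T\Omega_{h_{\mathcal Y}}\\&+\frac{8\sigma_{y,\Phi}}{\sqrt T}\Big(\frac1\rho+16\rho\,\Omega_{h_{\mathcal Y}}\Big)+\frac{8(\sigma_{x,f}+\sigma_{x,\Phi})}{\sqrt T}\Big(\frac1{\rho'}+\rho'\,\Omega_{h_{\mathcal X}}\Big).\end{aligned}$$ In addition, for any $\varsigma\in(0,1]$, with probability at least $1-\varsigma$, $G(\bar x^T,\bar y^T)\le\varsigma^{-1}B_{\rm E}(T)$. (B) If the gradient noises are also sub-Gaussian, i.e., almost surely for all $t\ge1$, $\mathbb E_{t-1}[\exp(\|\delta_{y,\Phi}^t\|_*^2/\sigma_{y,\Phi}^2)]\le e$, $\mathbb E_{t-1}[\exp(\|\delta_{x,\Phi}^t\|_*^2/\sigma_{x,\Phi}^2)]\le e$ and $\mathbb E_{t-1}[\exp(\|\delta_{x,f}^t\|_*^2/\sigma_{x,f}^2)]\le e$, then for any $T\ge3$ and $\varsigma\in(0,1/6]$, with probability at least $1-6\varsigma$, $$G(\bar x^T,\bar y^T)\le B_{\rm E}(T)+\frac{8\sigma_{y,\Phi}}{\sqrt T}\Big(\frac{\log(1/\varsigma)}\rho+\sqrt{\log(1/\varsigma)}\,D_{\mathcal Y}\Big)+\frac{8(\sigma_{x,\Phi}+\sigma_{x,f})}{\sqrt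 T}\Big(\frac{\log(1/\varsigma)}{\rho'}+\sqrt{\log(1/\varsigma)}\,D_{\mathcal X}\Big).$$
   Context: **Problem.** $\mathbb X,\mathbb Y$ are finite-dimensional real normed spaces with duals $\mathbb X^*,\mathbb Y^*$; $\|\cdot\|$ and $\|\cdot\|_*$ denote primal and dual norms, $\langle\cdot,\cdot\rangle$ the duality pairing. $\mathcal X\subseteq\mathbb X$, $\mathcal Y\subseteq\mathbb Y$ are nonempty closed convex sets, and $S(x,y)\triangleq f(x)+g(x)+\Phi(x,y)-J(y)$, where $f,g:\mathbb X\to(-\infty,+\infty]$ and $J:\mathbb Y\to(-\infty,+\infty]$ are convex, closed and proper (CCP), $\operatorname{dom}g\cap\mathcal X\neq\emptyset$, $\operatorname{dom}J\cap\mathcal Y\ne\emptyset$. $f$ is differentiable on an open set containing $\mathcal X$, $\nabla f$ is $L$-Lipschitz on $\mathcal X$, and $f(x)\ge f(x')+\langle\nabla f(x'),x-x'\rangle+\frac\mu2\|x-x'\|^2$ for $x,x'\in\mathcal X$. $\Phi$ is convex in $x$, concave in $y$, differentiable on an open set containing $\mathcal X\times\mathcal Y$, and for all $x,x'\in\mathcal X$, $y,y'\in\mathcal Y$: $\|\nabla_x\Phi(x,y)-\nabla_x\Phi(x',y)\|_*\le L_{xx}\|x-x'\|$, $\|\nabla_x\Phi(x,y)-\nabla_x\Phi(x,y')\|_*\le L_{yx}\|y-y'\|$, $\|\nabla_y\Phi(x,y)-\nabla_y\Phi(x',y)\|_*\le L_{yx}\|x-x'\|$, $\|\nabla_y\Phi(x,y)-\nabla_y\Phi(x,y')\|_*\le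 L_{yy}\|y-y'\|$. A saddle point of $S$ on $\mathcal X\times\mathcal Y$ exists. Duality gap: $G(x,y)\triangleq\sup_{x'\in\mathcal X,y'\in\mathcal Y}[S(x,y')-S(x',y)]$. $D_{\mathcal U}\triangleq\sup_{u,u'\in\mathcal U}\|u-u'\|$. **Distance generating functions (DGFs).** For a nonempty closed convex set $\mathcal U$, a CCP function $h_{\mathcal U}$ is a DGF on $\mathcal U$ if it is continuous on $\mathcal U$, essentially smooth (continuously differentiable on $\operatorname{int}\operatorname{dom}h_{\mathcal U}\neq\emptyset$ with $\|\nabla h_{\mathcal U}(u^k)\|_*\to\infty$ whenever $u^k\in\operatorname{int}\operatorname{dom}h_{\mathcal U}$ converges to a boundary point of $\operatorname{dom}h_{\mathcal U}$), and $D_{h_{\mathcal U}}(u,u')\triangleq h_{\mathcal U}(u)-h_{\mathcal U}(u')-\langle\nabla h_{\mathcal U}(u'),u-u'\rangle\ge\frac12\|u-u'\|^2$ for $u\in\mathcal U$, $u'\in\mathcal U^o\triangleq\mathcal U\cap\operatorname{int}\operatorname{dom}h_{\mathcal U}$. $h_{\mathcal X}$, $h_{\mathcal Y}$ are fixed DGFs on $\mathcal X,\mathcal Y$, with Bregman diameters $\Omega_{h_{\mathcal X}}\triangleq\sup_{x\in\mathcal X,x'\in\mathcal X^o}D_{h_{\mathcal X}}(x,x')$ and $\Omega_{h_{\mathcal Y}}\triangleq\sup_{y\in\mathcal Y,y'\in\mathcal Y^o}D_{h_{\mathcal Y}}(y,y')$, such that the two minimization subproblems below always have unique solutions in $\mathcal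 Y^o\cap\operatorname{dom}J$ and $\mathcal X^o\cap\operatorname{dom}g$ respectively. **Algorithm** (parameters $\beta_t,\alpha_t,\tau_t,\theta_t$). Set $x^1=\bar x^1\in\mathcal X^o$, $y^1=\bar y^1\in\mathcal Y^o$, $s^1=\hat\nabla_y\Phi(x^1,y^1,\zeta_y^1)$. For $t=1,2,\dots$: - $y^{t+1}=\arg\min_{y\in\mathcal Y}J(y)-\langle s^t,y-y^t\rangle+\alpha_t^{-1}D_{h_{\mathcal Y}}(y,y^t)$; - $\tilde x^{t+1}=(1-\beta_t)\bar x^t+\beta_tx^t$; - $x^{t+1}=\arg\min_{x\in\mathcal X}g(x)+\langle\hat\nabla_x\Phi(x^t,y^{t+1},\zeta_x^t)+\hat\nabla f(\tilde x^{t+1},\xi^t),x-x^t\rangle+\tau_t^{-1}D_{h_{\mathcal X}}(x,x^t)$; - $s^{t+1}=(1+\theta_{t+1})\hat\nabla_y\Phi(x^{t+1},y^{t+1},\zeta_y^{t+1})-\theta_{t+1}\hat\nabla_y\Phi(x^t,y^t,\zeta_y^t)$; - $\bar x^{t+1}=(1-\beta_t)\bar x^t+\beta_tx^{t+1}$, $\ \bar y^{t+1}=(1-\beta_t)\bar y^t+\beta_ty^{t+1}$. **Noise.** $\hat\nabla$ denotes stochastic gradients driven by random variables $\zeta^t_y,\zeta^t_x,\xi^t$. Put $\delta_{y,\Phi}^t=\hat\nabla_y\Phi(x^t,y^t,\zeta^t_y)-\nabla_y\Phi(x^t,y^t)$, $\delta_{x,\Phi}^t=\hat\nabla_x\Phi(x^t,y^{t+1},\zeta^t_x)-\nabla_x\Phi(x^t,y^{t+1})$,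 $\delta_{x,f}^t=\hat\nabla f(\tilde x^{t+1},\xi^t)-\nabla f(\tilde x^{t+1})$. Let $\mathcal F_t$ be the $\sigma$-algebra generated by $\{(\zeta_x^i,\zeta_y^i,\xi^i)\}_{i=1}^t$ ($\mathcal F_0$ trivial) and $\mathbb E_t[\cdot]=\mathbb E[\cdot\mid\mathcal F_t]$. $\sigma_{y,\Phi},\sigma_{x,\Phi},\sigma_{x,f}>0$ are constants, entering through the noise conditions stated in the claim. *)

(* Defs.v *)
From HB Require Import structures.
From mathcomp Require Import all_boot all_order all_algebra.
From mathcomp Require Import all_classical all_reals all_analysis.
From mathcomp Require Import measurable_realfun.
Set Implicit Arguments.
Unset Strict Implicit.
Unset Printing Implicit Defensive.
Import Order.TTheory GRing.Theory Num.Theory.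
Import numFieldNormedType.Exports.
Local Open Scope classical_set_scope.
Local Open Scope ring_scope.

Section FiniteDimensional.
Context {R : realType}.

Definition finite_dim (E : lmodType R) : Prop :=
  exists (n : nat) (b : 'I_n -> E),
    forall x : E, exists c : 'I_n -> R, x = \sum_(i < n) c i *: b i.

(* Only used on linear forms of a finite-dimensional space, for which the
   supremum is taken over a bounded set. *)
Definition dual_norm {E : normedModType R} (l : E -> R) : R :=
  sup [set `|l v| | v in [set v : E | `|v| <= 1]].

Definition diameter {E : normedModType R} (U : set E) : \bar R :=
  ereal_sup [set (`|p.1 - p.2|)%:E | p in U `*` U].

(* The Borel sigma-algebra. *)
Definition borel (E : normedModType R) := g_sigma_algebraType (@open E).

End FiniteDimensional.

Section ExtendedConvexFunctions.
Context {R : realType} {E : normedModType R}.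
Implicit Types (h : E -> \bar R) (U : set E).

Definition edom h : set E := [set x | (h x < +oo)%E].

Definition econvex h : Prop :=
  forall (x y : E) (t : R), 0 <= t <= 1 ->
    (h (t *: x + (1 - t) *: y)%R <= t%:E * h x + (1 - t)%:E * h y)%E.

Record ccp h : Prop := CCP {
  ccp_gtNy : forall x, (-oo < h x)%E ;
  ccp_dom : edom h !=set0 ;
  ccp_convex : econvex h ;
  ccp_closed : lower_semicontinuous h }.

(* The derivative of an extended-real-valued function, meaningful at interior
   points of the set where it is finite. *)
Definition egrad h (u : E) : {linear E -> R} := 'd (fine \o h) u.

Definition bregman h (u u' : E) : \bar R :=
  (h u - h u' - (egrad h u' (u - u')%R)%:E)%E.

(* U^o in the usual notation of mirror descent. *)
Definition dgf_core U h : set E := U `&` (edom h)°.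

Definition bregman_diameter U h : \bar R :=
  ereal_sup [set bregman h p.1 p.2 | p in U `*` dgf_core U h].

Record is_dgf U h : Prop := IsDgf {
  dgf_ccp : ccp h ;
  dgf_continuous : {within U, continuous h} ;
  dgf_int_nonempty : (edom h)° !=set0 ;
  dgf_differentiable : forall u, (edom h)° u -> differentiable (fine \o h) u ;
  dgf_C1 : forall u, (edom h)° u ->
    dual_norm (egrad h v \- egrad h u) @[v --> u] --> (0 : R) ;
  dgf_blowup : forall (u_ : nat -> E) (ub : E),
    (forall k, (edom h)° (u_ k)) -> u_ @ \oo --> ub ->
    (closure (edom h) `\` (edom h)°) ub ->
    dual_norm (egrad h (u_ k)) @[k --> \oo] --> +oo ;
  dgf_strongly_convex : forall u u', U u -> dgf_core U h u' ->
    ((2^-1 * `|u - u'| ^+ 2)%:E <= bregman h u u')%E }.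

Definition argmin U (F : E -> \bar R) : set E :=
  [set u | U u /\ forall v, U v -> (F u <= F v)%E].

End ExtendedConvexFunctions.

Section SaddlePointProblem.
Context {R : realType} {X Y : normedModType R}.
Variables (XX : set X) (YY : set Y).
Variables (f g : X -> \bar R) (Phi : X -> Y -> R) (J : Y -> \bar R).

Definition gradx_Phi (x : X) (y : Y) : {linear X -> R} := 'd (Phi ^~ y) x.
Definition grady_Phi (x : X) (y : Y) : {linear Y -> R} := 'd (Phi x) y.

Definition saddle_fun (x : X) (y : Y) : \bar R :=
  (f x + g x + (Phi x y)%:E - J y)%E.

Definition saddle_point (xs : X) (ys : Y) : Prop :=
  [/\ XX xs, YY ys &
    forall x y, XX x -> YY y ->
      (saddle_fun xs y <= saddle_fun xs ys <= saddle_fun x ys)%E].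

Definition gap (x : X) (y : Y) : \bar R :=
  ereal_sup [set (saddle_fun x p.2 - saddle_fun p.1 y)%E | p in XX `*` YY].

Record saddle_problem (mu L Lxx Lyx Lyy : R) : Prop := SaddleProblem {
  sp_X_nonempty : XX !=set0 ;
  sp_X_closed : closed XX ;
  sp_X_convex : convex_set XX ;
  sp_Y_nonempty : YY !=set0 ;
  sp_Y_closed : closed YY ;
  sp_Y_convex : convex_set YY ;
  sp_f_ccp : ccp f ;
  sp_g_ccp : ccp g ;
  sp_J_ccp : ccp J ;
  sp_g_dom : edom g `&` XX !=set0 ;
  sp_J_dom : edom J `&` YY !=set0 ;
  sp_mu_ge0 : 0 <= mu ;
  sp_L_ge0 : 0 <= L ;
  sp_Lxx_ge0 : 0 <= Lxx ;
  sp_Lyx_ge0 : 0 <= Lyx ;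
  sp_Lyy_ge0 : 0 <= Lyy ;
  sp_f_differentiable : exists O : set X, [/\ open O, XX `<=` O &
    forall x, O x -> f x \is a fin_num /\ differentiable (fine \o f) x] ;
  sp_f_lipschitz : forall x x', XX x -> XX x' ->
    dual_norm (egrad f x \- egrad f x') <= L * `|x - x'| ;
  sp_f_strongly_convex : forall x x', XX x -> XX x' ->
    (f x' + (egrad f x' (x - x')%R)%:E + (mu / 2 * `|x - x'| ^+ 2)%:E
       <= f x)%E ;
  sp_Phi_convex : forall y, YY y -> convex_function XX (Phi ^~ y) ;
  sp_Phi_concave : forall x, XX x -> convex_function YY (fun y => - Phi x y) ;
  sp_Phi_differentiable : exists O : set (X * Y),
    [/\ open O, XX `*` YY `<=` O &
      forall p, O p -> differentiable (fun q : X * Y => Phi q.1 q.2) p] ;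
  sp_Phi_xx : forall x x' y, XX x -> XX x' -> YY y ->
    dual_norm (gradx_Phi x y \- gradx_Phi x' y) <= Lxx * `|x - x'| ;
  sp_Phi_xy : forall x y y', XX x -> YY y -> YY y' ->
    dual_norm (gradx_Phi x y \- gradx_Phi x y') <= Lyx * `|y - y'| ;
  sp_Phi_yx : forall x x' y, XX x -> XX x' -> YY y ->
    dual_norm (grady_Phi x y \- grady_Phi x' y) <= Lyx * `|x - x'| ;
  sp_Phi_yy : forall x y y', XX x -> YY y -> YY y' ->
    dual_norm (grady_Phi x y \- grady_Phi x y') <= Lyy * `|y - y'| ;
  sp_saddle : exists xs ys, saddle_point xs ys }.

End SaddlePointProblem.

Section ConditionalExpectation.
Context {R : realType} {d : measure_display} {Om : measurableType d}.
Variables (P : probability Om R) (G : set (set Om)).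

(* W is a version of E[Z | G], for Z integrable or nonnegative. *)
Record cond_expectation (Z W : Om -> \bar R) : Prop := CondExpectation {
  cond_expectation_measurable :
    forall B : set (\bar R), measurable B -> G (W @^-1` B) ;
  cond_expectation_integral : forall A : set Om, G A ->
    (\int[P]_(w in A) W w = \int[P]_(w in A) Z w)%E }.

Definition cond_expectation_le (Z : Om -> \bar R) (c : \bar R) : Prop :=
  exists2 W, cond_expectation Z W & {ae P, forall w, (W w <= c)%E}.

(* E[delta | G] = 0 almost surely, for a random linear form delta on E;
   tested against every vector, as E is finite-dimensional. *)
Definition cond_unbiased (E : normedModType R) (delta : Om -> E -> R) : Prop :=
  forall v : E, P.-integrable setT (fun w => (delta w v)%:E) /\
    cond_expectation (fun w => (delta w v)%:E) (cst 0%E).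

Definition cond_variance_le (E : normedModType R) (delta : Om -> E -> R)
    (sigma : R) : Prop :=
  cond_expectation_le (fun w => (dual_norm (delta w) ^+ 2)%:E) (sigma ^+ 2)%:E.

Definition cond_subgaussian (E : normedModType R) (delta : Om -> E -> R)
    (sigma : R) : Prop :=
  cond_expectation_le
    (fun w => (expR (dual_norm (delta w) ^+ 2 / sigma ^+ 2))%:E)
    (expR 1)%:E.

End ConditionalExpectation.

Section Filtration.
Context {d dx dy df : measure_display} {Om : measurableType d}.
Context {Zx : measurableType dx} {Zy : measurableType dy}.
Context {Zf : measurableType df}.
Variables (zx : nat -> Om -> Zx) (zy : nat -> Om -> Zy) (xi : nat -> Om -> Zf).

Definition noise_filtration (t : nat) : set (set Om) :=
  <<s \bigcup_(i in [set i | (1 <= i <= t)%N])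
        (preimage_set_system setT (zx i) measurable `|`
         preimage_set_system setT (zy i) measurable `|`
         preimage_set_system setT (xi i) measurable) >>.

End Filtration.

Section StochasticPrimalDual.
Context {R : realType} {X Y : normedModType R}.
Context {d dx dy df : measure_display} {Om : measurableType d}.
Context {Zx : measurableType dx} {Zy : measurableType dy}.
Context {Zf : measurableType df}.
Variables (XX : set X) (YY : set Y).
Variables (f g : X -> \bar R) (Phi : X -> Y -> R) (J : Y -> \bar R).
Variables (hX : X -> \bar R) (hY : Y -> \bar R).
(* The stochastic gradient oracles for the partial gradients of Phi in x and
   in y and for the gradient of f. *)
Variables (ox : X -> Y -> Zx -> {linear X -> R}).
Variables (oy : X -> Y -> Zy -> {linear Y -> R}).
Variables (of_ : X -> Zf -> {linear X -> R}).
Variables (zx : nat -> Om -> Zx) (zy : nat -> Om -> Zy) (xi : nat -> Om -> Zf).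

(* Measurability of a dual-valued map is measurability of all its pairings
   with fixed vectors. *)
Record measurable_oracles : Prop := MeasurableOracles {
  mo_x : forall v : X,
    measurable_fun ((XX `*` YY) `*` setT : set (borel X * borel Y * Zx))
      (fun p => ox p.1.1 p.1.2 p.2 v) ;
  mo_y : forall v : Y,
    measurable_fun ((XX `*` YY) `*` setT : set (borel X * borel Y * Zy))
      (fun p => oy p.1.1 p.1.2 p.2 v) ;
  mo_f : forall v : X,
    measurable_fun (XX `*` setT : set (borel X * Zf))
      (fun p => of_ p.1 p.2 v) }.

(* Index 0 of every sequence is unused, except that xt, the sequence of the
   points x tilde, starts at index 2. *)
Variables (beta alpha tau theta : nat -> R) (x1 : X) (y1 : Y).
Variables (x xb xt : nat -> Om -> X) (y yb : nat -> Om -> Y).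
Variable (s : nat -> Om -> Y -> R).

Definition y_objective (t : nat) (w : Om) (u : Y) : \bar R :=
  (J u - (s t w (u - y t w)%R)%:E
     + ((alpha t)^-1)%:E * bregman hY u (y t w))%E.

Definition x_objective (t : nat) (w : Om) (u : X) : \bar R :=
  (g u + (ox (x t w) (y t.+1 w) (zx t w) (u - x t w)
            + of_ (xt t.+1 w) (xi t w) (u - x t w))%R%:E
     + ((tau t)^-1)%:E * bregman hX u (x t w))%E.

Record spd_iterates : Prop := SpdIterates {
  spd_x1_core : dgf_core XX hX x1 ;
  spd_y1_core : dgf_core YY hY y1 ;
  spd_x1 : forall w, x 1 w = x1 /\ xb 1 w = x1 ;
  spd_y1 : forall w, y 1 w = y1 /\ yb 1 w = y1 ;
  spd_s1 : forall w v, s 1 w v = oy (x 1 w) (y 1 w) (zy 1 w) v ;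
  spd_y : forall t w, (1 <= t)%N ->
    argmin YY (y_objective t w) = [set y t.+1 w] /\
    (dgf_core YY hY `&` edom J) (y t.+1 w) ;
  spd_xt : forall t w, (1 <= t)%N ->
    xt t.+1 w = (1 - beta t) *: xb t w + beta t *: x t w ;
  spd_x : forall t w, (1 <= t)%N ->
    argmin XX (x_objective t w) = [set x t.+1 w] /\
    (dgf_core XX hX `&` edom g) (x t.+1 w) ;
  spd_s : forall t w v, (1 <= t)%N ->
    s t.+1 w v =
      (1 + theta t.+1) * oy (x t.+1 w) (y t.+1 w) (zy t.+1 w) v
        - theta t.+1 * oy (x t w) (y t w) (zy t w) v ;
  spd_xb : forall t w, (1 <= t)%N ->
    xb t.+1 w = (1 - beta t) *: xb t w + beta t *: x t.+1 w ;
  spd_yb : forall t w, (1 <= t)%N ->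
    yb t.+1 w = (1 - beta t) *: yb t w + beta t *: y t.+1 w }.

Definition delta_yPhi (t : nat) (w : Om) : Y -> R :=
  oy (x t w) (y t w) (zy t w) \- grady_Phi Phi (x t w) (y t w).

Definition delta_xPhi (t : nat) (w : Om) : X -> R :=
  ox (x t w) (y t.+1 w) (zx t w) \- gradx_Phi Phi (x t w) (y t.+1 w).

Definition delta_xf (t : nat) (w : Om) : X -> R :=
  of_ (xt t.+1 w) (xi t w) \- egrad f (xt t.+1 w).

End StochasticPrimalDual.

Section StepSizes.
Context {R : realType}.
Variables (L Lxx Lyx Lyy syPhi sxPhi sxf rho rho' : R).

Definition theta_ (t : nat) : R := (t%:R - 1) / t%:R.
Definition beta_ (t : nat) : R := 2 / (t%:R + 1).
Definition alpha_ (t : nat) : R :=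
  1 / (16 * (Lyx + Lyy + rho * syPhi * Num.sqrt t%:R)).
Definition tau_ (t : nat) : R :=
  t%:R / (2 * (2 * L + (Lxx + Lyx) * t%:R
               + rho' * (sxPhi + sxf) * t%:R `^ (3 / 2))).

(* OmX and OmY are the Bregman diameters. *)
Definition B_E (OmX OmY : \bar R) (T : nat) : \bar R :=
  ((16 * L / (T%:R * (T%:R - 1)))%:E * OmX
   + (8 * (Lxx + Lyx) / T%:R)%:E * OmX
   + (128 * (Lyx + Lyy) / T%:R)%:E * OmY
   + (8 * syPhi / Num.sqrt T%:R)%:E * ((rho^-1)%:E + (16 * rho)%:E * OmY)
   + (8 * (sxf + sxPhi) / Num.sqrt T%:R)%:E
       * ((rho'^-1)%:E + rho'%:E * OmX))%E.

(* The additional term of the high-probability bound; DX and DY are the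
   diameters. *)
Definition B_sG (DX DY : \bar R) (T : nat) (vs : R) : \bar R :=
  ((8 * syPhi / Num.sqrt T%:R)%:E
     * ((ln vs^-1 / rho)%:E + (Num.sqrt (ln vs^-1))%:E * DY)
   + (8 * (sxPhi + sxf) / Num.sqrt T%:R)%:E
     * ((ln vs^-1 / rho')%:E + (Num.sqrt (ln vs^-1))%:E * DX))%E.

End StepSizes.

(* Main.v *)
(** By the three-point inequality of the two proximal steps and the weights
    [t] of the averages, [t (t + 1) / 2 * (S (xb, v) - S (u, yb))] telescopes,
    up to Bregman distances with nondecreasing coefficients [t / tau_t] and
    [t / alpha_t] and up to noise terms linear in [(u, v)]. Since the gap is a
    supremum over [(u, v)], these terms are decoupled by dual averaging: the
    noise is a sequence of linear forms, against which the predictable mirror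
    points [xhat] and [yhat] have small regret uniformly in [(u, v)]. What is
    left does not depend on [(u, v)]: a martingale, which has mean zero and,
    for sub-Gaussian noise, the moment bound given by
    [exp x <= x + exp (2 x ^ 2)], and averages of squared dual norms of the
    noise. The iterates are measurable because they depend continuously on
    finitely many real random variables, a property stable under every step of
    the algorithm, including the argmins. *)

Require Import Defs.
From mathcomp Require Import all_boot all_order all_algebra.
From mathcomp Require Import all_classical all_reals all_analysis.
From mathcomp Require Import measurable_realfun.
From mathcomp Require Import ring lra.
Import Order.TTheory GRing.Theory Num.Theory.
Import numFieldNormedType.Exports.
Local Open Scope classical_set_scope.
Local Open Scope ring_scope.
Set Implicit Arguments.
Unset Strict Implicit.
Unset Printing Implicit Defensive.

(** * Finite-dimensional spaces and their linear forms *)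

(** The noise of a step acts on the new iterate, with which it is correlated. It is moved to the old
    iterate, and Young's inequality charges the displacement to the Bregman distance between the
    two; the [t * sqrt t] parts of [t / tau_t] and [t / alpha_t] are there for that, and leave
    squared noise norms with weights of order [sqrt t]. In [y] each noise occurs in two successive
    extrapolated gradients, and each occurrence gets half of that allowance. Dual averaging uses one
    parameter of order [m * sqrt (m + 1)], the order of the noise part of the algorithm's own
    coefficients.

    Finite Bregman diameters also make the DGFs finite and the sets bounded, hence compact, so that
    mirror points exist. Strong convexity is given only relative to points of the core and has to be
    extended to the whole set.

    Conditional expectations are known only through integrals over events of the filtration, so
    taking out a predictable factor has to be derived from these. Three martingales and three
    averages of squared norms make the six exceptional events of the tail bound. *)

Lemma continuous_bigsum (R : realType) (T : topologicalType)
    (V : normedModType R) (I : Type) (s : seq I) (F : I -> T -> V) (t : T) :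
  (forall i, {for t, continuous (F i)}) ->
  {for t, continuous (fun u => \sum_(i <- s) F i u)}.
Proof.
move=> cF; elim: s => [|i s IH].
  rewrite (_ : (fun _ => _) = cst 0); first exact: cst_continuous.
  by apply/funext => u; rewrite big_nil.
rewrite (_ : (fun _ => _) = (F i \+ (fun u => \sum_(j <- s) F j u))).
  exact: continuousD.
by apply/funext => u; rewrite big_cons.
Qed.

Section FiniteDim.
Context {R : realType} {E : normedModType R}.

(** A spanning family of minimal length is free, since a nontrivial relation would express one of
    its vectors by the others. Coordinates are then unique, hence linear. *)
Lemma findim_coord : finite_dim E ->
  exists n (b : 'I_n -> E) (c : 'I_n -> E -> R),
    [/\ forall i, scalar (c i), forall x, x = \sum_i c i x *: b i,
     forall d : 'I_n -> R, \sum_i d i *: b i = 0 -> forall i, d i = 0 &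
     forall d i, c i (\sum_j d j *: b j) = d i].
Proof.
move=> fdE.
pose spanning n (b : 'I_n -> E) :=
  forall x : E, exists c : 'I_n -> R, x = \sum_(i < n) c i *: b i.
have exP : exists n, `[< exists b : 'I_n -> E, spanning n b >].
  by case: fdE => n [b hb]; exists n; apply/asboolP; exists b.
case: (ex_minnP exP) => n /asboolP [b sb] nmin.
have free d : \sum_i d i *: b i = 0 -> forall i, d i = 0.
  move=> d0 j; apply/eqP; apply/negPn/negP => dj.
  case: n b sb nmin d d0 j dj => [|n] b sb nmin d d0 j dj; first by case: j {dj}.
  suff : (n.+1 <= n)%N by rewrite ltnn.
  apply: nmin; apply/asboolP; exists (fun i => b (lift j i)) => x.
  have [c ->] := sb x.
  exists (fun i => c (lift j i) - c j / d j * d (lift j i)).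
  have -> : \sum_i c i *: b i = \sum_i (c i - c j / d j * d i) *: b i.
    under [RHS]eq_bigr do rewrite scalerBl -scalerA.
    by rewrite sumrB -scaler_sumr d0 scaler0 subr0.
  by rewrite (bigD1_ord j) //= divfK // subrr scale0r add0r.
have inj d d' : \sum_i d i *: b i = \sum_i d' i *: b i -> forall i, d i = d' i.
  move=> /eqP; rewrite -subr_eq0 -sumrB => /eqP dd i.
  apply/eqP; rewrite -subr_eq0; apply/eqP; move: i; apply: free.
  by rewrite -[RHS]dd; apply: eq_bigr => i _; rewrite scalerBl.
have [c hc] := choice sb.
exists n, b, (fun i x => c x i); split => //.
- move=> i a u v; apply: (inj _ (fun i => a * c u i + c v i)).
  rewrite -hc; under eq_bigr do rewrite scalerDl -scalerA.
  by rewrite big_split /= -scaler_sumr -!hc.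
- by move=> d; apply: inj; rewrite -hc.
Qed.

(** On the unit sphere of coordinate space, which is compact, the norm of the combination attains a
    minimum, positive by freeness; its inverse is the constant. *)
Lemma coord_bounded n (b : 'I_n -> E) (c : 'I_n -> E -> R) :
  (forall x, x = \sum_i c i x *: b i) ->
  (forall d : 'I_n -> R, \sum_i d i *: b i = 0 -> forall i, d i = 0) ->
  exists2 C, 0 <= C & forall i x, `|c i x| <= C * `|x|.
Proof.
(* In dimension 0 the unit sphere is empty and there is no minimum to take. *)
case: n b c => [|n] b c cb free; first by exists 0 => // -[].
pose phi (r : 'rV[R]_n.+1) := \sum_i r 0 i *: b i.
have phic : continuous phi.
  move=> r; apply: continuous_bigsum => i; apply: continuousZr_tmp.
  exact: coord_continuous.
pose S := [set r : 'rV[R]_n.+1 | `|r| = 1].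
have S0 : S !=set0 by exists (const_mx 1); rewrite /S /= [LHS]mx_normrE;
  apply/eqP; rewrite eq_le; apply/andP; split;
  [apply/bigmax_leP; split => // i _; rewrite mxE normr1
  | apply: (le_trans _ (le_bigmax _ _ (ord0, ord0))); rewrite /= mxE normr1].
have cS : compact S.
  apply: bounded_closed_compact.
    exists 1; split; first exact: num_real.
    by move=> x x1 y; rewrite /S /= => ->; exact: ltW.
  apply: (@preimage_closed _ _ (fun r : 'rV[R]_n.+1 => `|r|) [set 1]).
    by move=> r _; exact: norm_continuous.
  exact: closed_eq.
have [r0 /set_mem r0S rmin] : exists2 r0, r0 \in S & forall r, r \in S -> `|phi r0| <= `|phi r|.
  apply: compact_EVT_min => //; apply: continuous_subspaceT => r.
  by apply: (continuous_comp (phic r)); exact: norm_continuous.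
have m0 : 0 < `|phi r0|.
  rewrite normr_gt0; apply/eqP => /free r00.
  move: r0S; rewrite /S /= (_ : r0 = 0) ?normr0; first by move/eqP; rewrite eq_sym oner_eq0.
  by apply/rowP => i; rewrite r00 mxE.
exists (`|phi r0|)^-1; first by rewrite invr_ge0.
move=> i x; pose r := \row_j c j x.
have phir : phi r = x by rewrite [RHS]cb; apply: eq_bigr => j _; rewrite mxE.
have cr : `|c i x| <= `|r|.
  rewrite [leRHS]mx_normrE; apply: le_trans (le_bigmax _ _ (0, i)) => /=.
  by rewrite mxE.
apply: (le_trans cr).
have [->|rn0] := eqVneq r 0; first by rewrite normr0 mulr_ge0 ?invr_ge0.
have rp : 0 < `|r| by rewrite normr_gt0.
rewrite ler_pdivlMl // mulrC -ler_pdivlMl // -phir.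
have -> : `|r|^-1 * `|phi r| = `|phi (`|r|^-1 *: r)|.
  rewrite -[X in X * _](ger0_norm) ?invr_ge0 // -normrZ; congr (`|_|).
  by rewrite /phi scaler_sumr; apply: eq_bigr => j _; rewrite [in RHS]mxE scalerA.
by apply: rmin; apply/mem_set; rewrite /S /= normrZ ger0_norm ?invr_ge0 // mulVf ?gt_eqF.
Qed.

End FiniteDim.

Section Dual.
Context {R : realType} {E : normedModType R}.
Implicit Types l : E -> R.

Section Scalar.
Variables (l : E -> R) (sl : scalar l).

Lemma scalar0 : l 0 = 0.
Proof. by have := sl 1 0 0; rewrite scaler0 addr0 mul1r => /eqP; rewrite -subr_eq0 opprD addNKr oppr_eq0 => /eqP. Qed.

Lemma scalarD u v : l (u + v) = l u + l v.
Proof. by rewrite -[u]scale1r sl mul1r scale1r. Qed.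

Lemma scalarZ a u : l (a *: u) = a * l u.
Proof. by rewrite -[a *: u]addr0 sl scalar0 addr0. Qed.

Lemma scalarN u : l (- u) = - l u.
Proof. by rewrite -scaleN1r scalarZ mulN1r. Qed.

Lemma scalarB u v : l (u - v) = l u - l v.
Proof. by rewrite scalarD scalarN. Qed.

Lemma scalar_sum (I : Type) (s : seq I) (a : I -> R) (v : I -> E) :
  l (\sum_(i <- s) a i *: v i) = \sum_(i <- s) a i * l (v i).
Proof.
elim: s => [|i s IH]; first by rewrite !big_nil scalar0.
by rewrite !big_cons sl IH.
Qed.

End Scalar.

Lemma scalar_addf l l' : scalar l -> scalar l' -> scalar (l \+ l').
Proof. by move=> sl sl' a u v /=; rewrite sl sl'; ring. Qed.

Lemma scalar_subf l l' : scalar l -> scalar l' -> scalar (l \- l').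
Proof. by move=> sl sl' a u v /=; rewrite sl sl'; ring. Qed.

Lemma scalar_scalef k l : scalar l -> scalar (fun v => k * l v).
Proof. by move=> sl a u v /=; rewrite sl; ring. Qed.

Lemma scalar_linear (l : {linear E -> R}) : scalar l.
Proof. by move=> a u v; rewrite linearP. Qed.

Lemma dual_norm_le l K : 0 <= K -> (forall v, `|l v| <= K * `|v|) ->
  dual_norm l <= K.
Proof.
move=> K0 lK; apply: ge_sup.
  by exists `|l 0|; exists 0 => //=; rewrite normr0.
move=> _ [v /= v1 <-]; apply: (le_trans (lK v)).
by rewrite -[leRHS]mulr1 ler_wpM2l.
Qed.

Hypothesis fdE : finite_dim E.

(** The vectors and the constant do not depend on the form: small values on finitely many vectors
    make the dual norm small. [controlled_dual] relies on this uniformity. *)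
Lemma dual_norm_coord : exists n (b : 'I_n -> E) (C : R), 0 <= C /\
  forall l, scalar l -> forall v, `|l v| <= (C * \sum_i `|l (b i)|) * `|v|.
Proof.
have [n [b [c [cs cb free _]]]] := findim_coord fdE.
have [C C0 cC] := coord_bounded cb free.
exists n, b, C; split => // l sl v.
rewrite {1}(cb v) scalar_sum // (le_trans (ler_norm_sum _ _ _)) //.
rewrite mulrAC mulr_sumr; apply: ler_sum => i _.
by rewrite normrM ler_wpM2r.
Qed.

Lemma scalar_bounded l : scalar l ->
  exists2 K, 0 <= K & forall v, `|l v| <= K * `|v|.
Proof.
move=> sl; have [n [b [C [C0 h]]]] := dual_norm_coord.
exists (C * \sum_i `|l (b i)|); last exact: h.
by rewrite mulr_ge0 // sumr_ge0.
Qed.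

Lemma dual_norm_has_sup l : scalar l ->
  has_sup [set `|l v| | v in [set v : E | `|v| <= 1]].
Proof.
move=> sl; have [K K0 lK] := scalar_bounded sl; split.
  by exists `|l 0|; exists 0 => //=; rewrite normr0.
exists K => _ [v /= v1 <-]; apply: (le_trans (lK v)).
by rewrite -[leRHS]mulr1 ler_wpM2l.
Qed.

Lemma dual_norm_ge0 l : scalar l -> 0 <= dual_norm l.
Proof.
move=> sl; have [_ ub] := dual_norm_has_sup sl.
apply: (le_trans (normr_ge0 (l 0))).
by apply: ub_le_sup => //; exists 0 => //=; rewrite normr0.
Qed.

Lemma le_dual_norm l v : scalar l -> `|l v| <= dual_norm l * `|v|.
Proof.
move=> sl; have [->|v0] := eqVneq v 0; first by rewrite scalar0 // !normr0 mulr0.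
have vp : 0 < `|v| by rewrite normr_gt0.
rewrite -ler_pdivrMr // mulrC -[X in X * _]ger0_norm ?invr_ge0 //.
rewrite -normrM -scalarZ //; have [_ ub] := dual_norm_has_sup sl.
apply: ub_le_sup => //; exists (`|v|^-1 *: v) => //=.
by rewrite normrZ ger0_norm ?invr_ge0 // mulVf ?gt_eqF.
Qed.

Lemma dual_norm_pairing l v : scalar l -> l v <= dual_norm l * `|v|.
Proof. by move=> sl; apply: le_trans (le_dual_norm v sl); exact: ler_norm. Qed.

Lemma dual_normD l l' : scalar l -> scalar l' ->
  dual_norm (l \+ l') <= dual_norm l + dual_norm l'.
Proof.
move=> sl sl'; apply: dual_norm_le => [|v /=].
  by rewrite addr_ge0 ?dual_norm_ge0.
by rewrite mulrDl (le_trans (ler_normD _ _)) ?lerD ?le_dual_norm.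
Qed.

Lemma dual_normN l : dual_norm (fun v => - l v) = dual_norm l.
Proof.
by congr (sup (image _ _)); apply/funext => v; rewrite normrN.
Qed.

Lemma dual_norm_dist l l' : scalar l -> scalar l' ->
  `|dual_norm l - dual_norm l'| <= dual_norm (l \- l').
Proof.
move=> sl sl'; have sd := scalar_subf sl sl'.
have h (k k' : E -> R) : scalar k -> scalar k' ->
    dual_norm k <= dual_norm (k \- k') + dual_norm k'.
  move=> sk sk'; have := dual_normD (scalar_subf sk sk') sk'.
  by rewrite (_ : _ \+ _ = k) //; apply/funext => v /=; rewrite subrK.
have := h _ _ sl sl'; have := h _ _ sl' sl.
rewrite (_ : dual_norm (l' \- l) = dual_norm (l \- l')).
  by move=> *; rewrite ler_norml; apply/andP; split; lra.
by rewrite -[RHS]dual_normN; congr dual_norm; apply/funext => v /=; rewrite opprB.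
Qed.

Lemma scalar_continuous l : scalar l -> continuous l.
Proof.
move=> sl; have [K K0 lK] := scalar_bounded sl.
have K1 : 0 < K + 1 by rewrite ltr_wpDl.
move=> x; apply/cvgrPdist_le => e e0; near=> y.
rewrite -scalarB // (le_trans (lK _)) // (@le_trans _ _ ((K + 1) * `|x - y|)) //.
  by rewrite ler_wpM2r // lerDl.
rewrite -ler_pdivlMl //; near: y.
by apply: cvgr_dist_le; rewrite ?mulr_gt0 ?invr_gt0 //; exact: cvg_id.
Unshelve. all: by end_near. Qed.

(** Compactness is carried over from coordinate space: [A] is the continuous image of its preimage,
    which is closed, and bounded by [coord_bounded]. *)
Lemma bounded_closed_compact_findim (A : set E) (M : R) :
  closed A -> (forall x, A x -> `|x| <= M) -> compact A.
Proof.
move=> Acl AM; have [n [b [c [cs cb free bc]]]] := findim_coord fdE.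
have [C C0 cC] := coord_bounded cb free.
pose phi (r : 'rV[R]_n) := \sum_i r 0 i *: b i.
have phic : continuous phi.
  by move=> r; apply: continuous_bigsum => i; apply: continuousZr_tmp; exact: coord_continuous.
pose B := phi @^-1` A.
have -> : A = phi @` B.
  apply/seteqP; split => [x Ax|_ [r Br <-]//].
  have xE : phi (\row_i c i x) = x.
    by rewrite [RHS]cb; apply: eq_bigr => i _; rewrite mxE.
  by exists (\row_i c i x) => //; rewrite /B /= xE.
apply: continuous_compact; first exact: continuous_subspaceT.
apply: bounded_closed_compact; last exact: preimage_closed.
exists (C * M); split; first exact: num_real.
move=> N CMN r /AM rM; apply: le_trans (ltW CMN).
rewrite [leLHS]mx_normrE; apply/bigmax_leP.
have M0 : 0 <= M by exact: le_trans (normr_ge0 _) rM.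
split; first exact: mulr_ge0.
move=> [i j] _ /=; rewrite ord1 -(bc (fun j => r 0 j) j).
by apply: (le_trans (cC _ _)); rewrite ler_wpM2l.
Qed.

End Dual.

(** * Proximal steps and distance generating functions *)

Section Differential.
Context {R : realType} {E : normedModType R}.
Implicit Types (phi : E -> R) (A : set E).

Lemma convex_setE A x y (t : R) : convex_set A -> A x -> A y -> 0 <= t <= 1 ->
  A (t *: x + (1 - t) *: y).
Proof.
move=> cA Ax Ay t01.
have [t0 t1] := andP t01.
have tp : (0 : R) <= t <= 1 by [].
pose k : {i01 R} := Itv01 t0 t1.
by have := cA x y k (mem_set Ax) (mem_set Ay); rewrite inE.
Qed.

Lemma convex_functionE A phi x y (t : R) : convex_function A phi ->
  A x -> A y -> 0 <= t <= 1 ->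
  phi (t *: x + (1 - t) *: y) <= t * phi x + (1 - t) * phi y.
Proof.
move=> cA Ax Ay /andP[t0 t1].
exact: (cA (Itv01 t0 t1) x y (mem_set Ax) (mem_set Ay)).
Qed.

(** The approach is one-sided because a convex set only provides the points [x + k *: d] with
    [0 < k <= 1]. *)
Lemma differential_quotient phi x d (e : R) : differentiable phi x -> 0 < e ->
  \forall k \near (0 : R)^'+, `|phi (x + k *: d) - phi x - k * 'd phi x d| <= e * k.
Proof.
move=> dphi e0.
have dd : derivable phi x d by exact: diff_derivable.
have h : (k^-1 *: ((phi \o shift x) (k *: d) - phi x)) @[k --> (0 : R)^'+] --> 'd phi x d.
  by apply: cvg_dnbhs_at_right; rewrite -deriveE.
move/cvgrPdist_le : h => /(_ _ e0) h.
near=> k.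
have k0 : 0 < k by near: k; exact: nbhs_right_gt.
have hk : `|'d phi x d - k^-1 *: ((phi \o shift x) (k *: d) - phi x)| <= e by near: k.
have -> : phi (x + k *: d) - phi x - k * 'd phi x d =
    - (k * ('d phi x d - k^-1 *: ((phi \o shift x) (k *: d) - phi x))).
  by rewrite /= /GRing.scale /= [k *: d + x]addrC mulrBr mulVKf ?gt_eqF // opprB.
by rewrite normrN normrM gtr0_norm // mulrC ler_pM2r.
Unshelve. all: by end_near. Qed.

Lemma differential_le phi x d (c : R) : differentiable phi x ->
  (forall k, 0 < k <= 1 -> phi (x + k *: d) - phi x <= k * c) ->
  'd phi x d <= c.
Proof.
move=> dphi h; apply/ler_addgt0Pr => e e0.
have /(_ _ _)/filter_ex [] := filterI (nbhs_right_le (ltr01)) (filterI (nbhs_right_gt (0:R)) (differential_quotient d dphi e0)).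
move=> k [k1 [k0]]; rewrite ler_norml => /andP[h1 _].
have := h k; rewrite k0 k1 => /(_ isT) h2.
by rewrite -(ler_pM2l k0); lra.
Qed.

Lemma differential_ge phi x d (c : R) : differentiable phi x ->
  (forall k, 0 < k <= 1 -> k * c <= phi (x + k *: d) - phi x) ->
  c <= 'd phi x d.
Proof.
move=> dphi h; apply/ler_addgt0Pr => e e0.
have /(_ _ _)/filter_ex [] := filterI (nbhs_right_le (ltr01)) (filterI (nbhs_right_gt (0:R)) (differential_quotient d dphi e0)).
move=> k [k1 [k0]]; rewrite ler_norml => /andP[_ h1].
have := h k; rewrite k0 k1 => /(_ isT) h2.
by rewrite -(ler_pM2l k0); lra.
Qed.

Lemma segment_convE (x y : E) (k : R) : x + k *: (y - x) = k *: y + (1 - k) *: x.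
Proof. by rewrite scalerBr scalerBl scale1r addrCA. Qed.

Lemma convex_gradient A phi x y : convex_function A phi ->
  differentiable phi x -> A x -> A y -> 'd phi x (y - x) <= phi y - phi x.
Proof.
move=> cphi dphi Ax Ay; apply: differential_le => // k /andP[k0 k1].
rewrite segment_convE.
have := convex_functionE cphi Ay Ax; move=> /(_ k); rewrite (ltW k0) k1 => /(_ isT).
lra.
Qed.

End Differential.

Section Prox.
Context {R : realType} {E : normedModType R}.
Implicit Types (h : E -> \bar R) (U : set E).

Definition rbregman h (u v : E) : R :=
  fine (h u) - fine (h v) - egrad h v (u - v).

Lemma bregmanE h u v : h u \is a fin_num -> h v \is a fin_num ->
  bregman h u v = (rbregman h u v)%:E.
Proof. by move=> hu hv; rewrite /bregman -(fineK hu) -(fineK hv) -!EFinB. Qed.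

Lemma rbregman_three_point h u v w :
  rbregman h u v - rbregman h u w - rbregman h w v =
  egrad h w (u - w) - egrad h v (u - w).
Proof.
rewrite /rbregman (_ : u - v = (u - w) + (w - v)); last by rewrite subrKA.
by rewrite linearD; ring.
Qed.

Lemma fin_num_edom h u : (forall x, (-oo < h x)%E) -> edom h u ->
  h u \is a fin_num.
Proof. by move=> hNy hu; rewrite fin_numElt hNy. Qed.

Lemma econvex_fine h x y (t : R) : econvex h -> h x \is a fin_num ->
  h y \is a fin_num -> (-oo < h (t *: x + (1 - t) *: y)%R)%E -> 0 <= t <= 1 ->
  fine (h (t *: x + (1 - t) *: y)) <= t * fine (h x) + (1 - t) * fine (h y).
Proof.
move=> ch hx hy hz t01.
have hle : (h (t *: x + (1 - t) *: y)%R <=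
    (t * fine (h x) + (1 - t) * fine (h y))%:E)%E.
  by have := ch x y t t01; rewrite -{1}(fineK hx) -{1}(fineK hy) -!EFinM -EFinD.
have hf : h (t *: x + (1 - t) *: y) \is a fin_num.
  by rewrite fin_numElt hz /=; exact: le_lt_trans hle (ltry _).
by rewrite -lee_fin fineK.
Qed.

Lemma edom_convex h x y (t : R) : (forall x, (-oo < h x)%E) -> econvex h ->
  edom h x -> edom h y -> 0 <= t <= 1 -> edom h (t *: x + (1 - t) *: y).
Proof.
move=> hNy ch hx hy t01; have := ch x y t t01.
rewrite -(fineK (fin_num_edom hNy hx)) -(fineK (fin_num_edom hNy hy)) -!EFinM -EFinD.
by move=> /le_lt_trans; apply; exact: ltry.
Qed.

(** First-order optimality without subdifferentials: [yp] is compared with the points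
    [yp + k *: (u - yp)], [J] is bounded by convexity, and after division by [k] only [h]
    contributes a derivative as [k] tends to 0. *)
Lemma prox_ineq U h (J : E -> \bar R) (l : E -> R) (a : R) (y0 yp u : E) :
  convex_set U -> ccp J -> scalar l ->
  (forall v, U v -> h v \is a fin_num) ->
  U yp -> differentiable (fine \o h) yp -> edom J yp -> U u -> edom J u ->
  U y0 ->
  (forall v, U v -> (J yp + (l (yp - y0)%R)%:E + a%:E * bregman h yp y0 <=
     J v + (l (v - y0)%R)%:E + a%:E * bregman h v y0)%E) ->
  0 <= a ->
  fine (J yp) + l (yp - u) + a * (egrad h yp (yp - u) - egrad h y0 (yp - u))
    <= fine (J u).
Proof.
move=> cU [JNy _ cJ _] sl hfin Uyp dh Jyp Uu Ju Uy0 opt a0.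
have Jypf := fin_num_edom JNy Jyp; have Juf := fin_num_edom JNy Ju.
pose c := egrad h yp (u - yp).
pose rhs := fine (J u) + l (u - yp) - a * egrad h y0 (u - yp).
suff H : fine (J yp) - rhs <= a * c.
  have e1 : egrad h yp (yp - u) = - c by rewrite -opprB linearN.
  have e2 : egrad h y0 (yp - u) = - egrad h y0 (u - yp) by rewrite -opprB linearN.
  have e3 : l (yp - u) = - l (u - yp) by rewrite -opprB (scalarN sl).
  by move: H; rewrite e1 e2 e3 /rhs; lra.
have step k : 0 < k <= 1 -> k * (fine (J yp) - rhs) <=
    a * (fine (h (yp + k *: (u - yp))) - fine (h yp)).
  move=> /andP[k0 k1]; have k01 : 0 <= k <= 1 by rewrite ltW.
  pose v := yp + k *: (u - yp).
  have vE : v = k *: u + (1 - k) *: yp by rewrite /v segment_convE.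
  have Uv : U v by rewrite vE; exact: convex_setE.
  have Jv : edom J v by rewrite vE; exact: edom_convex.
  have Jvf := fin_num_edom JNy Jv.
  have := opt _ Uv.
  rewrite !bregmanE ?hfin // -(fineK Jypf) -(fineK Jvf) -!EFinM -!EFinD lee_fin.
  have Jle : fine (J v) <= k * fine (J u) + (1 - k) * fine (J yp).
    by rewrite vE; apply: econvex_fine => //; rewrite -vE.
  rewrite /rbregman.
  have ev : v - y0 = (yp - y0) + k *: (u - yp) by rewrite /v addrAC.
  have lE (l' : E -> R) : scalar l' -> l' (v - y0) = l' (yp - y0) + k * l' (u - yp).
    by move=> sl'; rewrite ev (scalarD sl') (scalarZ sl').
  rewrite (lE _ sl) (lE _ (scalar_linear (egrad h y0))) /rhs.
  rewrite -/v; lra.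
(* For [a = 0] there is no derivative to take, and the comparison at [k = 1] is already the
   claim. *)
move: a0; rewrite le_eqVlt => /predU1P[a00|a0].
  by have := step 1; rewrite ltr01 lexx -a00 !mul0r mul1r => /(_ isT).
rewrite mulrC -ler_pdivrMr //; apply: differential_ge => // k k01.
by rewrite mulrA ler_pdivrMr // [leRHS]mulrC; exact: step.
Qed.

End Prox.

(** * Distance generating functions and dual averaging *)

Section Dgf.
Context {R : realType} {E : normedModType R}.
Variables (U : set E) (h : E -> \bar R) (u1 : E).
Hypotheses (fdE : finite_dim E) (Ucl : closed U) (cU : convex_set U).
Hypotheses (hdgf : is_dgf U h) (Ofin : (bregman_diameter U h < +oo)%E).
Hypothesis core1 : dgf_core U h u1.

Let Omega := fine (bregman_diameter U h).
Let D := rbregman h.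

Lemma dgf_core_fin u : dgf_core U h u -> h u \is a fin_num.
Proof.
move=> [Uu /interior_subset hu].
by apply: fin_num_edom => //; exact: ccp_gtNy (dgf_ccp hdgf).
Qed.

(** A DGF may take the value [+oo] on [U]. A finite Bregman diameter excludes it, because the other
    terms of [bregman h u u1] are finite at the fixed core point [u1]. *)
Lemma dgf_fin u : U u -> h u \is a fin_num.
Proof.
move=> Uu; rewrite fin_numElt (ccp_gtNy (dgf_ccp hdgf)) /=.
have : (bregman h u u1 < +oo)%E.
  by apply: le_lt_trans Ofin; apply: ereal_sup_ubound; exists (u, u1).
have := ccp_gtNy (dgf_ccp hdgf) u; rewrite /bregman.
rewrite -(fineK (dgf_core_fin core1)); by case: (h u).
Qed.

Lemma Omega_bounds : 0 <= Omega /\ bregman_diameter U h = Omega%:E.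
Proof.
have ge0 : (0 <= bregman_diameter U h)%E.
  have h1 := dgf_core_fin core1.
  apply: (@le_trans _ _ (bregman h u1 u1)).
    by rewrite bregmanE // /rbregman !subrr linear0 subrr.
  by apply: ereal_sup_ubound; exists (u1, u1) => //; split => //; case: core1.
split; first by rewrite fine_ge0.
by rewrite /Omega fineK // ge0_fin_numE.
Qed.

Lemma rbregman_le u v : U u -> dgf_core U h v -> D u v <= Omega.
Proof.
move=> Uu cv; rewrite -lee_fin -(Omega_bounds.2) -bregmanE ?dgf_fin //; last by case: cv.
by apply: ereal_sup_ubound; exists (u, v).
Qed.

Lemma rbregman_ge u v : U u -> dgf_core U h v -> 2^-1 * `|u - v| ^+ 2 <= D u v.
Proof.
move=> Uu cv; have := dgf_strongly_convex hdgf Uu cv.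
by rewrite bregmanE ?dgf_fin ?lee_fin //; case: cv.
Qed.

Lemma dgf_bounded u : U u -> `|u| <= `|u1| + Num.sqrt (2 * Omega).
Proof.
move=> Uu; have := rbregman_ge Uu core1; have := rbregman_le Uu core1 => h1 h2.
have : `|u - u1| ^+ 2 <= 2 * Omega by lra.
rewrite -ler_sqrt; last by rewrite mulr_ge0 // Omega_bounds.1.
rewrite sqrtr_sqr normr_id => h3.
by rewrite -[u](subrK u1) (le_trans (ler_normD _ _)) // [leLHS]addrC lerD2l.
Qed.

(** The homothety of centre [u] and ratio [t] maps a ball around [u1] inside the domain to a ball
    around the new point, inside the domain by convexity. So every point of [U] is a limit of core
    points along a segment. *)
Lemma core_segment u (t : R) : U u -> 0 < t <= 1 ->
  dgf_core U h (t *: u1 + (1 - t) *: u).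
Proof.
move=> Uu /andP[t0 t1]; have [U1 i1] := core1.
split; first by apply: convex_setE => //; rewrite (ltW t0).
move: i1; rewrite /interior /= => /nbhs_ballP [r /= r0 hr].
apply/nbhs_ballP; exists (t * r); first by rewrite /= mulr_gt0.
move=> z; rewrite -ball_normE /= => zr.
have hNy := ccp_gtNy (dgf_ccp hdgf).
pose z1 := u1 + t^-1 *: (z - (t *: u1 + (1 - t) *: u)).
have -> : z = t *: z1 + (1 - t) *: u.
  by rewrite /z1 scalerDr scalerA divff ?gt_eqF // scale1r addrAC [RHS]addrC subrK.
apply: edom_convex => //.
- exact: ccp_convex (dgf_ccp hdgf).
- apply: hr; rewrite -ball_normE /= /z1 opprD addNKr normrN normrZ ger0_norm ?invr_ge0 ?ltW //.
  by rewrite ltr_pdivrMl // distrC.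
- by have := dgf_fin Uu; rewrite fin_numElt => /andP[].
- by rewrite ltW.
Qed.

Let hr u := fine (h u).

(** Weighted sum of the two Bregman lower bounds based at the intermediate point; its gradient terms
    cancel. *)
Lemma strongly_convex_core u v t : U u -> U v -> 0 <= t <= 1 ->
  dgf_core U h (t *: u + (1 - t) *: v) ->
  hr (t *: u + (1 - t) *: v) <=
    t * hr u + (1 - t) * hr v - 2^-1 * (t * (1 - t)) * `|u - v| ^+ 2.
Proof.
set w := _ + _ => Uu Uv /andP[t0 t1] cw.
have vw : v - w = (- t) *: (u - v).
  by rewrite /w scalerBr !scaleNr opprK scalerBl scale1r opprD opprB addrCA subrKC.
have uw : u - w = (1 - t) *: (u - v).
  by rewrite /w opprD addrA scalerBr; congr (_ - _); rewrite scalerBl scale1r.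
have := rbregman_ge Uu cw; have := rbregman_ge Uv cw.
rewrite /D /rbregman -/(hr u) -/(hr v) -/(hr w) vw uw.
rewrite !(scalarZ (scalar_linear (egrad h w))) !normrZ normrN !ger0_norm ?subr_ge0 // !exprMn.
set N := `|_| ^+ 2; set g := egrad h w _ => h1 h2.
have t1' : 0 <= 1 - t by rewrite subr_ge0.
have := ler_wpM2l t0 h2; have := ler_wpM2l t1' h1; lra.
Qed.

(** To reach intermediate points outside the core, all three points are pulled towards [u1] by a
    factor [k], which puts them in the core. As [k] tends to 0, convexity controls [h] at the two
    ends and lower semicontinuity controls it at the intermediate point. *)
Lemma strongly_convex_dgf u v t : U u -> U v -> 0 <= t <= 1 ->
  hr (t *: u + (1 - t) *: v) <=
    t * hr u + (1 - t) * hr v - 2^-1 * (t * (1 - t)) * `|u - v| ^+ 2.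
Proof.
set w := _ + _ => Uu Uv t01.
have Uw : U w by exact: convex_setE.
set N := `|_| ^+ 2; set B := t * hr u + (1 - t) * hr v.
have N0 : 0 <= N by rewrite exprn_ge0.
have tt0 : 0 <= t * (1 - t) by case/andP: t01 => t0 t1; rewrite mulr_ge0 ?subr_ge0.
(* [k * K] dominates the two errors due to the pulling: [B] is averaged with [hr u1], and the
   quadratic term loses a factor [(1 - k) ^+ 2]. *)
pose K := `|hr u1 - B| + t * (1 - t) * N.
have K0 : 0 <= K by rewrite addr_ge0 // mulr_ge0.
apply/ler_addgt0Pr => e e0.
have [V Vw Vh] := ccp_closed (dgf_ccp hdgf) (x := w) (a := hr w - e / 2) ltac:(
  by rewrite -(fineK (dgf_fin Uw)) lte_fin ltrBlDr ltrDl divr_gt0).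
have wc (z : E) : z + k *: (u1 - z) @[k --> (0 : R)^'+] --> z.
  rewrite -[X in _ --> X]addr0 -[X in _ --> _ + X](scale0r (u1 - z)).
  apply: cvgD; first exact: cvg_cst.
  by apply: cvgZr_tmp; apply: cvg_at_right_filter; exact: cvg_id.
have : \forall k \near (0 : R)^'+, V (w + k *: (u1 - w)) by exact: (wc w).
have e1 : 0 < e / 2 / (K + 1) by rewrite divr_gt0 ?divr_gt0 ?ltr_wpDl.
move=> nV; have /(_ _ _ _)/filter_ex [] := filterI (nbhs_right_le e1)
  (filterI (nbhs_right_le (ltr01)) (filterI (nbhs_right_gt (0:R)) nV)).
move=> k [ke [k1 [k0 /Vh]]].
rewrite segment_convE.
have k01 : 0 < k <= 1 by rewrite k0 k1.
have k01' : 0 <= k <= 1 by rewrite ltW.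
have cwk := core_segment Uw k01.
rewrite -(fineK (dgf_core_fin cwk)) lte_fin -/(hr _) => hlt.
pose uk := k *: u1 + (1 - k) *: u; pose vk := k *: u1 + (1 - k) *: v.
have ck := core_segment Uu k01; have cvk := core_segment Uv k01.
have wE : k *: u1 + (1 - k) *: w = t *: uk + (1 - t) *: vk.
  rewrite /w /uk /vk !scalerDr !scalerA addrACA -scalerDl.
  by congr (_ *: _ + (_ *: _ + _ *: _)); ring.
have hk (z : E) : U z -> hr (k *: u1 + (1 - k) *: z) <= k * hr u1 + (1 - k) * hr z.
  move=> Uz; apply: econvex_fine => //.
  - exact: ccp_convex (dgf_ccp hdgf).
  - exact: dgf_core_fin.
  - exact: dgf_fin.
  - exact: ccp_gtNy (dgf_ccp hdgf) _.
have := strongly_convex_core (proj1 ck) (proj1 cvk) t01.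
rewrite -/uk -/vk -wE => /(_ cwk).
have -> : uk - vk = (1 - k) *: (u - v).
  by rewrite /uk /vk opprD addrACA subrr add0r -scalerBr.
rewrite normrZ exprMn ger0_norm ?subr_ge0 // -/N.
have := hk _ Uu; have := hk _ Uv; rewrite -/uk -/vk.
case/andP: t01 => t0 t1 hv hu hs.
have t1' : 0 <= 1 - t by rewrite subr_ge0.
have hu' := ler_wpM2l t0 hu; have hv' := ler_wpM2l t1' hv.
have k2 : (1 - k) ^+ 2 * (t * (1 - t) * N) >= (1 - 2 * k) * (t * (1 - t) * N).
  by rewrite ler_wpM2r ?mulr_ge0 //; nra.
have kK : k * K <= e / 2.
  rewrite (le_trans _ (_ : k * (K + 1) <= _)) //; last by rewrite -ler_pdivlMr ?ltr_wpDl.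
  by rewrite ler_pM2l // lerDl.
have kB : k * (hr u1 - B) <= k * `|hr u1 - B| by rewrite ler_pM2l // ler_norm.
have : k * K = k * `|hr u1 - B| + k * (t * (1 - t) * N) by rewrite mulrDr.
rewrite /B in kB *; lra.
Qed.

(** Compactness of [U] gives a maximizer, and the strong convexity of the Bregman distance,
    inherited from [h], gives the quadratic growth away from it. *)
Lemma mirror_exists (p : E -> R) (a : R) : scalar p -> 0 <= a ->
  exists z, U z /\ forall u, U u ->
    p u - a * D u u1 + a / 2 * `|u - z| ^+ 2 <= p z - a * D z u1.
Proof.
move=> sp a0.
pose phi u := a * D u u1 - p u.
have U0 : U !=set0 by exists u1; case: core1.
have cptU : compact U.
  exact: (bounded_closed_compact_findim fdE Ucl dgf_bounded).
have cphi : {within U, continuous phi}.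
  apply/subspace_continuousP => u Uu.
  have ch : hr v @[v --> within U (nbhs u)] --> hr u.
    apply: fine_cvg; rewrite /hr fineK ?dgf_fin //.
    by have /subspace_continuousP := dgf_continuous hdgf; apply.
  have cl (l : E -> R) : scalar l -> l v @[v --> within U (nbhs u)] --> l u.
    by move=> sl; apply: cvg_within_filter; exact: scalar_continuous.
  rewrite /phi /D /rbregman; apply: cvgB; last exact: cl.
  apply: cvgM; first exact: cvg_cst.
  apply: cvgB; first by apply: cvgB => //; exact: cvg_cst.
  have := cl _ (scalar_linear (egrad h u1)) => cg.
  under eq_fun do rewrite linearB.
  by rewrite linearB; apply: cvgB => //; exact: cvg_cst.
have [z /set_mem Uz zmin] := compact_EVT_min U0 cptU cphi.
exists z; split => // u Uu.
set N := `|_| ^+ 2; have N0 : 0 <= N by rewrite exprn_ge0.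
suff : a / 2 * N <= phi u - phi z by rewrite /phi; lra.
apply/ler_addgt0Pr => e e0.
set c := a / 2 * N; have c0 : 0 <= c by rewrite !mulr_ge0 ?invr_ge0.
(* Comparing [z] with the point of parameter [k] on the segment to [u] yields the growth only up to
   a factor [1 - k]; this [k] makes the loss at most [e]. *)
pose k := e / (c + e).
have ce0 : 0 < c + e by rewrite ltr_wpDl.
have k0 : 0 < k by rewrite divr_gt0.
have k1 : k <= 1 by rewrite ler_pdivrMr // mul1r lerDr.
have k01 : 0 <= k <= 1 by rewrite ltW.
have Uw : U (k *: u + (1 - k) *: z) by exact: convex_setE.
have := zmin _ (mem_set Uw).
have := strongly_convex_dgf Uu Uz k01.
rewrite -/N /phi /D /rbregman -!/(hr _).
have sg := scalar_linear (egrad h u1).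
rewrite !(scalarB sg) (scalarD sg) !(scalarZ sg) (scalarD sp) !(scalarZ sp) => h1 h2.
have h3 := ler_wpM2l a0 h1.
have h4 : k * ((1 - k) * c) <= k * ((a * (hr u - egrad h u1 u) - p u) - (a * (hr z - egrad h u1 z) - p z)).
  by rewrite /c; lra.
rewrite ler_pM2l // in h4.
have ck : k * c <= e.
  by rewrite /k mulrAC ler_pdivrMr // ler_wpM2l ?(ltW e0) // lerDl ltW.
lra.
Qed.

(** The dual averaging point for the dual variable [p]. Quadratic growth belongs to the choice
    predicate: it makes the point unique for [a > 0] and gives its stability in [p]. By
    [mirror_exists] the choice succeeds for linear [p] and [a >= 0]. *)
Definition mirror (a : R) (p : E -> R) : E :=
  xget u1 [set z | U z /\ forall u, U u ->
    p u - a * D u u1 + a / 2 * `|u - z| ^+ 2 <= p z - a * D z u1].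

Lemma mirrorP a p : scalar p -> 0 <= a -> U (mirror a p) /\
  forall u, U u -> p u - a * D u u1 + a / 2 * `|u - mirror a p| ^+ 2 <=
    p (mirror a p) - a * D (mirror a p) u1.
Proof.
move=> sp a0; rewrite /mirror; case: xgetP => [z _ //|h0].
by have [z] := mirror_exists sp a0; move/(h0 z).
Qed.

(** Each point is tested in the growth inequality of the other. The result has the form that
    [vmeasurable_argmax] asks for, which is how mirror points become measurable. *)
Lemma mirror_lipschitz a p q : scalar p -> scalar q -> 0 <= a ->
  a * `|mirror a p - mirror a q| ^+ 2 <=
    p (mirror a p - mirror a q) - q (mirror a p - mirror a q).
Proof.
move=> sp sq a0; have [Up hp] := mirrorP sp a0; have [Uq hq] := mirrorP sq a0.
have := hp _ Uq; have := hq _ Up; rewrite [`|mirror a q - _|]distrC.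
rewrite (scalarB sp) (scalarB sq); lra.
Qed.

(* The potential of dual averaging: by strong convexity, each increment of
   the dual variable raises it by at most the linear term at the current
   maximizer plus a quadratic error. *)
Lemma mirror_regret (a : R) (q : nat -> E -> R) (n : nat) (u : E) :
  0 < a -> (forall i, scalar (q i)) -> U u ->
  \sum_(i < n) q i u - a * D u u1 <=
    \sum_(i < n) (q i (mirror a (fun v => \sum_(j < i) q j v)) +
      (dual_norm (q i)) ^+ 2 / (2 * a)).
Proof.
move=> a0 sq Uu; pose P k v := \sum_(i < k) q i v.
have sP k : scalar (P k).
  move=> c v w; rewrite /P mulr_sumr -big_split; apply: eq_bigr => i _; exact: sq.
have a0' := ltW a0.
elim: n u Uu => [|n IH] u Uu.
  rewrite !big_ord0 sub0r oppr_le0 mulr_ge0 //.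
  apply: (le_trans _ (rbregman_ge Uu core1)).
  by rewrite mulr_ge0 ?exprn_ge0.
rewrite [leRHS]big_ord_recr /= -/(P n).
set z := mirror a (P n).
have [Uz hz] := mirrorP (sP n) a0'.
have h1 := hz _ Uu; rewrite -/z in h1.
(* The induction hypothesis is used at the maximizer [z] and not at [u]: it bounds the maximal value
   of the potential, from which [h1] starts. *)
have h2 : P n z - a * D z u1 <= _ := IH _ Uz.
rewrite big_ord_recr /= -/(P n u).
have h3 := dual_norm_pairing fdE (u - z) (sq n).
rewrite (scalarB (sq n)) in h3.
have h4 : dual_norm (q n) * `|u - z| <= dual_norm (q n) ^+ 2 / (2 * a) + a / 2 * `|u - z| ^+ 2.
  have -> : dual_norm (q n) ^+ 2 / (2 * a) = a / 2 * (dual_norm (q n) / a) ^+ 2.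
    by field; rewrite gt_eqF.
  have {1}-> : dual_norm (q n) = a * (dual_norm (q n) / a) by rewrite mulrC divfK ?gt_eqF.
  have := mulr_ge0 a0' (sqr_ge0 (dual_norm (q n) / a - `|u - z|)).
  set r := _ / a; set s := `|_|; lra.
lra.
Qed.

End Dgf.

(** * Measurability through finitely many real functions *)

Section InitialMeasurability.
Context {R : realType} {d : measure_display} {T : measurableType d}.

(* A set that is open for the initial topology of finitely many measurable
   functions is a countable union of boxes with rational centres. *)
Lemma measurable_initial_open (J : finType) (xi : J -> T -> R) (A : set T) :
  (forall i, measurable_fun setT (xi i)) ->
  (forall w, A w -> exists2 e : R, 0 < e &
     forall w', (forall i, `|xi i w' - xi i w| < e) -> A w') ->
  measurable A.
Proof.
move=> mxi Aopen.
pose C (k : {ffun J -> rat} * nat) : set T :=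
  \bigcap_(i in [set: J]) [set w | `|xi i w - ratr (k.1 i)| < k.2.+1%:R^-1].
have -> : A = \bigcup_(k in [set k | C k `<=` A]) C k.
  apply/seteqP; split => [w Aw|w [k kA Ck]]; last exact: kA.
  have [e e0 he] := Aopen _ Aw.
  have [m me] : exists m : nat, m.+1%:R^-1 < e / 2.
    have [m _ /(_ m (leqnn m)) hm] := near_infty_natSinv_lt (PosNum (divr_gt0 e0 (ltr0Sn R 1))).
    by exists m.
  have m0 : 0 < m.+1%:R^-1 :> R by rewrite invr_gt0.
  have /choice [q hq] : forall i, exists q : rat, `|xi i w - ratr q| < m.+1%:R^-1.
    move=> i; have /rat_in_itvoo [q] : xi i w - m.+1%:R^-1 < xi i w + m.+1%:R^-1.
      by rewrite ltrBlDr -addrA ltrDl addr_gt0.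
    rewrite in_itv /= => /andP[h1 h2]; exists q.
    by rewrite distrC ltr_distl h1 h2.
  exists ([ffun i => q i], m); last by move=> i _ /=; rewrite ffunE.
  move=> w' Cw'; apply: he => i.
  have := Cw' i I; rewrite /= ffunE => h.
  apply: (le_lt_trans (ler_distD (ratr (q i)) _ _)).
  by rewrite (splitr e) ltrD ?(lt_trans _ me) // distrC.
rewrite bigcup_mkcond; apply: countable_bigcupT_measurable => // k.
case: ifP => _; last exact: measurable0.
apply: fin_bigcap_measurable => // i _.
rewrite (_ : [set w | _] = [set: T] `&` (fun w => `|xi i w - ratr (k.1 i)|) @^-1` `]-oo, k.2.+1%:R^-1[%classic).
  have mi : measurable_fun setT (fun w => `|xi i w - ratr (k.1 i)|).
    by apply: measurableT_comp => //; apply: measurable_funB.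
  by apply: mi.
by apply/seteqP; split => w /=; rewrite in_itv /=; [split|case].
Qed.

Lemma measurable_initial_continuous (J : finType) (xi : J -> T -> R)
    (phi : T -> R) :
  (forall i, measurable_fun setT (xi i)) ->
  (forall w (e : R), 0 < e -> exists2 r : R, 0 < r &
     forall w', (forall i, `|xi i w' - xi i w| < r) -> `|phi w' - phi w| < e) ->
  measurable_fun setT phi.
Proof.
move=> mxi hphi; apply: (measurability _ (RGenOpens.measurableE R)).
move=> _ [_ [a [b ->]] <-]; rewrite setTI.
apply: (measurable_initial_open mxi) => w /=; rewrite in_itv /= => /andP[h1 h2].
have [r r0 hr] := hphi w (Num.min (phi w - a) (b - phi w)) ltac:(by rewrite lt_min !subr_gt0 h1 h2).
exists r => // w' /hr; rewrite lt_min !ltr_norml in_itv /= => /andP[/andP[? ?] /andP[? ?]].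
by apply/andP; split; lra.
Qed.

(* [kappa w w'] plays the role of the distance between the values at [w] and
   [w'] of some map: such a map is then Borel, whatever its codomain. *)
Definition controlled (kappa : T -> T -> R) : Prop :=
  exists (J : finType) (xi : J -> T -> R),
    (forall j, measurable_fun setT (xi j)) /\
    forall w (e : R), 0 < e -> exists2 r : R, 0 < r &
      forall w', (forall j, `|xi j w' - xi j w| < r) -> kappa w w' < e.

Lemma controlled_real (f : T -> R) : measurable_fun setT f ->
  controlled (fun w w' => `|f w' - f w|).
Proof.
move=> mf; exists unit, (fun=> f); split => // w e e0.
by exists e => // w' /(_ tt).
Qed.

Lemma controlledD kappa1 kappa2 : controlled kappa1 -> controlled kappa2 ->
  controlled (fun w w' => kappa1 w w' + kappa2 w w').
Proof.
move=> [J1 [xi1 [m1 h1]]] [J2 [xi2 [m2 h2]]].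
exists (J1 + J2)%type, (fun j => match j with inl j => xi1 j | inr j => xi2 j end).
split => [[j|j] //|w e e0].
have e2 : 0 < e / 2 by rewrite divr_gt0.
have [r1 r10 k1] := h1 w _ e2; have [r2 r20 k2] := h2 w _ e2.
exists (Num.min r1 r2); first by rewrite lt_min r10 r20.
move=> w' h; rewrite (splitr e) ltrD //.
- by apply: k1 => j; have := h (inl j); rewrite lt_min => /andP[].
- by apply: k2 => j; have := h (inr j); rewrite lt_min => /andP[].
Qed.

Lemma controlled_le kappa1 kappa2 (c : R) : 0 <= c ->
  (forall w w', kappa2 w w' <= c * kappa1 w w') ->
  controlled kappa1 -> controlled kappa2.
Proof.
move=> c0 le12 [J [xi [mxi h]]]; exists J, xi; split => // w e e0.
have c1 : 0 < c + 1 by rewrite ltr_wpDl.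
have [r r0 hr] := h w (e / (c + 1)) (divr_gt0 e0 c1).
exists r => // w' /hr; rewrite ltr_pdivlMr // => hk.
apply: (le_lt_trans (le12 _ _)).
have [k0|k0] := leP 0 (kappa1 w w'); first by lra.
by apply: le_lt_trans e0; rewrite nmulr_lle0.
Qed.

Lemma controlled_sum (J : finType) (kappa : J -> T -> T -> R) :
  (forall j, controlled (kappa j)) ->
  controlled (fun w w' => \sum_j kappa j w w').
Proof.
move=> ck.
suff H s : controlled (fun w w' => \sum_(j <- s) kappa j w w') by exact: H.
elim: s => [|j s IH].
  exists (void : finType), (fun v : void => of_void _ v); split => // w e e0.
  by exists 1 => // w' _; rewrite big_nil.
rewrite (_ : (fun _ => _) = fun w w' => kappa j w w' + \sum_(j <- s) kappa j w w').
  exact: controlledD.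
by apply/funext => w; apply/funext => w'; rewrite big_cons.
Qed.

Lemma controlled_measurable kappa (phi : T -> R) : controlled kappa ->
  (forall w (e : R), 0 < e -> exists2 r : R, 0 < r &
     forall w', kappa w w' < r -> `|phi w' - phi w| < e) ->
  measurable_fun setT phi.
Proof.
move=> [J [xi [mxi h]]] hphi; apply: (measurable_initial_continuous mxi).
move=> w e /(hphi w)[r r0 hr]; have [s s0 hs] := h w r r0.
by exists s => // w' /hs /hr.
Qed.

Lemma controlled_open kappa (A : set T) : controlled kappa ->
  (forall w, A w -> exists2 r : R, 0 < r & forall w', kappa w w' < r -> A w') ->
  measurable A.
Proof.
move=> [J [xi [mxi h]]] hA; apply: (measurable_initial_open mxi).
move=> w /hA [r r0 hr]; have [s s0 hs] := h w r r0.
by exists s => // w' /hs /hr.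
Qed.

Section Vectors.
Context {E : normedModType R}.
Hypothesis fdE : finite_dim E.
Implicit Types (x : T -> E) (p : T -> E -> R).

Definition vmeasurable x := measurable_fun setT (x : T -> borel E).

Definition dmeasurable p :=
  (forall w, scalar (p w)) /\ forall v, measurable_fun setT (p ^~ v).

Lemma continuous_borel (phi : E -> R) : continuous phi ->
  measurable_fun setT (phi : borel E -> R).
Proof.
move=> cphi; apply: (measurability _ (RGenOpens.measurableE R)).
move=> _ [_ [a [b ->]] <-]; rewrite setTI.
apply: sub_sigma_algebra; apply: open_comp => [u _|]; first exact: cphi.
exact: interval_open.
Qed.

Lemma vmeasurable_scalar x (l : E -> R) : vmeasurable x -> scalar l ->
  measurable_fun setT (fun w => l (x w)).
Proof.
move=> mx sl; apply: (measurableT_comp _ mx).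
by apply: continuous_borel; exact: scalar_continuous.
Qed.

Lemma controlled_vector x : vmeasurable x ->
  controlled (fun w w' => `|x w' - x w|).
Proof.
move=> mx; have [n [b [c [cs cb free bc]]]] := findim_coord fdE.
pose kappa j w w' := `|c j (x w') - c j (x w)|.
pose B := \sum_j `|b j|.
apply: (@controlled_le (fun w w' => \sum_j kappa j w w') _ B).
- by rewrite sumr_ge0.
- move=> w w'; rewrite (cb (x w' - x w)) (le_trans (ler_norm_sum _ _ _)) //.
  rewrite mulr_sumr; apply: ler_sum => j _.
  rewrite normrZ (scalarB (cs j)) mulrC ler_wpM2r // /B.
  by rewrite (bigD1 j) //= lerDl sumr_ge0.
- by apply: controlled_sum => j; apply: controlled_real; exact: vmeasurable_scalar.
Qed.

Lemma controlled_dual p : dmeasurable p ->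
  controlled (fun w w' => dual_norm (p w' \- p w)).
Proof.
move=> [sp mp]; have [n [b [C [C0 h]]]] := dual_norm_coord fdE.
apply: (@controlled_le (fun w w' => \sum_i `|p w' (b i) - p w (b i)|) _ C) => //.
- move=> w w'; apply: dual_norm_le; first by rewrite mulr_ge0 // sumr_ge0.
  by move=> v; apply: h; exact: scalar_subf.
- by apply: controlled_sum => j; apply: controlled_real; exact: mp.
Qed.

Lemma controlled_vmeasurable kappa x : controlled kappa ->
  (forall w (e : R), 0 < e -> exists2 r : R, 0 < r &
     forall w', kappa w w' < r -> `|x w' - x w| < e) ->
  vmeasurable x.
Proof.
move=> ck hx; apply: (@measurability _ _ T (borel E) setT x open) => // _ [A oA <-].
rewrite setTI; apply: (controlled_open ck) => w Axw.
have /nbhs_ballP [e /= e0 he] := open_nbhs_nbhs (conj oA Axw).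
have [r r0 hr] := hx w e e0; exists r => // w' /hr h.
by apply: he; rewrite -ball_normE /= distrC.
Qed.

(** Going through [controlled] avoids comparing the Borel sets of [E * E] with the product of the
    Borel sigma-algebras. *)
Lemma vmeasurable_lincomb (a b : R) x x' : vmeasurable x -> vmeasurable x' ->
  vmeasurable (fun w => a *: x w + b *: x' w).
Proof.
move=> mx mx'.
have ck : controlled (fun w w' => `|a *: x w' + b *: x' w' - (a *: x w + b *: x' w)|).
  apply: (@controlled_le _ _ (`|a| + `|b|) _ _
    (controlledD (controlled_vector mx) (controlled_vector mx'))).
    by rewrite addr_ge0.
  move=> w w'; rewrite opprD addrACA -!scalerBr (le_trans (ler_normD _ _)) // !normrZ.
  have := normr_ge0 (x w' - x w); have := normr_ge0 (x' w' - x' w).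
  have := normr_ge0 a; have := normr_ge0 b => *; nra.
by apply: (controlled_vmeasurable ck) => w e e0; exists e.
Qed.

Lemma vmeasurable_cst (v : E) : vmeasurable (fun=> v).
Proof. exact: measurable_cst. Qed.

(** Pairing with the dual norm turns the hypothesis into [a * |x w' - x w| <= dual_norm (p w' \- p
    w)]: [x] is a Lipschitz function of the dual variable [p]. Prox points and mirror points both
    satisfy it, so no measurable selection is involved. *)
Lemma vmeasurable_argmax (a : R) p x : 0 < a -> dmeasurable p ->
  (forall w w', a * `|x w' - x w| ^+ 2 <=
     p w' (x w' - x w) - p w (x w' - x w)) ->
  vmeasurable x.
Proof.
move=> a0 dp hx; have [sp _] := dp.
have ck : controlled (fun w w' => `|x w' - x w|).
  apply: (@controlled_le _ _ a^-1 _ _ (controlled_dual dp)).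
    by rewrite invr_ge0 ltW.
  move=> w w'; rewrite ler_pdivlMl //.
  have [->|n0] := eqVneq (`|x w' - x w|) 0.
    by rewrite mulr0 dual_norm_ge0 //; exact: scalar_subf.
  have np : 0 < `|x w' - x w| by rewrite lt_neqAle eq_sym n0 /=.
  rewrite -(ler_pM2r np) -mulrA -expr2 (le_trans (hx _ _)) //.
  have := dual_norm_pairing fdE (x w' - x w) (scalar_subf (sp w') (sp w)); exact.
by apply: (controlled_vmeasurable ck) => w e e0; exists e.
Qed.

Lemma dmeasurable_norm p : dmeasurable p ->
  measurable_fun setT (fun w => dual_norm (p w)).
Proof.
move=> dp; apply: (controlled_measurable (controlled_dual dp)) => w e e0.
by exists e => // w'; apply: le_lt_trans; apply: dual_norm_dist => //; case: dp.
Qed.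

Lemma dmeasurable_pairing p x : dmeasurable p -> vmeasurable x ->
  measurable_fun setT (fun w => p w (x w)).
Proof.
move=> [sp mp] mx; have [n [b [c [cs cb free bc]]]] := findim_coord fdE.
rewrite (_ : (fun w => _) = fun w => \sum_i c i (x w) * p w (b i)).
  apply: measurable_sum => i; apply: measurable_funM; last exact: mp.
  exact: vmeasurable_scalar.
by apply/funext => w; rewrite {1}(cb (x w)) scalar_sum.
Qed.

Lemma dmeasurableD p q : dmeasurable p -> dmeasurable q ->
  dmeasurable (fun w => p w \+ q w).
Proof.
move=> [sp mp] [sq mq]; split => [w|v]; first exact: scalar_addf.
by apply: measurable_funD; [exact: mp|exact: mq].
Qed.

Lemma dmeasurableZ (k : R) p : dmeasurable p ->
  dmeasurable (fun w v => k * p w v).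
Proof.
move=> [sp mp]; split => [w|v]; first exact: scalar_scalef.
by apply: measurable_funM; [exact: measurable_cst|exact: mp].
Qed.

Lemma dmeasurableB p q : dmeasurable p -> dmeasurable q ->
  dmeasurable (fun w => p w \- q w).
Proof.
move=> [sp mp] [sq mq]; split => [w|v]; first exact: scalar_subf.
by apply: measurable_funB; [exact: mp|exact: mq].
Qed.

Lemma dmeasurable_sum (n : nat) (p : nat -> T -> E -> R) :
  (forall i, (i < n)%N -> dmeasurable (p i)) ->
  dmeasurable (fun w v => \sum_(i < n) p i w v).
Proof.
move=> dp; split => [w a u v|v].
  rewrite mulr_sumr -big_split; apply: eq_bigr => i _.
  by have [+ _] := dp _ (ltn_ord i); exact.
by apply: measurable_sum => i; have [_] := dp _ (ltn_ord i); exact.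
Qed.

(** This is for gradients at random points: continuity in the dual norm along measurable vectors is
    enough. *)
Lemma dmeasurable_controlled kappa p : controlled kappa ->
  (forall w, scalar (p w)) ->
  (forall w (e : R), 0 < e -> exists2 r : R, 0 < r &
     forall w', kappa w w' < r -> dual_norm (p w' \- p w) < e) ->
  dmeasurable p.
Proof.
move=> ck sp hp; split => // v; apply: (controlled_measurable ck) => w e e0.
have v1 : 0 < `|v| + 1 by rewrite ltr_wpDl.
have [r r0 hr] := hp w (e / (`|v| + 1)) (divr_gt0 e0 v1); exists r => // w' /hr.
rewrite ltr_pdivlMr // => h; apply: le_lt_trans h.
have sd := scalar_subf (sp w') (sp w).
apply: (le_trans (le_dual_norm fdE v sd)).
by rewrite ler_wpM2l ?dual_norm_ge0 // lerDl.
Qed.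

End Vectors.

End InitialMeasurability.

(** * Conditional moments and martingales *)

Section SubSigmaAlgebra.
Context {R : realType} {d : measure_display} {Om : measurableType d}.
Variables (P : probability Om R) (gens : set (set Om)).
Hypothesis gens_meas : <<s gens >> `<=` measurable.

Local Notation GT := (g_sigma_algebraType gens).

Lemma sub_measurable_fun d' (T' : measurableType d') (f : Om -> T') :
  measurable_fun setT (f : GT -> T') -> measurable_fun setT f.
Proof.
move=> mf _ B mB; have := mf measurableT B mB.
by move/gens_meas.
Qed.

Import HBNNSimple.

Let integral_nnsfun_mul (h : {nnsfun GT >-> R}) (Z : Om -> R) :
  measurable_fun setT Z -> (forall w, 0 <= Z w) ->
  (\int[P]_w (h w * Z w)%:E =
   \sum_(y \in range h) y%:E * \int[P]_(w in h @^-1` [set y]) (Z w)%:E)%E.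
Proof.
move=> mZ Z0.
have mh y : measurable (h @^-1` [set y] : set Om).
  by apply: gens_meas; exact: (measurable_funPTI h (measurable_set1 y)).
have mI y : measurable_fun setT (fun w : Om => y * \1_(h @^-1` [set y]) w : R).
  apply: measurable_funM; first exact: measurable_cst.
  exact/measurable_indicP.
have yI0 y w : 0 <= y * \1_(h @^-1` [set y]) w :> R.
  by rewrite -lee_fin; exact: nnfun_muleindic_ge0.
transitivity (\int[P]_w (\sum_(y \in range h)
    (y * \1_(h @^-1` [set y]) w * Z w)%:E))%E.
  apply: eq_integral => w _.
  rewrite {1}fimfunE EFinM -fsumEFin // ge0_mule_fsuml; last first.
    by move=> y; exact: nnfun_muleindic_ge0.
  by apply: eq_fsbigr => y _; rewrite EFinM.
rewrite ge0_integral_fsum //; last 2 first.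
- by move=> y; apply/measurable_EFinP; apply: measurable_funM.
- by move=> y w _; rewrite lee_fin mulr_ge0.
apply: eq_fsbigr => y /set_mem [w0 _ yh].
rewrite [in RHS]integral_mkcond -ge0_integralZl //.
- apply: eq_integral => w _; rewrite epatch_indic -!EFinM.
  by rewrite -mulrA [Z w * _]mulrC.
- apply: (iffLR (measurable_restrictT _ (mh y))).
  by apply: measurable_funTS; exact/measurable_EFinP.
- by move=> w _; rewrite epatch_indic mule_ge0 // lee_fin.
- by rewrite lee_fin -yh.
Qed.

(** Passage from events to weights. For simple [psi] the integrals are nonnegative combinations of
    integrals over its level sets, which are events of the sub-sigma-algebra; monotone convergence
    does the rest. *)
Lemma cond_integral_le (Z1 Z2 psi : Om -> R) :
  measurable_fun setT Z1 -> measurable_fun setT Z2 ->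
  (forall w, 0 <= Z1 w) -> (forall w, 0 <= Z2 w) ->
  (forall A, <<s gens >> A ->
    \int[P]_(w in A) (Z1 w)%:E <= \int[P]_(w in A) (Z2 w)%:E)%E ->
  measurable_fun setT (psi : GT -> R) -> (forall w, 0 <= psi w) ->
  (\int[P]_w (psi w * Z1 w)%:E <= \int[P]_w (psi w * Z2 w)%:E)%E.
Proof.
move=> m1 m2 Z10 Z20 h12 mpsi psi0.
have mpsi' : measurable_fun [set: GT] (EFin \o psi) by exact/measurable_EFinP.
(* The approximation takes place in the sub-sigma-algebra, so that the level sets of the simple
   functions are events to which the hypothesis applies. *)
pose h := nnsfun_approx measurableT mpsi'.
have psiOm : measurable_fun setT psi by exact: sub_measurable_fun.
have hOm n : measurable_fun setT (h n : Om -> R).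
  by apply: sub_measurable_fun; exact: measurable_funPT.
have hle n w : h n w <= psi w.
  by rewrite -lee_fin /h nnsfun_approxE; apply: (@le_approx _ _ _ _ (EFin \o psi)) => // ? _; rewrite /= lee_fin.
have hnd a b w : (a <= b)%N -> h a w <= h b w.
  by move=> /(nd_nnsfun_approx measurableT mpsi') /lefP; exact.
have hcvg (Z : Om -> R) w : ((h n w * Z w)%:E @[n --> \oo] --> (psi w * Z w)%:E)%E.
  under eq_fun do rewrite EFinM.
  rewrite EFinM; apply: cvgeZr => //.
  by apply: (cvg_nnsfun_approx _ mpsi') => // ? _; rewrite lee_fin.
have -> : (\int[P]_w (psi w * Z1 w)%:E =
    limn (fun n => \int[P]_w (h n w * Z1 w)%:E))%E.
  rewrite -monotone_convergence //.
  - by apply: eq_integral => w _; apply/esym/cvg_lim => //; exact: hcvg.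
  - by move=> n; apply/measurable_EFinP; exact: measurable_funM.
  - by move=> n w _; rewrite lee_fin mulr_ge0.
  - move=> w _ a b ab; rewrite lee_fin ler_wpM2r //; exact: hnd.
apply: lime_le.
  apply: ereal_nondecreasing_is_cvgn => a b ab; apply: ge0_le_integral => //.
  - by move=> w _; rewrite lee_fin mulr_ge0.
  - by apply/measurable_EFinP; exact: measurable_funM.
  - by apply/measurable_EFinP; exact: measurable_funM.
  - by move=> w _; rewrite lee_fin ler_wpM2r //; exact: hnd.
near=> n.
apply: (@le_trans _ _ (\int[P]_w (h n w * Z2 w)%:E)%E).
  rewrite !integral_nnsfun_mul //; apply: lee_fsum => // y [w0 _ yh].
  apply: lee_wpmul2l; first by rewrite lee_fin -yh.
  by apply: h12; exact: (measurable_funPTI (h n) (measurable_set1 y)).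
apply: ge0_le_integral => //.
- by move=> w _; rewrite lee_fin mulr_ge0.
- by apply/measurable_EFinP; exact: measurable_funM.
- by apply/measurable_EFinP; exact: measurable_funM.
- by move=> w _; rewrite lee_fin ler_wpM2r.
Unshelve. all: by end_near. Qed.

End SubSigmaAlgebra.

Section RealExpectation.
Context {R : realType} {d : measure_display} {Om : measurableType d}.
Variable P : probability Om R.
Implicit Types f g : Om -> R.

Definition L1 f := P.-integrable setT (EFin \o f).

Definition Ex f : R := \int[P]_w f w.

Lemma L1_measurable f : L1 f -> measurable_fun setT f.
Proof. by move=> /measurable_int /measurable_EFinP. Qed.

Lemma ExE f : L1 f -> (\int[P]_w (f w)%:E = (Ex f)%:E)%E.
Proof. by move=> L1f; rewrite /Ex /Rintegral fineK //; exact: integrable_fin_num. Qed.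

Lemma L1_le f g : measurable_fun setT f -> (forall w, `|f w| <= g w) ->
  L1 g -> L1 f.
Proof.
move=> mf fg L1g; apply: le_integrable L1g => //; first exact/measurable_EFinP.
move=> w _ /=; rewrite lee_fin (le_trans (fg w)) //.
by rewrite ger0_norm // (le_trans _ (fg w)).
Qed.

Lemma L1D f g : L1 f -> L1 g -> L1 (fun w => f w + g w).
Proof. by move=> L1f L1g; exact: (integrableD measurableT L1f L1g). Qed.

Lemma L1Z c f : L1 f -> L1 (fun w => c * f w).
Proof. by move=> L1f; exact: (integrableZl measurableT c L1f). Qed.

Lemma L1_cst c : L1 (fun=> c).
Proof. by apply: finite_measure_integrable_cst. Qed.

Lemma L1_sum (I : Type) (s : seq I) (f : I -> Om -> R) :
  (forall i, L1 (f i)) -> L1 (fun w => \sum_(i <- s) f i w).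
Proof.
move=> L1f; elim: s => [|i s IH].
  rewrite (_ : (fun _ => _) = fun=> 0); first exact: L1_cst.
  by apply/funext => w; rewrite big_nil.
rewrite (_ : (fun _ => _) = fun w => f i w + \sum_(j <- s) f j w).
  exact: L1D.
by apply/funext => w; rewrite big_cons.
Qed.

Lemma ExD f g : L1 f -> L1 g -> Ex (fun w => f w + g w) = Ex f + Ex g.
Proof. by move=> *; exact: RintegralD. Qed.

Lemma ExB f g : L1 f -> L1 g -> Ex (fun w => f w - g w) = Ex f - Ex g.
Proof. by move=> *; exact: RintegralB. Qed.

Lemma ExZ c f : L1 f -> Ex (fun w => c * f w) = c * Ex f.
Proof. by move=> *; exact: RintegralZl. Qed.

Lemma Ex_cst c : Ex (fun=> c) = c.
Proof. by rewrite /Ex Rintegral_cst // [X in fine X](probability_setT P) mulr1. Qed.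

Lemma Ex_sum (I : Type) (s : seq I) (f : I -> Om -> R) :
  (forall i, L1 (f i)) ->
  Ex (fun w => \sum_(i <- s) f i w) = \sum_(i <- s) Ex (f i).
Proof.
move=> L1f; elim: s => [|i s IH].
  rewrite big_nil -[RHS](Ex_cst 0); congr Ex.
  by apply/funext => w; rewrite big_nil.
rewrite big_cons -IH -ExD //; last exact: L1_sum.
by congr Ex; apply/funext => w; rewrite big_cons.
Qed.

Lemma le_Ex f g : L1 f -> L1 g -> (forall w, f w <= g w) -> Ex f <= Ex g.
Proof. by move=> L1f L1g fg; apply: le_Rintegral. Qed.

Lemma Ex_ge0 f : (forall w, 0 <= f w) -> 0 <= Ex f.
Proof. by move=> f0; apply: Rintegral_ge0. Qed.

Lemma L1_ge0 f (c : R) : measurable_fun setT f -> (forall w, 0 <= f w) ->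
  (\int[P]_w (f w)%:E <= c%:E)%E -> L1 f /\ Ex f <= c.
Proof.
move=> mf f0 fc.
have L1f : L1 f.
  apply/integrableP; split; first exact/measurable_EFinP.
  under eq_integral do rewrite /= ger0_norm //.
  exact: le_lt_trans fc (ltry _).
by split => //; rewrite -lee_fin -ExE.
Qed.

Lemma markov_gt f (b c : R) : measurable_fun setT f -> (forall w, 0 <= f w) ->
  (\int[P]_w (f w)%:E <= b%:E)%E -> 0 < c ->
  (P [set w | c < f w]%R <= (b / c)%:E)%E.
Proof.
move=> mf f0 fb c0; set A := [set w | _].
have mA : measurable A.
  rewrite (_ : A = [set: Om] `&` f @^-1` `]c, +oo[%classic); first exact: mf.
  by rewrite setTI; apply/seteqP; split => w; rewrite /A /= in_itv /= andbT.
rewrite EFinM lee_pdivlMr // muleC.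
rewrite -(integral_cst P mA c%:E).
apply: (@le_trans _ _ (\int[P]_(w in A) (f w)%:E)%E).
  apply: ge0_le_integral => //.
  - by move=> w _; rewrite lee_fin ltW.
  - by apply: measurable_funTS; exact/measurable_EFinP.
  - by move=> w Aw; rewrite lee_fin ltW.
apply: le_trans fb; apply: ge0_subset_integral => //.
- exact/measurable_EFinP.
- by move=> w _; rewrite lee_fin.
Qed.

End RealExpectation.

(** * Predictable factors and conditional moments *)

Section Conditional.
Context {R : realType} {d : measure_display} {Om : measurableType d}.
Variables (P : probability Om R) (gens : set (set Om)).
Hypothesis gens_meas : <<s gens >> `<=` measurable.

Local Notation GT := (g_sigma_algebraType gens).

(** The version [W] is bounded above almost surely, but nothing is given about its sign; it is
    therefore its positive part that is compared with [c]. *)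
Lemma cond_expectation_le_integral (Z : Om -> R) (c : R) (A : set Om) :
  0 <= c -> cond_expectation_le P <<s gens >> (fun w => (Z w)%:E) c%:E ->
  <<s gens >> A -> (\int[P]_(w in A) (Z w)%:E <= \int[P]_(w in A) c%:E)%E.
Proof.
move=> c0 [W [mW hW] aeW] GA; rewrite -(hW A GA).
have mA := gens_meas GA.
have mW' : measurable_fun setT W.
  by move=> _ B mB; rewrite setTI; apply: gens_meas; exact: mW.
rewrite integralE.
apply: (@le_trans _ _ (\int[P]_(w in A) W^\+ w)%E).
  by apply: geeDl; rewrite oppe_le0 integral_ge0.
apply: ae_ge0_le_integral => //.
- by apply: measurable_funTS; exact: measurable_funepos.
- move: aeW; apply: filterS => w Wc _.
  by rewrite funeposE ge_max Wc lee_fin.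
Qed.

(** The tower property for a predictable nonnegative factor; the integrability of the product comes
    out as part of the conclusion. *)
Lemma cond_le_mul (Z psi : Om -> R) (c : R) :
  0 <= c -> measurable_fun setT Z -> (forall w, 0 <= Z w) ->
  cond_expectation_le P <<s gens >> (fun w => (Z w)%:E) c%:E ->
  measurable_fun setT (psi : GT -> R) -> (forall w, 0 <= psi w) ->
  L1 P psi -> L1 P (fun w => psi w * Z w) /\
  Ex P (fun w => psi w * Z w) <= c * Ex P psi.
Proof.
move=> c0 mZ Z0 hZ mpsi psi0 L1psi.
have mpsi' : measurable_fun setT psi by exact: sub_measurable_fun mpsi.
apply: L1_ge0; first exact: measurable_funM.
  by move=> w; rewrite mulr_ge0.
have := cond_integral_le gens_meas mZ (measurable_cst (D := setT) c) Z0 (fun=> c0)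
  (fun A => cond_expectation_le_integral c0 hZ) mpsi psi0.
move=> /le_trans; apply.
rewrite -ExZ // -ExE; last exact: L1Z.
apply: (eq_ind _ (fun z => (_ <= z)%E) (lexx _)).
by apply: eq_integral => w _; rewrite /= mulrC.
Qed.

End Conditional.

Section Unbiased.
Context {R : realType} {d : measure_display} {Om : measurableType d}.
Variables (P : probability Om R) (gens : set (set Om)).
Hypothesis gens_meas : <<s gens >> `<=` measurable.

Local Notation GT := (g_sigma_algebraType gens).
Local Notation L1 := (L1 P).
Local Notation Ex := (Ex P).

Let posR (f : Om -> R) w := Num.max (f w) 0.

Let posR_measurable d' (T : measurableType d') (f : T -> R) :
  measurable_fun setT f -> measurable_fun setT (fun w => Num.max (f w) 0).
Proof. by move=> mf; apply: measurable_maxr => //; exact: measurable_cst. Qed.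

Let posR_ge0 f w : 0 <= posR f w.
Proof. by rewrite /posR le_max lexx orbT. Qed.

Let posR_le f w : posR f w <= `|f w|.
Proof. by rewrite /posR ge_max ler_norm normr_ge0. Qed.

Let posRN f w : f w = posR f w - posR (fun w => - f w) w.
Proof.
rewrite /posR /Num.max; case: ltgtP => h.
- by rewrite oppr_lt0 ltNge (ltW h) /= sub0r opprK.
- by rewrite oppr_lt0 h subr0.
- by rewrite h oppr0 ltxx subr0.
Qed.

(** The positive and negative parts of [Z] have equal integrals over every event of the
    sub-sigma-algebra; [cond_integral_le], applied in both directions, extends the equality to the
    weight [psi]. *)
Lemma Ex_mul_centered_ge0 (Z psi : Om -> R) : L1 Z ->
  (forall A, <<s gens >> A -> (\int[P]_(w in A) (Z w)%:E = 0)%E) ->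
  measurable_fun setT (psi : GT -> R) -> (forall w, 0 <= psi w) ->
  L1 (fun w => psi w * Z w) -> Ex (fun w => psi w * Z w) = 0.
Proof.
move=> L1Z Zint mpsi psi0 L1pZ.
have mpsi' : measurable_fun setT psi by exact: sub_measurable_fun mpsi.
have mZ := L1_measurable L1Z.
pose Zp := posR Z; pose Zn := posR (fun w => - Z w).
have mZp : measurable_fun setT Zp by exact: posR_measurable.
have mZn : measurable_fun setT Zn by apply: posR_measurable; exact: measurableT_comp.
have aZ : L1 (fun w => `|Z w|) by exact: integrable_norm.
have L1p : L1 Zp by apply: (L1_le mZp) aZ => w; rewrite ger0_norm ?posR_le ?posR_ge0.
have L1n : L1 Zn.
  by apply: (L1_le mZn) aZ => w; rewrite ger0_norm ?posR_ge0 // -normrN; exact: (posR_le (fun w => - Z w)).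
have ZE : Z = fun w => Zp w - Zn w by apply/funext => w; exact: posRN.
have Zeq A : <<s gens >> A ->
    (\int[P]_(w in A) (Zp w)%:E = \int[P]_(w in A) (Zn w)%:E)%E.
  move=> GA; have mA := gens_meas GA; have := Zint A GA.
  have ip : P.-integrable A (EFin \o Zp) by apply: integrableS L1p.
  have i_n : P.-integrable A (EFin \o Zn) by apply: integrableS L1n.
  rewrite ZE integralB_EFin //.
  rewrite -(fineK (integrable_fin_num mA ip)) -(fineK (integrable_fin_num mA i_n)).
  by rewrite -EFinB => -[] /eqP; rewrite subr_eq0 => /eqP ->.
have h : (\int[P]_w (psi w * Zp w)%:E = \int[P]_w (psi w * Zn w)%:E)%E.
  apply/eqP; rewrite eq_le; apply/andP; split; apply: (cond_integral_le gens_meas) => //;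
    try (by move=> w; exact: posR_ge0); by move=> A GA; rewrite Zeq.
have apZ : L1 (fun w => `|psi w * Z w|) by exact: integrable_norm.
have L1pp : L1 (fun w => psi w * Zp w).
  apply: (L1_le _ _ apZ); first exact: measurable_funM.
  by move=> w; rewrite !normrM ler_wpM2l // [`|Zp w|]ger0_norm ?posR_ge0 ?posR_le.
have L1pn : L1 (fun w => psi w * Zn w).
  apply: (L1_le _ _ apZ); first exact: measurable_funM.
  move=> w; rewrite !normrM ler_wpM2l // [`|Zn w|]ger0_norm ?posR_ge0 //.
  by rewrite -(normrN (Z w)); exact: (posR_le (fun w => - Z w)).
rewrite (_ : (fun w => _) = fun w => psi w * Zp w - psi w * Zn w).
  by rewrite ExB // /Ex /Rintegral h subrr.
by apply/funext => w; rewrite -mulrBr {1}ZE.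
Qed.

Lemma Ex_mul_centered (Z psi : Om -> R) : L1 Z ->
  (forall A, <<s gens >> A -> (\int[P]_(w in A) (Z w)%:E = 0)%E) ->
  measurable_fun setT (psi : GT -> R) ->
  L1 (fun w => psi w * Z w) -> Ex (fun w => psi w * Z w) = 0.
Proof.
move=> L1Z Zint mpsi L1pZ.
have mpsi' : measurable_fun setT psi by exact: sub_measurable_fun mpsi.
have mZ := L1_measurable L1Z.
pose pp := posR psi; pose pn := posR (fun w => - psi w).
have mpp : measurable_fun setT (pp : GT -> R) by exact: posR_measurable.
have mpn : measurable_fun setT (pn : GT -> R).
  by apply: posR_measurable; exact: measurableT_comp.
have apZ : L1 (fun w => `|psi w * Z w|) by exact: integrable_norm.
have L1p : L1 (fun w => pp w * Z w).
  apply: (L1_le _ _ apZ).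
    by apply: measurable_funM => //; exact: sub_measurable_fun mpp.
  by move=> w; rewrite !normrM ler_wpM2r // ger0_norm ?posR_ge0 ?posR_le.
have L1n : L1 (fun w => pn w * Z w).
  apply: (L1_le _ _ apZ).
    by apply: measurable_funM => //; exact: sub_measurable_fun mpn.
  move=> w; rewrite !normrM ler_wpM2r // ger0_norm ?posR_ge0 // -(normrN (psi w)).
  exact: (posR_le (fun w => - psi w)).
rewrite (_ : (fun w => _) = fun w => pp w * Z w - pn w * Z w).
  rewrite ExB // !Ex_mul_centered_ge0 ?subrr // => w; exact: posR_ge0.
by apply/funext => w; rewrite -mulrBl {1}(posRN psi).
Qed.

Section Pairing.
Context {E : normedModType R}.
Hypothesis fdE : finite_dim E.
Variables (delta : Om -> E -> R) (x : Om -> E).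
Hypotheses (sdelta : forall w, scalar (delta w)).
Hypothesis mx : vmeasurable (x : GT -> E).
Hypothesis unb : cond_unbiased P <<s gens >> delta.

Lemma unbiased_dmeasurable : dmeasurable delta.
Proof. by split => // v; have [+ _] := unb v; exact: L1_measurable. Qed.

Lemma vmeasurable_sub : vmeasurable x.
Proof. exact: sub_measurable_fun mx. Qed.

(** Unbiasedness is known for fixed vectors, so the predictable vector [x] is expanded in a basis
    and each coordinate becomes a predictable factor. The weight [V] will be a constant, or the
    exponential of the past of a martingale. *)
Lemma Ex_unbiased_pairing (V : Om -> R) (B : R) :
  measurable_fun setT (V : GT -> R) -> (forall w, `|x w| <= B) ->
  L1 (fun w => `|V w| * dual_norm (delta w)) ->
  L1 (fun w => V w * delta w (x w)) /\ Ex (fun w => V w * delta w (x w)) = 0.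
Proof.
move=> mV xB L1V.
have mV' : measurable_fun setT V by exact: sub_measurable_fun mV.
have dd := unbiased_dmeasurable.
have [n [b [c [cs cb free _]]]] := findim_coord fdE.
have [C C0 cC] := coord_bounded cb free.
have mc i : measurable_fun setT ((fun w => V w * c i (x w)) : GT -> R).
  by apply: measurable_funM => //; exact: vmeasurable_scalar.
have L1i i : L1 (fun w => V w * c i (x w) * delta w (b i)).
  apply: (L1_le _ _ (L1Z (C * B * `|b i|) L1V)).
    apply: measurable_funM; last exact: dd.2.
    exact: sub_measurable_fun (mc i).
  move=> w; rewrite !normrM.
  rewrite [leRHS](_ : _ = (C * B) * `|V w| * (dual_norm (delta w) * `|b i|)); last ring.
  apply: ler_pM => //; last exact: le_dual_norm.
  rewrite [leRHS]mulrC ler_wpM2l // (le_trans (cC _ _)) // ler_wpM2l //.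
have eqf : (fun w => V w * delta w (x w)) =
    fun w => \sum_i V w * c i (x w) * delta w (b i).
  apply/funext => w; rewrite {1}(cb (x w)) scalar_sum // mulr_sumr.
  by apply: eq_bigr => i _; rewrite mulrA.
rewrite eqf; split; first exact: L1_sum.
rewrite Ex_sum // big1 // => i _; apply: Ex_mul_centered => //.
- by have [] := unb (b i).
- move=> A GA; have [_ [_ /(_ A GA)]] := unb (b i).
  by move=> <-; rewrite integral0.
Qed.

End Pairing.

End Unbiased.

(** * Exponential moments and tails of sub-Gaussian noise *)

Lemma expR_le_quadratic (R : realType) (x : R) : expR x <= x + expR (2 * x ^+ 2).
Proof.
have h2 := expR_ge1Dx (2 * x ^+ 2).
(* Above 1/2 one has [x <= 2 * x ^+ 2]; below, [expR x <= 1 / (1 - x) <= 1 + x + 2 * x ^+ 2]. *)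
have [x2|x2] := leP x 2^-1; last first.
  have : expR x <= expR (2 * x ^+ 2) by rewrite ler_expR; nra.
  have x0 : 0 < x by lra.
  move=> h; lra.
have h1 := expR_ge1Dx (- x).
have ep := expR_gt0 x.
have : expR x * expR (- x) = 1 by rewrite expRN mulfV // gt_eqF.
have := ler_wpM2l (ltW ep) h1.
have x1 : 0 < 1 - x by lra.
have h3 : 1 <= (1 - x) * (1 + x + 2 * x ^+ 2).
  have : 0 <= x ^+ 2 * (1 - 2 * x) by rewrite mulr_ge0 ?sqr_ge0; lra.
  lra.
move=> h4 h5; have : (1 - x) * expR x <= (1 - x) * (1 + x + 2 * x ^+ 2) by lra.
by rewrite ler_pM2l //; lra.
Qed.

(** Weighted sum of the tangent inequality of [expR] at the point [k * y], evaluated at [y] and at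
    0. *)
Lemma expR_convex0 (R : realType) (k y : R) : 0 <= k <= 1 ->
  expR (k * y) <= k * expR y + (1 - k).
Proof.
move=> /andP[k0 k1].
set m := expR (k * y); have m0 : 0 < m by exact: expR_gt0.
have e1 : expR y = m * expR ((1 - k) * y) by rewrite -expRD; congr expR; ring.
have e2 : m * expR (- (k * y)) = 1 by rewrite expRN mulfV // gt_eqF.
have h1 := ler_wpM2l (ltW m0) (expR_ge1Dx ((1 - k) * y)).
have h2 := ler_wpM2l (ltW m0) (expR_ge1Dx (- (k * y))).
rewrite -e1 in h1; rewrite e2 in h2.
have k1' : 0 <= 1 - k by lra.
have := ler_wpM2l k0 h1; have := ler_wpM2l k1' h2; lra.
Qed.

Section SubGaussian.
Context {R : realType} {d : measure_display} {Om : measurableType d}.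
Variable P : probability Om R.
Context {E : normedModType R}.
Hypothesis fdE : finite_dim E.

Local Notation L1 := (L1 P).
Local Notation Ex := (Ex P).

Section OneStep.
Variable gens : set (set Om).
Hypothesis gens_meas : <<s gens >> `<=` measurable.
Local Notation GT := (g_sigma_algebraType gens).
Variables (delta : Om -> E -> R) (sigma : R).
Hypothesis sigma0 : 0 < sigma.
Hypothesis sdelta : forall w, scalar (delta w).
Hypothesis unb : cond_unbiased P <<s gens >> delta.
Hypothesis subg : cond_subgaussian P <<s gens >> delta sigma.

Let N w := dual_norm (delta w) ^+ 2 / sigma ^+ 2.

Let N0 w : 0 <= N w.
Proof. by rewrite divr_ge0 ?sqr_ge0. Qed.

Let mN : measurable_fun setT N.
Proof.
apply: measurable_funM; last exact: measurable_cst.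
apply: measurable_funX; apply: dmeasurable_norm => //.
exact: unbiased_dmeasurable unb.
Qed.

Variable V : Om -> R.
Hypothesis mV : measurable_fun setT (V : GT -> R).
Hypothesis V0 : forall w, 0 <= V w.
Hypothesis L1V : L1 V.

Let mV' : measurable_fun setT V.
Proof. exact: sub_measurable_fun mV. Qed.

Let VN : L1 (fun w => V w * expR (N w)) /\
  Ex (fun w => V w * expR (N w)) <= expR 1 * Ex V.
Proof.
apply: (cond_le_mul gens_meas) => //.
by apply: measurableT_comp => //; exact: measurable_expR.
Qed.

(** This replaces a conditional Jensen inequality. Convexity is used around [N = 1], where [expR N]
    equals the sub-Gaussian bound, and this makes the constant exactly [expR k]. *)
Lemma subgaussian_power (k : R) : 0 <= k <= 1 ->
  L1 (fun w => V w * expR (k * N w)) /\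
  Ex (fun w => V w * expR (k * N w)) <= expR k * Ex V.
Proof.
move=> k01; have [k0 k1] := andP k01.
have [L1VN ExVN] := VN.
pose g w := expR k * (k / expR 1) * (V w * expR (N w)) + expR k * (1 - k) * V w.
have L1g : L1 g by apply: L1D; exact: L1Z.
have le w : V w * expR (k * N w) <= g w.
  have -> : g w = V w * (expR k * (k * expR (N w - 1) + (1 - k))).
    by rewrite /g expRB; field; rewrite gt_eqF ?expR_gt0.
  rewrite ler_wpM2l // (_ : k * N w = k + k * (N w - 1)); last ring.
  by rewrite expRD ler_wpM2l ?expR_ge0 // expR_convex0.
have L1e : L1 (fun w => V w * expR (k * N w)).
  apply: (L1_le _ _ L1g); last by move=> w; rewrite ger0_norm ?mulr_ge0 ?expR_ge0.
  apply: measurable_funM => //; apply: measurableT_comp; first exact: measurable_expR.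
  by apply: measurable_funM => //; exact: measurable_cst.
split => //; apply: (le_trans (le_Ex L1e L1g le)).
rewrite ExD ?ExZ //; try exact: L1Z.
have c0 : 0 <= expR k * (k / expR 1) by rewrite mulr_ge0 ?divr_ge0 ?expR_ge0.
have := ler_wpM2l c0 ExVN.
have -> : expR k * (k / expR 1) * (expR 1 * Ex V) = expR k * k * Ex V.
  by field; rewrite gt_eqF ?expR_gt0.
lra.
Qed.

(** With [k = (s * D * sigma) ^+ 2] the exponent [Z] satisfies [Z ^+ 2 <= k * N]. If [2 * k <= 1],
    the linear term of [expR_le_quadratic] integrates to zero and [expR (2 * k * N)] is within the
    range of [subgaussian_power]. If [2 * k > 1], Young's inequality [Z <= k + N / 4] suffices,
    because [k + 1 / 4 <= 2 * k]. *)
Lemma subgaussian_mgf (x : Om -> E) (D s : R) :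
  vmeasurable (x : GT -> E) -> (forall w, `|x w| <= D) -> 0 <= s ->
  L1 (fun w => V w * expR (s * delta w (x w))) /\
  Ex (fun w => V w * expR (s * delta w (x w))) <=
    expR (2 * (s * D * sigma) ^+ 2) * Ex V.
Proof.
move=> mx xD s0; have [w0 _] : [set: Om] !=set0 by exists point.
have D0 : 0 <= D by exact: le_trans (normr_ge0 _) (xD w0).
set k := (s * D * sigma) ^+ 2; have k0 : 0 <= k by exact: sqr_ge0.
pose Z w := s * delta w (x w).
have dn0 w := dual_norm_ge0 fdE (sdelta w).
have dd := unbiased_dmeasurable sdelta unb.
have mZ : measurable_fun setT Z.
  apply: measurable_funM; first exact: measurable_cst.
  by apply: (dmeasurable_pairing fdE) => //; exact: vmeasurable_sub mx.
have meZ : measurable_fun setT (fun w => V w * expR (Z w)).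
  by apply: measurable_funM => //; apply: measurableT_comp => //; exact: measurable_expR.
have NE w : dual_norm (delta w) ^+ 2 = sigma ^+ 2 * N w.
  by rewrite /N; field; rewrite gt_eqF.
have Zle w : `|Z w| <= s * D * dual_norm (delta w).
  rewrite /Z normrM ger0_norm // -mulrA ler_wpM2l // mulrC.
  by rewrite (le_trans (le_dual_norm fdE _ (sdelta w))) // ler_wpM2l.
have Z2 w : Z w ^+ 2 <= k * N w.
  rewrite -[leLHS]real_normK ?num_real // (le_trans (_ : _ <= (s * D * dual_norm (delta w)) ^+ 2)) //.
    by rewrite ler_sqr ?nnegrE // ?mulr_ge0.
  by rewrite /k !exprMn NE !mulrA.
have fin (f : Om -> R) (b c : R) : L1 (fun w => V w * f w) ->
    Ex (fun w => V w * f w) <= b ->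
    (forall w, expR (Z w) <= f w) -> b <= c ->
    L1 (fun w => V w * expR (Z w)) /\ Ex (fun w => V w * expR (Z w)) <= c.
  move=> L1f fb Zf bc.
  have L1e : L1 (fun w => V w * expR (Z w)).
    apply: (L1_le meZ _ L1f) => w.
    by rewrite ger0_norm ?mulr_ge0 ?expR_ge0 // ler_wpM2l.
  split => //; apply: le_trans bc; apply: le_trans fb.
  by apply: le_Ex => // w; rewrite ler_wpM2l.
have ExV0 : 0 <= Ex V by exact: Ex_ge0.
have [k2|k2] := leP (2 * k) 1.
- have k01 : 0 <= 2 * k <= 1 by rewrite k2 mulr_ge0.
  have [L1p Exp] := subgaussian_power k01.
  (* The dual norm is at most [sigma * (1 + N)], hence at most [sigma * expR N], whose product with
     [V] is integrable by [VN]. *)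
  have L1Vd : L1 (fun w => `|V w| * dual_norm (delta w)).
    apply: (L1_le _ _ (L1Z sigma VN.1)).
      apply: measurable_funM; first exact: measurableT_comp.
      exact: dmeasurable_norm.
    move=> w; rewrite ger0_norm ?mulr_ge0 // ger0_norm // mulrCA ler_wpM2l //.
    have : dual_norm (delta w) <= sigma * (1 + N w).
      have := NE w; have := dn0 w; set n := dual_norm _ => n0 nE.
      have h1 : (n - sigma) ^+ 2 >= 0 by exact: sqr_ge0.
      rewrite -(ler_pM2l sigma0); have := sqr_ge0 n; have := sqr_ge0 sigma; lra.
    by move=> /le_trans; apply; rewrite ler_wpM2l ?(ltW sigma0) // expR_ge1Dx.
  have [L1Z0 ExZ0] := Ex_unbiased_pairing gens_meas fdE sdelta mx unb mV xD L1Vd.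
  apply: (fin (fun w => Z w + expR (2 * k * N w)) (expR (2 * k) * Ex V)) => //.
  + rewrite (_ : (fun _ => _) = fun w => s * (V w * delta w (x w)) + V w * expR (2 * k * N w)).
      by apply: L1D => //; exact: L1Z.
    by apply/funext => w; rewrite /Z; ring.
  + rewrite (_ : (fun _ => _) = fun w => s * (V w * delta w (x w)) + V w * expR (2 * k * N w)).
      by rewrite ExD ?ExZ // ?ExZ0 ?mulr0 ?add0r //; exact: L1Z.
    by apply/funext => w; rewrite /Z; ring.
  + move=> w; apply: (le_trans (expR_le_quadratic _)); rewrite lerD2l ler_expR.
    by rewrite -mulrA ler_wpM2l.
- have q01 : 0 <= (4^-1 : R) <= 1 by apply/andP; split; lra.
  have [L1p Exp] := subgaussian_power q01.
  apply: (fin (fun w => expR k * expR (4^-1 * N w)) (expR k * (expR 4^-1 * Ex V))).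
  + rewrite (_ : (fun _ => _) = fun w => expR k * (V w * expR (4^-1 * N w))).
      exact: L1Z.
    by apply/funext => w; ring.
  + rewrite (_ : (fun _ => _) = fun w => expR k * (V w * expR (4^-1 * N w))).
      by rewrite ExZ // ler_wpM2l ?expR_ge0.
    by apply/funext => w; ring.
  + move=> w; rewrite -expRD ler_expR.
    have kN : 0 <= k + 4^-1 * N w by have := N0 w; lra.
    apply: (le_trans (ler_norm _)).
    rewrite -ler_sqr ?nnegrE // real_normK ?num_real // (le_trans (Z2 w)) //.
    have : 0 <= (k - 4^-1 * N w) ^+ 2 by exact: sqr_ge0.
    nra.
  + by rewrite mulrA -expRD ler_wpM2r // ler_expR; lra.
Qed.

End OneStep.

Section Moments.
Variable gens : set (set Om).
Hypothesis gens_meas : <<s gens >> `<=` measurable.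

Lemma cond_moment_le (Z : Om -> R) (c : R) : 0 <= c ->
  measurable_fun setT Z -> (forall w, 0 <= Z w) ->
  cond_expectation_le P <<s gens >> (fun w => (Z w)%:E) c%:E ->
  L1 Z /\ Ex Z <= c.
Proof.
move=> c0 mZ Z0 hZ.
have m1 : measurable_fun setT ((fun=> 1) : g_sigma_algebraType gens -> R).
  exact: measurable_cst.
have [] := cond_le_mul gens_meas c0 mZ Z0 hZ m1 (fun=> ler01) (L1_cst P 1).
rewrite Ex_cst mulr1 (_ : (fun w => _) = Z) //.
by apply/funext => w; rewrite mul1r.
Qed.

End Moments.

(** By the tangent of [expR] at the average (Jensen), the exponential of the average is at most the
    average of the exponentials, of expectation at most [expR 1]; then Markov's inequality at level
    [expR (1 + l)]. No relation between the [N i] enters. *)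
Lemma exp_average_tail (N : nat -> Om -> R) (m : nat) (l : R) : (0 < m)%N ->
  (forall i, (i < m)%N -> L1 (fun w => expR (N i w)) /\
    Ex (fun w => expR (N i w)) <= expR 1) ->
  (forall i, (i < m)%N -> measurable_fun setT (N i)) ->
  (P [set w | m%:R * (1 + l) < \sum_(i < m) N i w]%R <= (expR (- l))%:E)%E.
Proof.
move=> m0 hN mN.
have mp : 0 < m%:R :> R by rewrite ltr0n.
pose f w := expR (m%:R^-1 * \sum_(i < m) N i w).
pose g w := m%:R^-1 * \sum_(i < m) expR (N i w).
have mf : measurable_fun setT f.
  apply: measurableT_comp; first exact: measurable_expR.
  apply: measurable_funM; first exact: measurable_cst.
  by apply: measurable_sum => i; exact: mN.
have fg w : f w <= g w.
  set c := m%:R^-1 * \sum_(i < m) N i w.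
  have h i : expR c * (1 + (N i w - c)) <= expR (N i w).
    apply: (le_trans (ler_wpM2l (expR_ge0 c) (expR_ge1Dx (N i w - c)))).
    by rewrite -expRD subrKC.
  rewrite /g -ler_pdivrMl ?invr_gt0 // invrK.
  apply: le_trans (ler_sum _ (fun (i : 'I_m) _ => h i)).
  rewrite -mulr_sumr big_split /= sumrB sumr_const card_ord.
  rewrite (_ : \sum_(i < m) N i w = m%:R * c); last by rewrite /c mulVKf ?gt_eqF.
  by rewrite sumr_const card_ord -[c *+ m]mulr_natl subrr addr0 mulrC.
have L1g : L1 g by apply: L1Z; apply: L1_sum => i; have [] := hN i (ltn_ord i).
have f0 w : 0 <= f w by exact: expR_ge0.
have L1f : L1 f by apply: (L1_le mf _ L1g) => w; rewrite ger0_norm.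
have Exf : Ex f <= expR 1.
  apply: (le_trans (le_Ex L1f L1g fg)).
  rewrite ExZ; last by apply: L1_sum => i; have [] := hN i (ltn_ord i).
  rewrite Ex_sum; last by move=> i; have [] := hN i (ltn_ord i).
  rewrite ler_pdivrMl // mulr_natl -[in leRHS](card_ord m) -sumr_const.
  by apply: ler_sum => i _; have [] := hN i (ltn_ord i).
have -> : [set w | m%:R * (1 + l) < \sum_(i < m) N i w] = [set w | expR (1 + l) < f w].
  by apply/seteqP; split => w /=; rewrite /f ltr_expR ltr_pdivlMl.
have -> : expR (- l) = expR 1 / expR (1 + l).
  by rewrite -expRB; congr expR; ring.
by apply: markov_gt => //; [rewrite ExE // lee_fin|exact: expR_gt0].
Qed.

Section Martingale.
Variable gens : nat -> set (set Om).
Hypothesis gens_meas : forall t, <<s gens t >> `<=` measurable.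
Hypothesis gens_mono : forall t, <<s gens t >> `<=` <<s gens t.+1 >>.
Variables (m : nat) (delta : nat -> Om -> E -> R) (x : nat -> Om -> E).
Variables (sigma D : R) (s : nat -> R).
Hypotheses (sigma0 : 0 < sigma) (s0 : forall i, 0 <= s i).
Hypothesis sdelta : forall i w, scalar (delta i w).
Hypothesis mdelta : forall i, (i < m)%N ->
  dmeasurable (delta i : g_sigma_algebraType (gens i.+1) -> E -> R).
Hypothesis mx : forall i, (i < m)%N ->
  vmeasurable (x i : g_sigma_algebraType (gens i) -> E).
Hypothesis xD : forall i w, (i < m)%N -> `|x i w| <= D.
Hypothesis unb : forall i, (i < m)%N -> cond_unbiased P <<s gens i >> (delta i).

Let M k w := \sum_(i < k) s i * delta i w (x i w).

Let mono_fun d' (T : measurableType d') i j (f : Om -> T) : (i <= j)%N ->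
  measurable_fun setT (f : g_sigma_algebraType (gens i) -> T) ->
  measurable_fun setT (f : g_sigma_algebraType (gens j) -> T).
Proof.
move=> /subnK <-; elim: (j - i)%N => // k IH /IH mf _ B mB.
have := mf measurableT B mB; exact: gens_mono.
Qed.

Lemma martingale_measurable k : (k <= m)%N ->
  measurable_fun setT (M k : g_sigma_algebraType (gens k) -> R).
Proof.
move=> km; apply: measurable_sum => i.
have im : (i < m)%N by exact: leq_trans (ltn_ord i) km.
apply: (@mono_fun _ _ i.+1) => //.
apply: measurable_funM; first exact: measurable_cst.
apply: (dmeasurable_pairing fdE); first exact: mdelta.
by apply: (@mono_fun _ _ i) => //; exact: mx.
Qed.

(** The exponential of the past is measurable before step [k] and serves as the weight [V] of
    [subgaussian_mgf]; every step contributes one factor. *)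
Lemma martingale_mgf (lam : R) k : 0 <= lam -> (k <= m)%N ->
  (forall i, (i < m)%N -> cond_subgaussian P <<s gens i >> (delta i) sigma) ->
  L1 (fun w => expR (lam * M k w)) /\
  Ex (fun w => expR (lam * M k w)) <=
    expR (\sum_(i < k) 2 * (lam * s i * D * sigma) ^+ 2).
Proof.
move=> lam0 + subg; elim: k => [_|k IH km].
  rewrite big_ord0 expR0 (_ : (fun w => _) = fun=> 1).
    by rewrite Ex_cst; split => //; exact: L1_cst.
  by apply/funext => w; rewrite /M big_ord0 mulr0 expR0.
have [L1k Exk] := IH (ltnW km).
have mV : measurable_fun setT ((fun w => expR (lam * M k w)) : g_sigma_algebraType (gens k) -> R).
  apply: measurableT_comp; first exact: measurable_expR.
  apply: measurable_funM; first exact: measurable_cst.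
  by apply: martingale_measurable; exact: ltnW.
have ls0 : 0 <= lam * s k by rewrite mulr_ge0.
have [L1S ExS] := subgaussian_mgf (gens_meas (t := k)) sigma0 (sdelta k) (unb km) (subg k km)
  mV (fun w => expR_ge0 _) L1k (mx km) (fun w => xD w km) ls0.
have eqf : (fun w => expR (lam * M k w) * expR (lam * s k * delta k w (x k w))) =
    fun w => expR (lam * M k.+1 w).
  by apply/funext => w; rewrite /M big_ord_recr /= -expRD mulrDr mulrA.
rewrite eqf in L1S ExS; split => //; apply: (le_trans ExS).
by rewrite big_ord_recr /= addrC expRD ler_wpM2l ?expR_ge0.
Qed.

(** Chernoff's bound: [2 * lam ^+ 2 * q - lam * r] is minimal at [lam = r / (4 * q)], with value
    [- r ^+ 2 / (8 * q)]; hence the 8 in the condition on [r]. *)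
Lemma martingale_tail (S r l : R) : 0 <= D ->
  (forall i, (i < m)%N -> cond_subgaussian P <<s gens i >> (delta i) sigma) ->
  \sum_(i < m) s i ^+ 2 <= S -> 0 <= r -> 8 * l * (sigma ^+ 2 * D ^+ 2 * S) <= r ^+ 2 ->
  (P [set w | r < M m w]%R <= (expR (- l))%:E)%E.
Proof.
move=> D0 subg sS r0 rl.
have ss0 : 0 <= \sum_(i < m) s i ^+ 2 by rewrite sumr_ge0 // => i _; exact: sqr_ge0.
have S0 : 0 <= S by exact: le_trans sS.
set q := sigma ^+ 2 * D ^+ 2 * S in rl.
have q0 : 0 <= q by rewrite /q mulr_ge0 // mulr_ge0 ?sqr_ge0.
(* If [q = 0], either the vectors or the weights are zero, so the martingale vanishes at every
   outcome. *)
have [q00|qn0] := eqVneq q 0.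
  have M0 w : M m w = 0.
    rewrite /M big1 // => i _.
    have : D ^+ 2 == 0 \/ S = 0.
      move/eqP: q00; rewrite /q -mulrA mulf_eq0 gt_eqF ?exprn_gt0 //=.
      by rewrite mulf_eq0 => /orP[|/eqP] ?; [left|right].
    case=> [|e0]; first rewrite sqrf_eq0 => /eqP e0.
      have := xD w (ltn_ord i); rewrite e0 normr_le0 => /eqP ->.
      by rewrite scalar0 // mulr0.
    have : s i ^+ 2 <= 0.
      rewrite -e0; apply: le_trans sS; rewrite (bigD1 i) //= lerDl sumr_ge0 // => j _.
      exact: sqr_ge0.
    rewrite le_eqVlt ltNge sqr_ge0 orbF sqrf_eq0 => /eqP ->; exact: mul0r.
  rewrite (_ : [set w | _] = set0) ?measure0 ?lee_fin ?expR_ge0 //.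
  by apply/seteqP; split => w //=; rewrite M0 ltNge r0.
have qp : 0 < q by rewrite lt_neqAle eq_sym qn0.
pose lam := r / (4 * q).
have lam0 : 0 <= lam by rewrite divr_ge0 // mulr_ge0.
(* Here [r = 0] and [l <= 0], so the claimed bound is at least 1. *)
have [lamz|lamn] := eqVneq lam 0.
  have r00 : r = 0 by move/eqP: lamz; rewrite mulf_eq0 invr_eq0 mulf_eq0 (gt_eqF qp) orbF pnatr_eq0 orbF => /eqP.
  have l0 : l <= 0.
    by move: rl; rewrite r00 expr0n /= -mulrA pmulr_rle0 ?ltr0n // pmulr_lle0.
  apply: (le_trans (probability_le1 _ _)); last first.
    by rewrite lee_fin -(@expR0 R) ler_expR oppr_ge0.
  rewrite (_ : [set w | _] = [set: Om] `&` M m @^-1` `]r, +oo[%classic).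
    by apply: (sub_measurable_fun (gens_meas (t := m)) (martingale_measurable (leqnn m))).
  by rewrite setTI; apply/seteqP; split => w; rewrite /= in_itv /= andbT.
have lamp : 0 < lam by rewrite lt_neqAle eq_sym lamn.
have [L1M ExM] := martingale_mgf lam0 (leqnn m) subg.
have -> : [set w | r < M m w] = [set w | expR (lam * r) < expR (lam * M m w)].
  by apply/seteqP; split => w /=; rewrite ltr_expR ltr_pM2l.
apply: le_trans (markov_gt (L1_measurable L1M) (fun w => expR_ge0 _) (b := expR (2 * lam ^+ 2 * q)) _ (expR_gt0 _)) _.
  rewrite ExE // lee_fin (le_trans ExM) // ler_expR.
  rewrite (_ : \sum_(i < m) _ = 2 * lam ^+ 2 * (sigma ^+ 2 * D ^+ 2 * \sum_(i < m) s i ^+ 2)).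
    apply: ler_wpM2l; first by rewrite mulr_ge0 ?sqr_ge0.
    by apply: ler_wpM2l => //; rewrite mulr_ge0 ?sqr_ge0.
  by rewrite !mulr_sumr; apply: eq_bigr => i _; ring.
rewrite lee_fin -expRB ler_expR.
have -> : 2 * lam ^+ 2 * q - lam * r = - (r ^+ 2 / (8 * q)).
  by rewrite /lam; field.
rewrite lerN2 ler_pdivlMr; last by rewrite pmulr_rgt0.
by rewrite mulrCA mulrA.
Qed.

End Martingale.

End SubGaussian.

(** * The deterministic analysis *)

Lemma prox_step {R : realType} {E : normedModType R} (U : set E)
    (h J : E -> \bar R) (l : E -> R) (a : R) (y0 yp u : E) :
  convex_set U -> ccp J -> scalar l ->
  (forall v, U v -> h v \is a fin_num) ->
  U yp -> differentiable (fine \o h) yp -> edom J yp -> U u -> edom J u ->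
  U y0 ->
  (forall v, U v -> (J yp + (l (yp - y0)%R)%:E + a%:E * bregman h yp y0 <=
     J v + (l (v - y0)%R)%:E + a%:E * bregman h v y0)%E) ->
  0 <= a ->
  fine (J yp) - l (u - yp) <= fine (J u) +
    a * (rbregman h u y0 - rbregman h u yp - rbregman h yp y0).
Proof.
move=> cU cJ sl hfin Uyp dh Jyp Uu Ju Uy0 opt a0.
have := prox_ineq cU cJ sl hfin Uyp dh Jyp Uu Ju Uy0 opt a0.
rewrite rbregman_three_point -opprB (scalarN sl).
rewrite (scalarN (scalar_linear (egrad h yp))) (scalarN (scalar_linear (egrad h y0))).
lra.
Qed.

Lemma young {R : realType} (a b c : R) : 0 < c -> a * b <= c * b ^+ 2 + a ^+ 2 / (4 * c).
Proof.
move=> c0; have -> : a ^+ 2 / (4 * c) = c * (a / (2 * c)) ^+ 2.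
  by field; rewrite gt_eqF.
have {1}-> : a = 2 * c * (a / (2 * c)) by field; rewrite gt_eqF.
have := mulr_ge0 (ltW c0) (sqr_ge0 (b - a / (2 * c))); set z := a / _; lra.
Qed.

Lemma powR_3half {R : realType} (t : R) : 0 < t -> t `^ (3 / 2) = t * Num.sqrt t.
Proof.
move=> t0; rewrite (_ : 3 / 2 = 1 + 2^-1); last by field.
by rewrite powRD ?gt_eqF ?implybT // powRr1 ?ltW // powR12_sqrt // ltW.
Qed.

Section Averages.
Context {R : realType}.

Definition weight (t : nat) : R := t%:R * (t%:R + 1) / 2.

Lemma weight_beta t : (1 <= t)%N ->
  [/\ weight t * (1 - beta_ t) = weight t.-1, weight t * beta_ t = t%:R &
    0 <= (beta_ t : R) <= 1].
Proof.
case: t => // n _; rewrite /weight /beta_ /=.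
have n0 : 0 <= n%:R :> R by exact: ler0n.
rewrite -natr1; split; [field|field|]; try (by rewrite gt_eqF //; lra).
apply/andP; split; first by rewrite divr_ge0 //; lra.
by rewrite ler_pdivrMr; lra.
Qed.

Lemma weight_ge0 n : 0 <= weight n.
Proof. by rewrite /weight divr_ge0 // mulr_ge0 // addr_ge0. Qed.

Lemma weight_average t (c c' c'' : R) : (1 <= t)%N ->
  c <= (1 - beta_ t) * c' + beta_ t * c'' ->
  weight t * c <= weight t.-1 * c' + t%:R * c''.
Proof.
move=> t1; have [w1 w2 _] := weight_beta t1.
move/(ler_wpM2l (weight_ge0 t)); rewrite (_ : _ * (_ + _) =
  weight t * (1 - beta_ t) * c' + weight t * beta_ t * c''); last ring.
by rewrite w1 w2.
Qed.

End Averages.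

(** * First-order inequalities for the smooth terms *)

Section Path.
Context {R : realType} {X Y : normedModType R}.
Hypotheses (fdX : finite_dim X) (fdY : finite_dim Y).
Variables (XX : set X) (YY : set Y).
Variables (f g : X -> \bar R) (Phi : X -> Y -> R) (J : Y -> \bar R).
Variables (mu L Lxx Lyx Lyy : R).
Hypothesis problem : saddle_problem XX YY f g Phi J mu L Lxx Lyx Lyy.

Let fr x := fine (f x).
Let gr x := fine (g x).
Let Jr y := fine (J y).

Lemma f_fin x : XX x -> f x \is a fin_num /\ differentiable (fine \o f) x.
Proof.
move=> Xx; have [V [_ XV h]] := sp_f_differentiable problem.
by apply: h; exact: XV.
Qed.

Lemma f_gradient x x' : XX x -> XX x' -> fr x' + egrad f x' (x - x') <= fr x.
Proof.
move=> Xx Xx'; have := sp_f_strongly_convex problem Xx Xx'.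
rewrite -(fineK (f_fin Xx).1) -(fineK (f_fin Xx').1) -!EFinD lee_fin.
apply: le_trans; rewrite lerDl mulr_ge0 ?sqr_ge0 // divr_ge0 //.
exact: sp_mu_ge0 problem.
Qed.

(** Convexity at [x'] and the Lipschitz gradient replace an integration along the segment, at the
    price of [L] instead of [L / 2]; the term [2 * L] in [tau_] covers this. *)
Lemma f_smooth x x' : XX x -> XX x' ->
  fr x' <= fr x + egrad f x (x' - x) + L * `|x' - x| ^+ 2.
Proof.
move=> Xx Xx'; have h1 := f_gradient Xx Xx'.
have sf z := scalar_linear (egrad f z).
have h2 := dual_norm_pairing fdX (x' - x) (scalar_subf (sf x') (sf x)).
have h3 : dual_norm (egrad f x' \- egrad f x) * `|x' - x| <= L * `|x' - x| ^+ 2.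
  by rewrite expr2 mulrA ler_wpM2r // (sp_f_lipschitz problem).
by move: h1 h2; rewrite -opprB (scalarN (sf x')) /=; lra.
Qed.

Lemma Phi_differentiable x y : XX x -> YY y ->
  differentiable (fun q : X * Y => Phi q.1 q.2) (x, y).
Proof.
move=> Xx Yy; have [V [_ XV h]] := sp_Phi_differentiable problem.
by apply: h; exact: XV.
Qed.

Lemma Phi_differentiable_x x y : XX x -> YY y -> differentiable (Phi ^~ y) x.
Proof.
move=> Xx Yy; have h := Phi_differentiable Xx Yy.
have d : differentiable (fun z : X => (z, y)) x by exact: differentiable_pair.
exact: (differentiable_comp d h).
Qed.

Lemma Phi_differentiable_y x y : XX x -> YY y -> differentiable (Phi x) y.
Proof.
move=> Xx Yy; have h := Phi_differentiable Xx Yy.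
have d : differentiable (fun z : Y => (x, z)) y by exact: differentiable_pair.
exact: (differentiable_comp d h).
Qed.

Lemma Phi_gradient_x x x' y : XX x -> XX x' -> YY y ->
  gradx_Phi Phi x y (x' - x) <= Phi x' y - Phi x y.
Proof.
move=> Xx Xx' Yy; apply: (convex_gradient (sp_Phi_convex problem Yy)) => //.
exact: Phi_differentiable_x.
Qed.

Lemma Phi_gradient_y x y y' : XX x -> YY y -> YY y' ->
  Phi x y' - Phi x y <= grady_Phi Phi x y (y' - y).
Proof.
move=> Xx Yy Yy'; have dP := Phi_differentiable_y Xx Yy.
have := convex_gradient (sp_Phi_concave problem Xx) (differentiableN dP) Yy Yy'.
have -> : 'd (fun z => - Phi x z) y (y' - y) = - grady_Phi Phi x y (y' - y).
  exact: (congr1 (fun F : Y -> R => F (y' - y)) (diffN dP)).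
lra.
Qed.

Lemma Phi_smooth_x x x' y : XX x -> XX x' -> YY y ->
  Phi x' y <= Phi x y + gradx_Phi Phi x y (x' - x) + Lxx * `|x' - x| ^+ 2.
Proof.
move=> Xx Xx' Yy; have h1 := Phi_gradient_x Xx' Xx Yy.
have sf z := scalar_linear (gradx_Phi Phi z y).
have h2 := dual_norm_pairing fdX (x' - x) (scalar_subf (sf x') (sf x)).
have h3 : dual_norm (gradx_Phi Phi x' y \- gradx_Phi Phi x y) * `|x' - x| <= Lxx * `|x' - x| ^+ 2.
  by rewrite expr2 mulrA ler_wpM2r // (sp_Phi_xx problem).
by move: h1 h2; rewrite -opprB (scalarN (sf x')) /=; lra.
Qed.

Lemma grady_lipschitz x x' y y' : XX x -> XX x' -> YY y -> YY y' ->
  dual_norm (grady_Phi Phi x' y' \- grady_Phi Phi x y) <=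
    Lyx * `|x' - x| + Lyy * `|y' - y|.
Proof.
move=> Xx Xx' Yy Yy'.
have sf z z' := scalar_linear (grady_Phi Phi z z').
have h1 := sp_Phi_yx problem Xx' Xx Yy'.
have h2 := sp_Phi_yy problem Xx Yy' Yy.
apply: le_trans (lerD h1 h2).
have := dual_normD fdY (scalar_subf (sf x' y') (sf x y')) (scalar_subf (sf x y') (sf x y)).
by rewrite (_ : _ \+ _ = grady_Phi Phi x' y' \- grady_Phi Phi x y) //;
  apply/funext => v /=; rewrite subrKA.
Qed.

Lemma gradx_lipschitz x x' y y' : XX x -> XX x' -> YY y -> YY y' ->
  dual_norm (gradx_Phi Phi x' y' \- gradx_Phi Phi x y) <=
    Lxx * `|x' - x| + Lyx * `|y' - y|.
Proof.
move=> Xx Xx' Yy Yy'.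
have sf z z' := scalar_linear (gradx_Phi Phi z z').
have h1 := sp_Phi_xx problem Xx' Xx Yy'.
have h2 := sp_Phi_xy problem Xx Yy' Yy.
apply: le_trans (lerD h1 h2).
have := dual_normD fdX (scalar_subf (sf x' y') (sf x y')) (scalar_subf (sf x y') (sf x y)).
by rewrite (_ : _ \+ _ = gradx_Phi Phi x' y' \- gradx_Phi Phi x y) //;
  apply/funext => v /=; rewrite subrKA.
Qed.

End Path.

(** * Telescoping along one trajectory *)

Section Trajectory.
Context {R : realType} {X Y : normedModType R}.
Hypotheses (fdX : finite_dim X) (fdY : finite_dim Y).
Variables (XX : set X) (YY : set Y).
Variables (f g : X -> \bar R) (Phi : X -> Y -> R) (J : Y -> \bar R).
Variables (mu L Lxx Lyx Lyy : R).
Hypothesis problem : saddle_problem XX YY f g Phi J mu L Lxx Lyx Lyy.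
Variables (hX : X -> \bar R) (hY : Y -> \bar R).
Hypotheses (hX_dgf : is_dgf XX hX) (hY_dgf : is_dgf YY hY).
Hypothesis OmX_fin : (bregman_diameter XX hX < +oo)%E.
Hypothesis OmY_fin : (bregman_diameter YY hY < +oo)%E.
Variables (syPhi sxPhi sxf rho rho' : R).
Hypotheses (syPhi_gt0 : 0 < syPhi) (sxPhi_gt0 : 0 < sxPhi) (sxf_gt0 : 0 < sxf).
Hypotheses (rho_gt0 : 0 < rho) (rho'_gt0 : 0 < rho').
Variables (x xb xt : nat -> X) (y yb : nat -> Y) (s : nat -> Y -> R).
Variables (gx gf : nat -> X -> R) (gy : nat -> Y -> R).
Hypotheses (sgx : forall t, scalar (gx t)) (sgf : forall t, scalar (gf t)).
Hypothesis sgy : forall t, scalar (gy t).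

Local Notation alpha := (alpha_ Lyx Lyy syPhi rho).
Local Notation tau := (tau_ L Lxx Lyx sxPhi sxf rho').

(** The run of the algorithm at a single outcome. The oracle answers [gx], [gf], [gy] are arbitrary
    linear forms, so that this part contains no probability. *)
Record trajectory : Prop := Trajectory {
  tr_x1 : dgf_core XX hX (x 1) /\ xb 1 = x 1 ;
  tr_y1 : dgf_core YY hY (y 1) /\ yb 1 = y 1 ;
  tr_s1 : forall v, s 1 v = gy 1 v ;
  tr_s : forall t v, (1 <= t)%N ->
    s t.+1 v = (1 + theta_ t.+1) * gy t.+1 v - theta_ t.+1 * gy t v ;
  tr_y : forall t, (1 <= t)%N -> dgf_core YY hY (y t.+1) /\ edom J (y t.+1) ;
  tr_yopt : forall t u, (1 <= t)%N -> YY u ->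
    (J (y t.+1) - (s t (y t.+1 - y t)%R)%:E
       + ((alpha t)^-1)%:E * bregman hY (y t.+1) (y t) <=
     J u - (s t (u - y t)%R)%:E + ((alpha t)^-1)%:E * bregman hY u (y t))%E ;
  tr_xt : forall t, (1 <= t)%N ->
    xt t.+1 = (1 - beta_ t) *: xb t + beta_ t *: x t ;
  tr_x : forall t, (1 <= t)%N -> dgf_core XX hX (x t.+1) /\ edom g (x t.+1) ;
  tr_xopt : forall t u, (1 <= t)%N -> XX u ->
    (g (x t.+1) + (gx t (x t.+1 - x t) + gf t (x t.+1 - x t))%R%:E
       + ((tau t)^-1)%:E * bregman hX (x t.+1) (x t) <=
     g u + (gx t (u - x t) + gf t (u - x t))%R%:E
       + ((tau t)^-1)%:E * bregman hX u (x t))%E ;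
  tr_xb : forall t, (1 <= t)%N ->
    xb t.+1 = (1 - beta_ t) *: xb t + beta_ t *: x t.+1 ;
  tr_yb : forall t, (1 <= t)%N ->
    yb t.+1 = (1 - beta_ t) *: yb t + beta_ t *: y t.+1 }.

Hypothesis tr : trajectory.

Let fr z := fine (f z).
Let gr z := fine (g z).
Let Jr z := fine (J z).
Let DX := rbregman hX.
Let DY := rbregman hY.
Let OX := fine (bregman_diameter XX hX).
Let OY := fine (bregman_diameter YY hY).
Let sx := sxPhi + sxf.

Definition noise_x t v :=
  (gx t v - gradx_Phi Phi (x t) (y t.+1) v) + (gf t v - egrad f (xt t.+1) v).
Definition noise_y t v := gy t v - grady_Phi Phi (x t) (y t) v.

(** By strong convexity half of it multiplies [|x t.+1 - x t| ^+ 2], and that half is spent exactly: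
    [2 * L] and [t * Lxx] on smoothness errors, [t * Lyx] on the next extrapolation, the
    [t * sqrt t] part on the noise. *)
Definition coefX (t : R) :=
  2 * (2 * L + (Lxx + Lyx) * t + rho' * sx * (t * Num.sqrt t)).
Definition coefY (t : R) := 16 * (t * (Lyx + Lyy + rho * syPhi * Num.sqrt t)).

Lemma core_x t : (1 <= t)%N -> dgf_core XX hX (x t).
Proof.
by case: t => [//|[_|t _]]; [exact: (tr_x1 tr).1 | exact: (tr_x tr _).1].
Qed.

Lemma core_y t : (1 <= t)%N -> dgf_core YY hY (y t).
Proof.
by case: t => [//|[_|t _]]; [exact: (tr_y1 tr).1 | exact: (tr_y tr _).1].
Qed.

Lemma in_x t : (1 <= t)%N -> XX (x t).
Proof. by case/core_x. Qed.

Lemma in_y t : (1 <= t)%N -> YY (y t).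
Proof. by case/core_y. Qed.

Lemma in_xb t : (1 <= t)%N -> XX (xb t).
Proof.
case: t => // t _; elim: t => [|t IH].
  by rewrite (tr_x1 tr).2; exact: in_x.
have [_ _ b01] := @weight_beta R t.+1 isT.
rewrite (tr_xb tr) // addrC; apply: convex_setE => //; last exact: in_x.
exact: sp_X_convex problem.
Qed.

Lemma in_yb t : (1 <= t)%N -> YY (yb t).
Proof.
case: t => // t _; elim: t => [|t IH].
  by rewrite (tr_y1 tr).2; exact: in_y.
have [_ _ b01] := @weight_beta R t.+1 isT.
rewrite (tr_yb tr) // addrC; apply: convex_setE => //; last exact: in_y.
exact: sp_Y_convex problem.
Qed.

Lemma in_xt t : (1 <= t)%N -> XX (xt t.+1).
Proof.
move=> t1; have [_ _ b01] := @weight_beta R t t1.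
rewrite (tr_xt tr) // addrC; apply: convex_setE => //.
- exact: sp_X_convex problem.
- exact: in_x.
- exact: in_xb.
Qed.

Lemma beta1 : beta_ 1 = 1 :> R.
Proof. by rewrite /beta_ (_ : 1%:R + 1 = 2) // divff ?pnatr_eq0. Qed.

(** Since [beta_ 1 = 1], the average of index 2 is [x 2], and the initial point, which may lie
    outside the domain of [g], disappears. *)
Lemma dom_xb t : (2 <= t)%N -> edom g (xb t).
Proof.
case: t => [//|[//|t _]]; elim: t => [|t IH].
  rewrite (tr_xb tr) // beta1 subrr scale0r add0r scale1r.
  by have [] := tr_x tr (isT : (1 <= 1)%N).
have [_ _ b01] := @weight_beta R t.+2 isT.
rewrite (tr_xb tr) // addrC; apply: edom_convex => //.
- exact: ccp_gtNy (sp_g_ccp problem).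
- exact: ccp_convex (sp_g_ccp problem).
- by have [] := tr_x tr (isT : (1 <= t.+2)%N).
Qed.

Lemma dom_yb t : (2 <= t)%N -> edom J (yb t).
Proof.
case: t => [//|[//|t _]]; elim: t => [|t IH].
  rewrite (tr_yb tr) // beta1 subrr scale0r add0r scale1r.
  by have [] := tr_y tr (isT : (1 <= 1)%N).
have [_ _ b01] := @weight_beta R t.+2 isT.
rewrite (tr_yb tr) // addrC; apply: edom_convex => //.
- exact: ccp_gtNy (sp_J_ccp problem).
- exact: ccp_convex (sp_J_ccp problem).
- by have [] := tr_y tr (isT : (1 <= t.+2)%N).
Qed.

Lemma scalar_s t : (1 <= t)%N -> scalar (s t).
Proof.
case: t => [//|[_|t _]] a u v; first by rewrite !(tr_s1 tr) sgy.
by rewrite !(tr_s tr) // !sgy; ring.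
Qed.

Lemma scalar_noise_x t : scalar (noise_x t).
Proof.
move=> a u v; rewrite /noise_x sgx sgf.
by rewrite (scalar_linear (gradx_Phi _ _ _)) (scalar_linear (egrad _ _)); ring.
Qed.

Lemma scalar_noise_y t : scalar (noise_y t).
Proof.
by move=> a u v; rewrite /noise_y sgy (scalar_linear (grady_Phi _ _ _)); ring.
Qed.

Lemma coefX_tau (t : nat) : (1 <= t)%N ->
  t%:R * (tau t)^-1 = coefX t%:R /\ 0 <= (tau t)^-1.
Proof.
move=> t1; have t0 : 0 < t%:R :> R by rewrite ltr0n.
have pw := powR_3half t0.
have h : 0 <= coefX t%:R.
  have h1 : 0 <= (Lxx + Lyx) * t%:R.
    by rewrite mulr_ge0 // addr_ge0 ?(sp_Lxx_ge0 problem) ?(sp_Lyx_ge0 problem).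
  have h2 : 0 <= rho' * sx * (t%:R * Num.sqrt t%:R).
    by rewrite !mulr_ge0 ?sqrtr_ge0 ?addr_ge0 // ltW.
  by have := sp_L_ge0 problem; rewrite /coefX; lra.
rewrite /tau_ pw invf_div -/sx -/(coefX _); split; first by rewrite mulrC divfK ?gt_eqF.
by rewrite divr_ge0 // ltW.
Qed.

Lemma coefY_alpha (t : nat) : (1 <= t)%N ->
  t%:R * (alpha t)^-1 = coefY t%:R /\ 0 <= (alpha t)^-1.
Proof.
move=> t1; have t0 : 0 < t%:R :> R by rewrite ltr0n.
have yx := sp_Lyx_ge0 problem; have yy := sp_Lyy_ge0 problem.
have h : 0 <= Lyx + Lyy + rho * syPhi * Num.sqrt t%:R.
  by rewrite !addr_ge0 // !mulr_ge0 ?sqrtr_ge0 // ltW.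
rewrite /alpha_ div1r invrK /coefY; split; first by ring.
by rewrite mulr_ge0.
Qed.

Section Comparison.
Variables (u : X) (v : Y).
Hypotheses (Xu : XX u) (gu : edom g u) (Yv : YY v) (Jv : edom J v).

Definition saddle_diff t :=
  fr (xb t) + gr (xb t) + Phi (xb t) v - Jr v
  - (fr u + gr u + Phi u (yb t) - Jr (yb t)).

Let convex_avg (E : normedModType R) (h : E -> \bar R) (z zb : nat -> E) t :
  ccp h -> (1 <= t)%N -> (forall t, (2 <= t)%N -> edom h (zb t)) ->
  (forall t, (1 <= t)%N -> edom h (z t.+1)) ->
  (forall t, (1 <= t)%N -> zb t.+1 = (1 - beta_ t) *: zb t + beta_ t *: z t.+1) ->
  fine (h (zb t.+1)) <= (1 - beta_ t) * fine (h (zb t)) + beta_ t * fine (h (z t.+1)).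
Proof.
move=> [hNy _ ch _] t1 db dz hb.
(* At [t = 1] the value at [zb 1] may be infinite, but its coefficient [1 - beta_ 1] is zero. *)
case: t t1 => [//|[_|t _]].
  by rewrite hb // beta1 subrr scale0r add0r scale1r mul0r add0r mul1r.
have [_ _ b01] := @weight_beta R t.+2 isT.
rewrite [leRHS]addrC hb // (addrC (_ *: _)); apply: econvex_fine => //.
- by apply: fin_num_edom => //; exact: dz.
- by apply: fin_num_edom => //; exact: db.
Qed.

(** The accelerated gradient estimate. Because the gradient is taken at [xt t.+1], one has [xb t.+1
    - xt t.+1 = beta_ t *: (x t.+1 - x t)], and the smoothness error carries [weight t * beta_ t ^+
    2 = t * beta_ t <= 2]. *)
Lemma f_step t : (1 <= t)%N ->
  weight t * fr (xb t.+1) <= weight t.-1 * fr (xb t)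
    + t%:R * (fr u + egrad f (xt t.+1) (x t.+1 - u)) + 2 * L * `|x t.+1 - x t| ^+ 2.
Proof.
move=> t1; have [w1 w2 b01] := @weight_beta R t t1; have [b0 b1] := andP b01.
set b := beta_ t in w1 w2 b0 b1 *; set a2 := `|_| ^+ 2.
have Xt := in_xt t1; have Xb' := in_xb (leqW t1); have Xb := in_xb t1.
have h1 := f_smooth fdX problem Xt (in_xb (isT : (1 <= t.+1)%N)).
have h2 := f_gradient problem Xb Xt.
have h3 := f_gradient problem Xu Xt.
set G := egrad f (xt t.+1) in h1 h2 h3 *; have sG : scalar G := scalar_linear _.
have e1 : xb t.+1 - xt t.+1 = b *: (x t.+1 - x t).
  by rewrite (tr_xb tr) // (tr_xt tr) // opprD addrACA subrr add0r -scalerBr.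
have e2 : xb t.+1 - xt t.+1 = (1 - b) *: (xb t - xt t.+1) + b *: (x t.+1 - xt t.+1).
  rewrite !scalerBr addrACA -opprD -scalerDl subrK scale1r.
  by rewrite {1}(tr_xb tr).
have e3 : G (xb t.+1 - xt t.+1) = (1 - b) * G (xb t - xt t.+1) + b * (G (x t.+1 - u) + G (u - xt t.+1)).
  by rewrite e2 [LHS](scalarD sG) !(scalarZ sG) -[X in _ = _ + _ * X](scalarD sG) subrKA.
have e4 : `|xb t.+1 - xt t.+1| ^+ 2 = b ^+ 2 * a2.
  by rewrite e1 normrZ ger0_norm // exprMn.
have b1' : 0 <= 1 - b by lra.
have m2 := ler_wpM2l b1' h2; have m3 := ler_wpM2l b0 h3.
have h4 : fr (xb t.+1) - L * (b ^+ 2 * a2) <= (1 - b) * fr (xb t) + b * (fr u + G (x t.+1 - u)).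
  by rewrite -e4 /fr; lra.
have := weight_average t1 h4.
have h5 : weight t * (L * (b ^+ 2 * a2)) <= 2 * L * a2.
  have -> : weight t * (L * (b ^+ 2 * a2)) = (weight t * b) * b * (L * a2) by ring.
  rewrite w2 -[leRHS]mulrA ler_wpM2r ?mulr_ge0 ?sqr_ge0 ?(sp_L_ge0 problem) //.
  have t0 : 0 < t%:R :> R by rewrite ltr0n.
  rewrite /b /beta_ mulrA ler_pdivrMr; lra.
lra.
Qed.

(** Convexity along the averages is combined with the two prox inequalities. [Phi] is linearized in
    [y] at the new iterates, so the mismatch between that gradient and [s t] remains for the
    extrapolation to absorb. *)
Lemma gap_step t : (1 <= t)%N ->
  weight t * saddle_diff t.+1 <= weight t.-1 * saddle_diff t
    + t%:R * noise_x t (u - x t.+1)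
    + coefX t%:R * (DX u (x t) - DX u (x t.+1) - DX (x t.+1) (x t))
    + (2 * L + t%:R * Lxx) * `|x t.+1 - x t| ^+ 2
    + t%:R * (grady_Phi Phi (x t.+1) (y t.+1) (v - y t.+1) - s t (v - y t.+1))
    + coefY t%:R * (DY v (y t) - DY v (y t.+1) - DY (y t.+1) (y t)).
Proof.
move=> t1; have t1' : (1 <= t.+1)%N by [].
have t0 : 0 <= t%:R :> R by exact: ler0n.
have [w1 w2 b01] := @weight_beta R t t1; have [b0 b1] := andP b01.
have [eX tau0] := coefX_tau t1; have [eY al0] := coefY_alpha t1.
rewrite -eX -eY; set a2 := `|_| ^+ 2.
have hf := f_step t1; rewrite -/a2 in hf.
have hg := weight_average t1 (convex_avg (sp_g_ccp problem) t1 dom_xb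
  (fun t h => (tr_x tr h).2) (tr_xb tr)).
have hJ := weight_average t1 (convex_avg (sp_J_ccp problem) t1 dom_yb
  (fun t h => (tr_y tr h).2) (tr_yb tr)).
have hP1 : weight t * Phi (xb t.+1) v <= weight t.-1 * Phi (xb t) v + t%:R * Phi (x t.+1) v.
  apply: weight_average => //; rewrite (tr_xb tr) // (addrC (_ *: _)) [leRHS]addrC.
  by apply: (convex_functionE (sp_Phi_convex problem Yv)); [exact: in_x|exact: in_xb|].
have hP2 : weight t * - Phi u (yb t.+1) <= weight t.-1 * - Phi u (yb t) + t%:R * - Phi u (y t.+1).
  apply: weight_average => //; rewrite (tr_yb tr) // (addrC (_ *: _)) [leRHS]addrC.
  by apply: (convex_functionE (sp_Phi_concave problem Xu)); [exact: in_y|exact: in_yb|].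
have Xx := in_x t1; have Xx' := in_x t1'; have Yy := in_y t1; have Yy' := in_y t1'.
have q1 := Phi_gradient_y problem Xx' Yy' Yv.
have q2 := Phi_smooth_x fdX problem Xx Xx' Yy'.
have q3 := Phi_gradient_x problem Xx Xu Yy'.
rewrite -/a2 in q2.
have px := prox_step (sp_X_convex problem) (sp_g_ccp problem)
  (scalar_addf (sgx t) (sgf t)) (dgf_fin hX_dgf OmX_fin (tr_x1 tr).1) Xx'
  (dgf_differentiable hX_dgf (core_x t1').2) (tr_x tr t1).2 Xu gu Xx
  (fun z => tr_xopt tr t1) tau0.
have sns : scalar (fun z => - s t z) by move=> a z z'; rewrite (scalar_s t1); ring.
have py := prox_step (sp_Y_convex problem) (sp_J_ccp problem)
  sns (dgf_fin hY_dgf OmY_fin (tr_y1 tr).1) Yy'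
  (dgf_differentiable hY_dgf (core_y t1').2) (tr_y tr t1).2 Yv Jv Yy
  (fun z => tr_yopt tr t1) al0.
have sG := scalar_linear (gradx_Phi Phi (x t) (y t.+1)).
have sF := scalar_linear (egrad f (xt t.+1)).
have r1 : gradx_Phi Phi (x t) (y t.+1) (x t.+1 - x t) - gradx_Phi Phi (x t) (y t.+1) (u - x t)
    = - gradx_Phi Phi (x t) (y t.+1) (u - x t.+1).
  by rewrite -(scalarB sG) -(scalarN sG) opprB; congr (gradx_Phi _ _ _ _); rewrite opprB addrA subrK.
have r2 : egrad f (xt t.+1) (x t.+1 - u) = - egrad f (xt t.+1) (u - x t.+1).
  by rewrite -(scalarN sF) opprB.
rewrite r2 in hf.
have core : gr (x t.+1) + Phi (x t.+1) v + Jr (y t.+1) - Phi u (y t.+1)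
      - egrad f (xt t.+1) (u - x t.+1) <=
    gr u + Jr v + noise_x t (u - x t.+1) + Lxx * a2
    + (grady_Phi Phi (x t.+1) (y t.+1) (v - y t.+1) - s t (v - y t.+1))
    + (tau t)^-1 * (DX u (x t) - DX u (x t.+1) - DX (x t.+1) (x t))
    + (alpha t)^-1 * (DY v (y t) - DY v (y t.+1) - DY (y t.+1) (y t)).
  move: q1 q2 q3 px py r1; rewrite /noise_x /= -/(DX u _) -/(DX u _) -/(DX _ (x t)).
  rewrite -/(DY v _) -/(DY v _) -/(DY _ (y t)) -/(gr _) -/(gr u) -/(Jr _) -/(Jr v).
  set c1 := (tau t)^-1 * _; set c2 := (alpha t)^-1 * _.
  clear hf hg hJ hP1 hP2 w1 w2 b0 b1 b01 eX eY tau0 al0; lra.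
have hw : weight t = weight t.-1 + t%:R :> R by rewrite -w1 -w2; ring.
move: hw hf hg hJ hP1 hP2 (ler_wpM2l t0 core).
rewrite -[fine (g (xb t.+1))]/(gr _) -[fine (g (xb t))]/(gr _) -[fine (g (x t.+1))]/(gr _).
rewrite -[fine (J (yb t.+1))]/(Jr _) -[fine (J (yb t))]/(Jr _) -[fine (J (y t.+1))]/(Jr _).
rewrite /saddle_diff; clear q1 q2 q3 px py r1 r2 w1 w2 b0 b1 b01 eX eY tau0 al0 t0 core.
set c1 := DX u _ - _ - _; set c2 := DY v _ - _ - _.
move: (grady_Phi _ _ _ _) (noise_x _ _) (egrad _ _ _) (s t _) (tau t)^-1 (alpha t)^-1 c1 c2.
move: (weight t) (weight t.-1) t%:R => w w' n e1 e2 e3 e4 e5 e6 e7 e8.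
move: (fr _) (fr _) (fr _) (gr _) (gr _) (gr _) (gr _) (Jr _) (Jr _) (Jr _) (Jr _).
move: (Phi _ _) (Phi _ _) (Phi _ _) (Phi _ _) (Phi _ _) (Phi _ _) => p1 p2 p3 p4 p5 p6.
move=> fr0 fr1 fr2 gr0 gr1 gr2 gr3 J0 J1 J2 J3 -> *; lra.
Qed.

(** What step [t] leaves once the squared displacements are absorbed. The noises are paired at [x t]
    and [y t], which precede them. Of the factor [2 * t - 1] of the noise in [y], [t] is carried to
    the next step, where the extrapolation cancels it up to a displacement, and [t - 1] remains. *)
Definition potential_term (t : nat) : R :=
  t%:R * noise_x t (u - x t)
  + Num.sqrt t%:R / (4 * (rho' * sx)) * dual_norm (noise_x t) ^+ 2
  - (t%:R - 1) * noise_y t (v - y t)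
  + Num.sqrt t%:R / (4 * (rho * syPhi)) * dual_norm (noise_y t) ^+ 2.

Let Gy t := grady_Phi Phi (x t) (y t).

Let DXle t : (1 <= t)%N -> 0 <= OX - DX u (x t).
Proof.
move=> t1; rewrite subr_ge0.
exact: (rbregman_le hX_dgf OmX_fin (tr_x1 tr).1 Xu (core_x t1)).
Qed.

Let DYle t : (1 <= t)%N -> 0 <= OY - DY v (y t).
Proof.
move=> t1; rewrite subr_ge0.
exact: (rbregman_le hY_dgf OmY_fin (tr_y1 tr).1 Yv (core_y t1)).
Qed.

Let DXge t : (1 <= t)%N -> 2^-1 * `|x t.+1 - x t| ^+ 2 <= DX (x t.+1) (x t).
Proof.
move=> t1; apply: (rbregman_ge hX_dgf OmX_fin (tr_x1 tr).1); last exact: core_x.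
exact: in_x.
Qed.

Let DYge z t : (1 <= t)%N -> YY z -> 2^-1 * `|z - y t| ^+ 2 <= DY z (y t).
Proof.
move=> t1 Yz; apply: (rbregman_ge hY_dgf OmY_fin (tr_y1 tr).1) => //.
exact: core_y.
Qed.

Let sx0 : 0 < sx. Proof. exact: addr_gt0. Qed.

(** The term [c * (t * sqrt t)] is the share of [coefX] or [coefY] set aside for the noise. The form
    with [sqrt n] matches the allowance that [potential] keeps from the previous step; the other one
    is for the current noise. *)
Let noise_young (E : normedModType R) (l : E -> R) (z : E) (t n c : R) :
  finite_dim E -> scalar l -> 0 < c -> 0 < t -> 0 <= n <= t ->
  n * l z <= c * (t * Num.sqrt t) * `|z| ^+ 2
    + Num.sqrt n / (4 * c) * dual_norm l ^+ 2 /\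
  n * l z <= c * (t * Num.sqrt t) * `|z| ^+ 2
    + Num.sqrt t / (4 * c) * dual_norm l ^+ 2.
Proof.
move=> fdE sl c0 t0 /andP[n0 nt].
have q0 : 0 < Num.sqrt t by rewrite sqrtr_gt0.
have p0 := sqrtr_ge0 n; have pq : Num.sqrt n <= Num.sqrt t by rewrite ler_wsqrtr.
have tE : t = Num.sqrt t ^+ 2 by rewrite sqr_sqrtr // ltW.
have nE : n = Num.sqrt n ^+ 2 by rewrite sqr_sqrtr.
set p := Num.sqrt n in p0 pq nE *; set q := Num.sqrt t in q0 pq tE *.
have h : n * l z <= c * (t * q) * `|z| ^+ 2 + p / (4 * c) * dual_norm l ^+ 2.
  have h1 := ler_wpM2l n0 (dual_norm_pairing fdE z sl).
  apply: (le_trans h1); rewrite [leLHS]mulrA.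
  have c1 : 0 < c * (t * q) by rewrite !mulr_gt0.
  apply: (le_trans (young (n * dual_norm l) `|z| c1)); rewrite lerD2l.
  rewrite exprMn mulrAC ler_wpM2r ?sqr_ge0 // ler_pdivrMr ?mulr_gt0 //.
  have -> : p / (4 * c) * (4 * (c * (t * q))) = p * (t * q).
    by field; rewrite gt_eqF.
  rewrite nE tE (_ : (p ^+ 2) ^+ 2 = p * p ^+ 3); last ring.
  rewrite (_ : q ^+ 2 * q = q ^+ 3); last ring.
  by rewrite ler_wpM2l // lerXn2r // nnegrE ltW.
split => //; apply: (le_trans h); rewrite lerD2l ler_wpM2r ?sqr_ge0 //.
by rewrite ler_wpM2r // invr_ge0 mulr_ge0 // ltW.
Qed.

Lemma coefX_mono (n t : R) : 0 <= n -> n <= t -> coefX n <= coefX t.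
Proof.
move=> n0 nt; rewrite /coefX ler_pM2l ?ltr0n // lerD //.
  by rewrite lerD2l ler_wpM2l // addr_ge0 ?(sp_Lxx_ge0 problem) ?(sp_Lyx_ge0 problem).
rewrite ler_wpM2l //; first by rewrite mulr_ge0 // ltW.
by rewrite ler_pM ?sqrtr_ge0 // ler_wsqrtr.
Qed.

Lemma coefY_mono (n t : R) : 0 <= n -> n <= t -> coefY n <= coefY t.
Proof.
move=> n0 nt; rewrite /coefY ler_pM2l ?ltr0n // ler_pM //.
  rewrite !addr_ge0 ?(sp_Lyy_ge0 problem) ?(sp_Lyx_ge0 problem) //.
  by rewrite !mulr_ge0 ?sqrtr_ge0 // ltW.
rewrite lerD2l ler_wpM2l ?ler_wsqrtr //.
by rewrite mulr_ge0 // ltW.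
Qed.

(** The step index clears the denominator of [theta_]; as [theta_ 1 = 0], the initial [s 1] follows
    the same formula. *)
Lemma s_weighted n z : n.+1%:R * s n.+1 z =
  (2 * n.+1%:R - 1) * gy n.+1 z - n%:R * gy n z.
Proof.
case: n => [|n]; first by rewrite (tr_s1 tr) mul0r subr0; congr (_ * _); ring.
have e : n.+1%:R = n.+2%:R - 1 :> R by rewrite -[n.+2]addn1 natrD addrK.
rewrite (tr_s tr) // /theta_ e.
have : n.+2%:R != 0 :> R by rewrite pnatr_eq0.
by move: n.+2%:R => N N0; field.
Qed.

Let grady_cross n z :
  n%:R * (Gy n.+1 z - Gy n z) <=
    n%:R * Lyx * `|x n.+1 - x n| ^+ 2 + n%:R * Lyx / 4 * `|z| ^+ 2
    + n%:R * Lyy * `|y n.+1 - y n| ^+ 2 + n%:R * Lyy / 4 * `|z| ^+ 2.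
Proof.
(* At [n = 0] the factor removes the iterates of index 0, which mean nothing. *)
case: n => [|n]; first by rewrite !mul0r !addr0.
have n1 : (1 <= n.+1)%N by [].
have t1 : (1 <= n.+2)%N by [].
set an := `|x _ - _|; set bn := `|y _ - _|; set b := `|z|.
have l1 := grady_lipschitz fdY problem (in_x n1) (in_x t1) (in_y n1) (in_y t1).
rewrite -/an -/bn in l1.
have sG k := scalar_linear (grady_Phi Phi (x k) (y k)).
have l2 := dual_norm_pairing fdY z (scalar_subf (sG n.+2) (sG n.+1)).
rewrite -/b /= in l2.
have l4 := le_trans l2 (ler_wpM2r (normr_ge0 z) l1); rewrite -/b in l4.
have l5 := ler_wpM2l (ler0n R n.+1) l4; rewrite /Gy.
have q1 : 0 <= n.+1%:R * Lyx by rewrite mulr_ge0 // (sp_Lyx_ge0 problem).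
have q2 : 0 <= n.+1%:R * Lyy by rewrite mulr_ge0 // (sp_Lyy_ge0 problem).
have := mulr_ge0 q1 (sqr_ge0 (an - b / 2)); have := mulr_ge0 q2 (sqr_ge0 (bn - b / 2)).
move: l5; lra.
Qed.

(** The invariant of the telescoping. As the coefficients increase and the Bregman distances stay
    below the diameters, summation by parts leaves diameter minus current distance. The gradient
    difference at [v - y n.+1] cancels in the next step up to a displacement. The negative squares
    are reserves: [n * Lyx] and [n * Lyy] pay for [grady_cross], the squared noise norm pays for
    moving [noise_y n] to another base point, and the [n * sqrt n] part pays for moving it back to
    [y n] in [path_sum]. *)
Lemma potential n :
  weight n * saddle_diff n.+1 <=
    coefX n%:R * (OX - DX u (x n.+1)) + coefY n%:R * (OY - DY v (y n.+1))
    + n%:R * (Gy n.+1 (v - y n.+1) - Gy n (v - y n.+1))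
    - n%:R * Lyx * `|x n.+1 - x n| ^+ 2
    - (n%:R * Lyy + 2 * (rho * syPhi) * (n%:R * Num.sqrt n%:R)) * `|y n.+1 - y n| ^+ 2
    - Num.sqrt n%:R / (8 * (rho * syPhi)) * dual_norm (noise_y n) ^+ 2
    - n%:R * noise_y n (v - y n.+1)
    + \sum_(i < n) potential_term i.+1.
Proof.
elim: n => [|n IH].
  (* For [n = 0] all terms vanish except the [L] part of [coefX], which is nonnegative. *)
  rewrite !mulr0n big_ord0 /weight mulr0n sqrtr0 !mul0r ?mulr0 ?mul0r !subr0 !addr0.
  apply: addr_ge0; last by rewrite /coefY !(mul0r, mulr0).
  apply: addr_ge0; last by rewrite /coefY !(mul0r, mulr0).
  rewrite mulr_ge0 ?DXle // /coefX !(mul0r, mulr0, addr0).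
  by rewrite !mulr_ge0 // (sp_L_ge0 problem).
have t1 : (1 <= n.+1)%N by [].
have hs := gap_step t1.
set a2 := `|x n.+2 - x n.+1| ^+ 2 in hs *.
set b := `|y n.+2 - y n.+1|.
set an := `|x n.+1 - x n| in IH; set bn := `|y n.+1 - y n| in IH.
have t0 : 0 < n.+1%:R :> R by rewrite ltr0n.
have n0 : 0 <= n%:R :> R by exact: ler0n.
have nt : n%:R <= n.+1%:R :> R by rewrite ler_nat.
have nt' : 0 <= (n%:R : R) <= n.+1%:R by rewrite n0 nt.
have tt' : 0 <= (n.+1%:R : R) <= n.+1%:R by rewrite lexx (ltW t0).
have rs0 : 0 < 2 * (rho * syPhi) by rewrite !mulr_gt0.
have rx0 : 0 < rho' * sx by rewrite mulr_gt0.
have i1 : coefX n%:R * (OX - DX u (x n.+1)) <= coefX n.+1%:R * (OX - DX u (x n.+1)).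
  by rewrite ler_wpM2r ?DXle // coefX_mono.
have i2 : coefY n%:R * (OY - DY v (y n.+1)) <= coefY n.+1%:R * (OY - DY v (y n.+1)).
  by rewrite ler_wpM2r ?DYle // coefY_mono.
have cX0 : 0 <= coefX n.+1%:R.
  apply: le_trans (coefX_mono (lexx 0) (ltW t0)).
  by rewrite /coefX !(mul0r, mulr0, addr0) !mulr_ge0 // (sp_L_ge0 problem).
have cY0 : 0 <= coefY n.+1%:R.
  by apply: le_trans (coefY_mono (lexx 0) (ltW t0)); rewrite /coefY !(mul0r, mulr0).
have i3 := ler_wpM2l cX0 (DXge t1).
have i4 := ler_wpM2l cY0 (DYge t1 (in_y (isT : (1 <= n.+2)%N))).
rewrite -/a2 in i3; rewrite -/b in i4.
have [_ i5] := noise_young (x n.+1 - x n.+2) fdX (scalar_noise_x n.+1) rx0 t0 tt'.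
have [_ i6] := noise_young (y n.+2 - y n.+1) fdY (scalar_noise_y n.+1) rs0 t0 nt'.
have [i7 _] := noise_young (y n.+1 - y n.+2) fdY (scalar_noise_y n) rs0 t0 nt'.
rewrite [`|y n.+1 - y n.+2|]distrC -/b in i7; rewrite -/b in i6.
rewrite [`|x n.+1 - x n.+2|]distrC -/a2 in i5.
have i8 := grady_cross n (y n.+2 - y n.+1); rewrite -/an -/bn -/b in i8.
have i9 : n.+1%:R * (Gy n.+2 (v - y n.+2) - s n.+1 (v - y n.+2)) =
    n.+1%:R * (Gy n.+2 (v - y n.+2) - Gy n.+1 (v - y n.+2))
    - n%:R * (Gy n.+1 (v - y n.+2) - Gy n (v - y n.+2))
    - (2 * n.+1%:R - 1) * noise_y n.+1 (v - y n.+2) + n%:R * noise_y n (v - y n.+2).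
  by rewrite mulrBr s_weighted /noise_y /Gy -natr1; ring.
rewrite big_ord_recr /= [potential_term n.+1]/potential_term.
have vE : v - y n.+1 = (v - y n.+2) + (y n.+2 - y n.+1) by rewrite subrKA.
have lE (l : Y -> R) : scalar l -> l (v - y n.+1) = l (v - y n.+2) + l (y n.+2 - y n.+1).
  by move=> sl; rewrite vE (scalarD sl).
have lN (l : Y -> R) : scalar l -> l (y n.+1 - y n.+2) = - l (y n.+2 - y n.+1).
  by move=> sl; rewrite -(scalarN sl) opprB.
have uE : noise_x n.+1 (u - x n.+2) = noise_x n.+1 (u - x n.+1) + noise_x n.+1 (x n.+1 - x n.+2).
  by rewrite -(scalarD (scalar_noise_x _)) subrKA.
rewrite uE [X in _ + n.+1%:R * X](_ : _ = Gy n.+2 (v - y n.+2) - s n.+1 (v - y n.+2)) // i9 in hs.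
rewrite (lE _ (scalar_noise_y n.+1)); rewrite (lN _ (scalar_noise_y n)) in i7.
rewrite (lE _ (scalar_noise_y n)) (lE _ (scalar_linear (grady_Phi Phi (x n.+1) (y n.+1)))) in IH.
rewrite [Gy n _](lE _ (scalar_linear (grady_Phi Phi (x n) (y n)))) in IH.
rewrite -/(Gy _ _) in IH.
have rsn0 : rho * syPhi != 0 by rewrite gt_eqF // mulr_gt0.
have rxn0 : rho' * sx != 0 by rewrite gt_eqF.
have Lyx0 := sp_Lyx_ge0 problem; have Lyy0 := sp_Lyy_ge0 problem.
have j3 : (2 * L + (Lxx + Lyx) * n.+1%:R + rho' * sx * (n.+1%:R * Num.sqrt n.+1%:R)) * a2
    <= coefX n.+1%:R * DX (x n.+2) (x n.+1).
  by apply: le_trans i3; rewrite le_eqVlt; apply/orP; left; apply/eqP; rewrite /coefX; field.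
have b20 : 0 <= b ^+ 2 by exact: sqr_ge0.
have tq0 : 0 <= rho * syPhi * (n.+1%:R * Num.sqrt n.+1%:R).
  by rewrite !mulr_ge0 ?sqrtr_ge0 // ltW.
(* Half of [coefY] contains 8 times [rho * syPhi * t * sqrt t]. Three shares of 2 are spent: on the
   displacements of the current and of the previous noise, and on the reserve for the next index. *)
have j4 : (n%:R * Lyx / 4 + n%:R * Lyy / 4 + n.+1%:R * Lyy
      + 6 * (rho * syPhi * (n.+1%:R * Num.sqrt n.+1%:R))) * b ^+ 2
    <= coefY n.+1%:R * DY (y n.+2) (y n.+1).
  apply: le_trans i4; rewrite [leRHS]mulrA ler_wpM2r // /coefY.
  have h1 := ler_wpM2r Lyx0 nt; have h2 := ler_wpM2r Lyy0 nt.
  have h3 : 0 <= n.+1%:R * Lyx by rewrite mulr_ge0.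
  have h4 : 0 <= n.+1%:R * Lyy by rewrite mulr_ge0.
  move: (n.+1%:R : R) (n%:R : R) h1 h2 h3 h4 tq0 => t k; move: (Num.sqrt t) => q; lra.
have hn : n%:R = n.+1%:R - 1 :> R by rewrite -natr1 addrK.
have e1 : (4 * (rho' * sx))^-1 = (rho' * sx)^-1 / 4 by rewrite invfM mulrC.
have e2 : (4 * (rho * syPhi))^-1 = (rho * syPhi)^-1 / 4 by rewrite invfM mulrC.
have e3 : (8 * (rho * syPhi))^-1 = (rho * syPhi)^-1 / 8 by rewrite invfM mulrC.
have e4 : (4 * (2 * (rho * syPhi)))^-1 = (rho * syPhi)^-1 / 8.
  by rewrite mulrA invfM mulrC; congr (_ / _); ring.
rewrite e1 in i5; rewrite e4 in i6 i7; rewrite e3 in IH.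
rewrite e1 e2 e3 -hn.
have e5 : 2 * n.+1%:R - 1 = n.+1%:R + n%:R :> R by rewrite hn; ring.
rewrite e5 in hs.
have k1 : 0 <= 2 * (rho * syPhi) * (n%:R * Num.sqrt n%:R) * bn ^+ 2.
  by rewrite mulr_ge0 ?sqr_ge0 // mulr_ge0 ?(ltW rs0) // mulr_ge0 ?sqrtr_ge0.
clear e5 i3 i4 uE lE lN vE i9 e1 e2 e3 e4 rsn0 rxn0 rs0 rx0 cX0 cY0 b20 tq0 Lyx0 Lyy0 nt' tt' hn.
rewrite /= -/(Gy n) -/(Gy n.+1) in hs IH i8 *.
move: k1 hs IH i1 i2 i5 i6 i7 i8 j3 j4.
move: (Gy n.+2 _) (Gy n.+1 _) (Gy n.+1 _) (Gy n _) (Gy n _) => G1 G2 G3 G4 G5.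
move: (noise_x n.+1 _) (noise_x n.+1 _) (noise_y n.+1 _) (noise_y n.+1 _) (noise_y n _) (noise_y n _) => N1 N2 N3 N4 N5 N6.
move: (\sum_(i < n) _) (saddle_diff n.+2) (saddle_diff n.+1) => S1 S2 S3.
move: (weight n.+1) (weight n) => w w'.
move: (coefX n.+1%:R) (coefX n%:R) (coefY n.+1%:R) (coefY n%:R) => cX cX' cY cY'.
move: (DX u (x n.+1)) (DX u (x n.+2)) (DX (x n.+2) _) => d1 d2 d3.
move: (DY v (y n.+1)) (DY v (y n.+2)) (DY (y n.+2) _) => d4 d5 d6.
move: (dual_norm (noise_x n.+1) ^+ 2) (dual_norm (noise_y n.+1) ^+ 2) => E1 E2.
move: (dual_norm (noise_y n) ^+ 2) => E3.
move: (an ^+ 2) (bn ^+ 2) (b ^+ 2) a2 => A B C A'.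
move: ((rho * syPhi)^-1) ((rho' * sx)^-1) (rho * syPhi) (rho' * sx) => r1 r2 r3 r4.
clear t0 n0 nt.
move: (Num.sqrt n.+1%:R) (Num.sqrt n%:R) => q p.
move: (n.+1%:R) (n%:R) => t k.
move=> *; lra.
Qed.

(* Extrapolating the gradients in [y] leaves, at the last step [m], one noise
   term that is not compensated by the next one; hence the extra weight. *)
Definition weight_y (m t : nat) : R := t%:R - 1 + (t == m)%:R * m%:R.

Lemma path_sum m : (1 <= m)%N ->
  weight m * saddle_diff m.+1 <= coefX m%:R * OX + coefY m%:R * OY
  + \sum_(i < m) (i.+1%:R * noise_x i.+1 (u - x i.+1)
    + Num.sqrt i.+1%:R / (4 * (rho' * sx)) * dual_norm (noise_x i.+1) ^+ 2
    - weight_y m i.+1 * noise_y i.+1 (v - y i.+1)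
    + Num.sqrt i.+1%:R / (4 * (rho * syPhi)) * dual_norm (noise_y i.+1) ^+ 2).
Proof.
move=> m1; have h := potential m.
have -> : \sum_(i < m) (i.+1%:R * noise_x i.+1 (u - x i.+1)
    + Num.sqrt i.+1%:R / (4 * (rho' * sx)) * dual_norm (noise_x i.+1) ^+ 2
    - weight_y m i.+1 * noise_y i.+1 (v - y i.+1)
    + Num.sqrt i.+1%:R / (4 * (rho * syPhi)) * dual_norm (noise_y i.+1) ^+ 2) =
    \sum_(i < m) potential_term i.+1 - m%:R * noise_y m (v - y m).
  case: m m1 {h} => // k _; rewrite !big_ord_recr /= -[in RHS]addrA; congr (_ + _).
    apply: eq_bigr => i _; rewrite /potential_term /weight_y.
    by rewrite eqSS (ltn_eqF (ltn_ord i)) mul0r addr0.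
  by rewrite /potential_term /weight_y eqxx mul1r; ring.
have t0 : 0 < m%:R :> R by rewrite ltr0n.
have rs0 : 0 < 2 * (rho * syPhi) by rewrite !mulr_gt0.
have mm : 0 <= (m%:R : R) <= m%:R by rewrite lexx (ltW t0).
have [i6 _] := noise_young (y m.+1 - y m) fdY (scalar_noise_y m) rs0 t0 mm.
have i8 := grady_cross m (v - y m.+1).
have i3 := DYge (isT : (1 <= m.+1)%N) Yv.
have i4 : 0 <= DX u (x m.+1).
  apply: (le_trans _ (rbregman_ge hX_dgf OmX_fin (tr_x1 tr).1 Xu (core_x (isT : (1 <= m.+1)%N)))).
  by rewrite mulr_ge0 ?sqr_ge0.
have cX0 : 0 <= coefX m%:R.
  apply: le_trans (coefX_mono (lexx 0) (ltW t0)).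
  by rewrite /coefX !(mul0r, mulr0, addr0) !mulr_ge0 // (sp_L_ge0 problem).
have i5 := mulr_ge0 cX0 i4.
have Lyx0 := sp_Lyx_ge0 problem; have Lyy0 := sp_Lyy_ge0 problem.
have c20 : 0 <= `|v - y m.+1| ^+ 2 by exact: sqr_ge0.
have i7 : (m%:R * Lyx / 4 + m%:R * Lyy / 4) * `|v - y m.+1| ^+ 2 <= coefY m%:R * DY v (y m.+1).
  have cY0 : 0 <= coefY m%:R.
    by apply: le_trans (coefY_mono (lexx 0) (ltW t0)); rewrite /coefY !(mul0r, mulr0).
  apply: le_trans (ler_wpM2l cY0 i3); rewrite [leRHS]mulrA ler_wpM2r // /coefY.
  have h3 : 0 <= m%:R * Lyx by rewrite mulr_ge0 // ltW.
  have h4 : 0 <= m%:R * Lyy by rewrite mulr_ge0 // ltW.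
  have h5 : 0 <= m%:R * (rho * syPhi * Num.sqrt m%:R).
    by rewrite !mulr_ge0 ?sqrtr_ge0 // ltW.
  move: h3 h4 h5; move: (Num.sqrt _) => q; lra.
have vE : noise_y m (v - y m) = noise_y m (v - y m.+1) + noise_y m (y m.+1 - y m).
  by rewrite -(scalarD (scalar_noise_y m)) subrKA.
have e3 : (8 * (rho * syPhi))^-1 = (rho * syPhi)^-1 / 8 by rewrite invfM mulrC.
have e4 : (4 * (2 * (rho * syPhi)))^-1 = (rho * syPhi)^-1 / 8.
  by rewrite mulrA invfM mulrC; congr (_ / _); ring.
rewrite e4 in i6; rewrite e3 in h; rewrite vE.
clear e3 e4 vE rs0 mm cX0 i3 i4 Lyx0 Lyy0 c20 m1.
move: h i5 i6 i7 i8.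
move: (Gy m.+1 _) (Gy m _) (noise_y m (v - _)) (noise_y m (y _ - _)) => G1 G2 N1 N2.
move: (\sum_(i < m) _) (saddle_diff m.+1) (weight m) => S1 S2 w.
move: (coefX m%:R) (coefY m%:R) (DX u _) (DY v _) (dual_norm (noise_y m) ^+ 2) => cX cY d1 d2 E1.
move: (`|x m.+1 - x m| ^+ 2) (`|y m.+1 - y m| ^+ 2) (`|v - y m.+1| ^+ 2) => A B C.
move: ((rho * syPhi)^-1) => r1.
clear t0.
move: (Num.sqrt m%:R) => q; move: (m%:R) => t *; lra.
Qed.

End Comparison.

(** The dual averaging parameters. Since the squared weights are at most [m * m.+1] in [x] and
    [4 * (m * m.+1)] in [y], they turn the quadratic regret into at most [sqrt (m + 1)] times
    [1 / (4 * rho' * sx)] and [1 / (8 * rho * syPhi)] per squared norm, and multiply the diameters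
    by the order of the noise parts of [coefX m] and [coefY m]. *)
Definition step_x (m : nat) : R := 2 * (rho' * sx) * (m%:R * Num.sqrt m.+1%:R).
Definition step_y (m : nat) : R := 16 * (rho * syPhi) * (m%:R * Num.sqrt m.+1%:R).

(* [xhat m i] and [yhat m i] only involve the noise of the steps before
   [i.+1]. *)
Definition xhat (m i : nat) : X := mirror XX hX (x 1) (step_x m)
  (fun v => \sum_(j < i) j.+1%:R * noise_x j.+1 v).
Definition yhat (m i : nat) : Y := mirror YY hY (y 1) (step_y m)
  (fun v => \sum_(j < i) - weight_y m j.+1 * noise_y j.+1 v).

Definition noise_total (m : nat) : R :=
  \sum_(i < m) (i.+1%:R * noise_x i.+1 (xhat m i - x i.+1)
    + weight_y m i.+1 * noise_y i.+1 (y i.+1 - yhat m i)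
    + Num.sqrt m.+1%:R / (2 * (rho' * sx)) * dual_norm (noise_x i.+1) ^+ 2
    + Num.sqrt m.+1%:R / (2 * (rho * syPhi)) * dual_norm (noise_y i.+1) ^+ 2).

Lemma weight_y_bound m t : (1 <= t <= m)%N ->
  0 <= weight_y m t /\ weight_y m t ^+ 2 <= 4 * (m%:R * m.+1%:R).
Proof.
move=> /andP[t1 tm]; have t1' : 1 <= t%:R :> R by rewrite ler1n.
have tm' : t%:R <= m%:R :> R by rewrite ler_nat.
have m0 : 0 <= m%:R :> R by [].
have h0 : 0 <= weight_y m t by rewrite addr_ge0 ?mulr_ge0 // subr_ge0.
split => //.
have h1 : weight_y m t <= 2 * m%:R.
  rewrite /weight_y; case: eqP => _; rewrite /= ?mul1r ?mul0r; lra.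
rewrite -natr1; nra.
Qed.

Lemma dual_normZ_le (E : normedModType R) (l : E -> R) (k : R) :
  finite_dim E -> scalar l ->
  dual_norm (fun v => k * l v) <= `|k| * dual_norm l.
Proof.
move=> fdE sl; apply: dual_norm_le => [|v].
  by rewrite mulr_ge0 ?dual_norm_ge0.
by rewrite normrM -mulrA ler_wpM2l // le_dual_norm.
Qed.

Lemma path_bound m u v : (1 <= m)%N ->
  XX u -> edom g u -> YY v -> edom J v ->
  weight m * saddle_diff u v m.+1 <=
    (coefX m%:R + step_x m) * OX + (coefY m%:R + step_y m) * OY + noise_total m.
Proof.
move=> m1 Xu gu Yv Jv; have h := path_sum Xu gu Yv Jv m1.
have m0 : 0 < m%:R :> R by rewrite ltr0n.
have sx0 : 0 < sx by exact: addr_gt0.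
have rx0 : 0 < rho' * sx by rewrite mulr_gt0.
have ry0 : 0 < rho * syPhi by rewrite mulr_gt0.
have q0 : 0 < Num.sqrt m.+1%:R :> R by rewrite sqrtr_gt0 ltr0n.
have ax0 : 0 < step_x m by rewrite !mulr_gt0.
have ay0 : 0 < step_y m by rewrite !mulr_gt0.
have hx := mirror_regret fdX (sp_X_closed problem) (sp_X_convex problem) hX_dgf OmX_fin
  (tr_x1 tr).1 m ax0 (fun i => scalar_scalef i.+1%:R (scalar_noise_x i.+1)) Xu.
have hy := mirror_regret fdY (sp_Y_closed problem) (sp_Y_convex problem) hY_dgf OmY_fin
  (tr_y1 tr).1 m ay0 (fun i => scalar_scalef (- weight_y m i.+1) (scalar_noise_y i.+1)) Yv.
have dx := rbregman_le hX_dgf OmX_fin (tr_x1 tr).1 Xu (tr_x1 tr).1.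
have dy := rbregman_le hY_dgf OmY_fin (tr_y1 tr).1 Yv (tr_y1 tr).1.
have dx' := ler_wpM2l (ltW ax0) dx; have dy' := ler_wpM2l (ltW ay0) dy.
rewrite -/OX in dx'; rewrite -/OY in dy'.
(* [lhs] is the part of the noise that is linear in [(u, v)] and [rhs] is its regret bound; once the
   first is exchanged for the second, the comparison is termwise. *)
pose lhs := \sum_(i < m) i.+1%:R * noise_x i.+1 u + \sum_(i < m) - weight_y m i.+1 * noise_y i.+1 v.
pose rhs := \sum_(i < m) (i.+1%:R * noise_x i.+1 (xhat m i) +
      dual_norm (fun v => i.+1%:R * noise_x i.+1 v) ^+ 2 / (2 * step_x m)) +
    \sum_(i < m) (- weight_y m i.+1 * noise_y i.+1 (yhat m i) +
      dual_norm (fun v => - weight_y m i.+1 * noise_y i.+1 v) ^+ 2 / (2 * step_y m)).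
have lr : lhs <= rhs + step_x m * OX + step_y m * OY by rewrite /lhs /rhs; lra.
set S := (X in _ <= _ + X) in h.
suff : S - lhs + rhs <= noise_total m by lra.
rewrite /S /lhs /rhs /noise_total -!big_split -sumrB -big_split /=.
apply: ler_sum => i _.
have ti : (1 <= i.+1 <= m)%N by rewrite ltn_ord.
have [w0 w2] := weight_y_bound ti.
have qi : Num.sqrt i.+1%:R <= Num.sqrt m.+1%:R :> R.
  by rewrite ler_wsqrtr // ler_nat ltnW // ltnS.
have snx := scalar_noise_x i.+1; have sny := scalar_noise_y i.+1.
rewrite !(scalarB snx) !(scalarB sny).
set Nx := dual_norm (noise_x i.+1); set Ny := dual_norm (noise_y i.+1).
have Nx0 : 0 <= Nx by exact: dual_norm_ge0.
have Ny0 : 0 <= Ny by exact: dual_norm_ge0.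
have sqm : Num.sqrt m.+1%:R ^+ 2 = m.+1%:R :> R by rewrite sqr_sqrtr.
have bx : dual_norm (fun v => i.+1%:R * noise_x i.+1 v) ^+ 2 / (2 * step_x m) <=
    Num.sqrt m.+1%:R * (rho' * sx)^-1 / 4 * Nx ^+ 2.
  rewrite ler_pdivrMr ?mulr_gt0 //.
  have -> : Num.sqrt m.+1%:R / (rho' * sx) / 4 * Nx ^+ 2 * (2 * step_x m) =
      (m%:R * m.+1%:R) * Nx ^+ 2.
    by rewrite -[X in _ = m%:R * X * _]sqm /step_x; move: (rho' * sx) (lt0r_neq0 rx0) => c cn; field.
  have b1 := dual_normZ_le i.+1%:R fdX snx; rewrite -/Nx ger0_norm // in b1.
  apply: (@le_trans _ _ ((i.+1%:R * Nx) ^+ 2)).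
    by rewrite ler_sqr // nnegrE ?mulr_ge0 // dual_norm_ge0 //; exact: scalar_scalef.
  rewrite exprMn ler_wpM2r ?sqr_ge0 // expr2 ler_pM // ler_nat ?ltn_ord //.
  by rewrite ltnW // ltnS.
have byy : dual_norm (fun v => - weight_y m i.+1 * noise_y i.+1 v) ^+ 2 / (2 * step_y m) <=
    Num.sqrt m.+1%:R * (rho * syPhi)^-1 / 8 * Ny ^+ 2.
  rewrite ler_pdivrMr ?mulr_gt0 //.
  have -> : Num.sqrt m.+1%:R / (rho * syPhi) / 8 * Ny ^+ 2 * (2 * step_y m) =
      4 * (m%:R * m.+1%:R) * Ny ^+ 2.
    by rewrite -[X in _ = _ * (m%:R * X) * _]sqm /step_y; move: (rho * syPhi) (lt0r_neq0 ry0) => c cn; field.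
  have b1 := dual_normZ_le (- weight_y m i.+1) fdY sny.
  rewrite -/Ny normrN ger0_norm // in b1.
  apply: (@le_trans _ _ ((weight_y m i.+1 * Ny) ^+ 2)).
    by rewrite ler_sqr // nnegrE ?mulr_ge0 // dual_norm_ge0 //; exact: scalar_scalef.
  by rewrite exprMn ler_wpM2r ?sqr_ge0.
have e1 : (4 * (rho' * sx))^-1 = (rho' * sx)^-1 / 4 by rewrite invfM mulrC.
have e2 : (4 * (rho * syPhi))^-1 = (rho * syPhi)^-1 / 4 by rewrite invfM mulrC.
have e3 : (2 * (rho' * sx))^-1 = (rho' * sx)^-1 / 2 by rewrite invfM mulrC.
have e4 : (2 * (rho * syPhi))^-1 = (rho * syPhi)^-1 / 2 by rewrite invfM mulrC.
rewrite e1 e2 e3 e4.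
have cx : Num.sqrt i.+1%:R * ((rho' * sx)^-1 / 4) * Nx ^+ 2 <=
    Num.sqrt m.+1%:R * ((rho' * sx)^-1 / 4) * Nx ^+ 2.
  by rewrite ler_wpM2r ?sqr_ge0 // ler_wpM2r // divr_ge0 // invr_ge0 ltW.
have cy : Num.sqrt i.+1%:R * ((rho * syPhi)^-1 / 4) * Ny ^+ 2 <=
    Num.sqrt m.+1%:R * ((rho * syPhi)^-1 / 4) * Ny ^+ 2.
  by rewrite ler_wpM2r ?sqr_ge0 // ler_wpM2r // divr_ge0 // invr_ge0 ltW.
have pos : 0 <= Num.sqrt m.+1%:R * (rho * syPhi)^-1 * Ny ^+ 2.
  by rewrite mulr_ge0 ?sqr_ge0 // divr_ge0 // ltW.
move: bx byy cx cy pos.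
set b1 := _ / (2 * step_x m); set b2 := _ / (2 * step_y m).
clear w2 qi sqm e1 e2 e3 e4 h hx hy dx dy dx' dy' lr m0 q0 ax0 ay0.
move: ((rho * syPhi)^-1) ((rho' * sx)^-1) (Nx ^+ 2) (Ny ^+ 2) b1 b2 => r1 r2 A B b1 b2.
move: (weight_y _ _) (noise_x _ _) (noise_x _ _) (noise_x _ _) => w n1 n2 n3.
move: (noise_y _ _) (noise_y _ _) (noise_y _ _) => n4 n5 n6.
move: (Num.sqrt _) (Num.sqrt _) => p q *; lra.
Qed.

End Trajectory.

(** * The duality gap and its measurability *)

Section Gap.
Context {R : realType} {X Y : normedModType R}.
Variables (XX : set X) (YY : set Y).
Variables (f g : X -> \bar R) (Phi : X -> Y -> R) (J : Y -> \bar R).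
Variables (mu L Lxx Lyx Lyy : R).
Hypothesis problem : saddle_problem XX YY f g Phi J mu L Lxx Lyx Lyy.
Variables (xb : X) (yb : Y).
Hypotheses (Xxb : XX xb) (gxb : edom g xb) (Yyb : YY yb) (Jyb : edom J yb).

Definition rgap (u : X) (v : Y) : R :=
  fine (f xb) + fine (g xb) + Phi xb v - fine (J v)
  - (fine (f u) + fine (g u) + Phi u yb - fine (J yb)).

Let gfin z : edom g z -> g z \is a fin_num.
Proof. exact: fin_num_edom (ccp_gtNy (sp_g_ccp problem)). Qed.

Let Jfin z : edom J z -> J z \is a fin_num.
Proof. exact: fin_num_edom (ccp_gtNy (sp_J_ccp problem)). Qed.

Lemma saddle_difference_fin u v : XX u -> edom g u -> YY v -> edom J v ->
  (saddle_fun f g Phi J xb v - saddle_fun f g Phi J u yb = (rgap u v)%:E)%E.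
Proof.
move=> Xu gu Yv Jv; rewrite /saddle_fun.
rewrite -(fineK (f_fin problem Xxb).1) -(fineK (gfin gxb)) -(fineK (Jfin Jv)).
by rewrite -(fineK (f_fin problem Xu).1) -(fineK (gfin gu)) -(fineK (Jfin Jyb)).
Qed.

(** An infinite [J v] makes the first saddle value [-oo], an infinite [g u] makes the second [+oo].
    No opposite infinity can arise, because [xb] and [yb] lie in the domains; such pairs do not
    affect the supremum. *)
Lemma saddle_difference_infty u v : XX u -> YY v -> ~ (edom g u /\ edom J v) ->
  (saddle_fun f g Phi J xb v - saddle_fun f g Phi J u yb = -oo)%E.
Proof.
move=> Xu Yv nd; rewrite /saddle_fun.
rewrite -(fineK (f_fin problem Xxb).1) -(fineK (gfin gxb)).
rewrite -(fineK (f_fin problem Xu).1) -(fineK (Jfin Jyb)).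
have Jv0 := ccp_gtNy (sp_J_ccp problem) v.
have gu0 := ccp_gtNy (sp_g_ccp problem) u.
have [Jv|nJv] := pselect (edom J v).
- have ngu : g u = +oo%E.
    by apply/eqP; rewrite -leye_eq leNgt; apply/negP => gu; apply: nd.
  by rewrite ngu -(fineK (Jfin Jv)) /= addeNy.
- have -> : J v = +oo%E.
    by apply/eqP; rewrite -leye_eq leNgt; apply/negP => Jv; apply: nJv.
  by rewrite /= addNye.
Qed.

Lemma gap_le (b : R) :
  (forall u v, XX u -> edom g u -> YY v -> edom J v -> rgap u v <= b) ->
  (gap XX YY f g Phi J xb yb <= b%:E)%E.
Proof.
move=> hb; apply: ge_ereal_sup => _ [[u v] [/= Xu Yv] <-].
have [[gu Jv]|nd] := pselect (edom g u /\ edom J v).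
  by rewrite saddle_difference_fin // lee_fin hb.
by rewrite saddle_difference_infty ?leNye.
Qed.

Lemma gap_ge0 : (0 <= gap XX YY f g Phi J xb yb)%E.
Proof.
apply: (@le_trans _ _ (rgap xb yb)%:E); first by rewrite lee_fin /rgap; lra.
by apply: ereal_sup_ubound; exists (xb, yb) => //=; rewrite saddle_difference_fin.
Qed.

Lemma gap_gtP (c : R) : (c%:E < gap XX YY f g Phi J xb yb)%E ->
  exists u v, [/\ XX u, edom g u, YY v, edom J v & c < rgap u v].
Proof.
move=> /ereal_sup_gt [_ [[u v] [/= Xu Yv] <-]] h.
have [[gu Jv]|nd] := pselect (edom g u /\ edom J v).
  by exists u, v; split => //; move: h; rewrite saddle_difference_fin // lte_fin.
by move: h; rewrite saddle_difference_infty ?ltNge ?leNye.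
Qed.

Lemma rgap_le_gap u v : XX u -> edom g u -> YY v -> edom J v ->
  ((rgap u v)%:E <= gap XX YY f g Phi J xb yb)%E.
Proof.
move=> Xu gu Yv Jv; apply: ereal_sup_ubound; exists (u, v) => //=.
by rewrite saddle_difference_fin.
Qed.

End Gap.

Section GapMeasurable.
Context {R : realType} {X Y : normedModType R}.
Hypotheses (fdX : finite_dim X) (fdY : finite_dim Y).
Variables (XX : set X) (YY : set Y).
Variables (f g : X -> \bar R) (Phi : X -> Y -> R) (J : Y -> \bar R).
Variables (mu L Lxx Lyx Lyy : R).
Hypothesis problem : saddle_problem XX YY f g Phi J mu L Lxx Lyx Lyy.
Context {d : measure_display} {T : measurableType d}.
Variables (xb : T -> X) (yb : T -> Y).
Hypotheses (mxb : vmeasurable xb) (myb : vmeasurable yb).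
Hypothesis Dxb : forall w, XX (xb w) /\ edom g (xb w).
Hypothesis Dyb : forall w, YY (yb w) /\ edom J (yb w).

Let lsc_near (E : normedModType R) (h : E -> \bar R) (z : E) (e : R) : ccp h ->
  edom h z -> 0 < e -> exists2 r : R, 0 < r & forall z', `|z' - z| < r ->
    edom h z' -> fine (h z) - e < fine (h z').
Proof.
move=> ch hz e0; have hNy := ccp_gtNy ch.
have hf := fin_num_edom hNy hz.
have [V Vz Vh] := ccp_closed ch (x := z) (a := fine (h z) - e) ltac:(
  by rewrite -{2}(fineK hf) lte_fin ltrBlDr ltrDl).
have /nbhs_ballP [r /= r0 hr] := Vz; exists r => // z' zz' hz'.
rewrite -lte_fin (fineK (fin_num_edom hNy hz')); apply: Vh; apply: hr.
by rewrite -ball_normE /= distrC.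
Qed.

Let cont_near (E : normedModType R) (h : E -> R) (z : E) (e : R) :
  {for z, continuous h} -> 0 < e -> exists2 r : R, 0 < r & forall z',
    `|z' - z| < r -> h z - e < h z'.
Proof.
move=> ch e0; have /nbhs_ballP [r /= r0 hr] : \forall z' \near z, h z - e < h z'.
  have /cvgrPdist_lt /(_ _ e0) := ch; apply: filterS => z'.
  by rewrite ltr_norml => /andP[_]; lra.
by exists r => // z' zz'; apply: hr; rewrite -ball_normE /= distrC.
Qed.

(** The supremum is uncountable, but the gap is lower semicontinuous along the averages: a pair that
    exceeds [c] strictly still does so nearby, by lower semicontinuity of [f], [g], [J] and
    continuity of [Phi]. Superlevel sets are thus open for the control of [(xb, yb)]. *)
Lemma measurable_gap :
  measurable_fun setT (fun w => gap XX YY f g Phi J (xb w) (yb w)).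
Proof.
apply: (measurability _ (ErealGenOInfty.measurableE R)) => //.
move=> _ [_ [c ->] <-]; rewrite setTI.
apply: (controlled_open (controlledD (controlled_vector fdX mxb)
  (controlled_vector fdY myb))) => w /=; rewrite in_itv /= andbT => cw.
have [Xw gw] := Dxb w; have [Yw Jw] := Dyb w.
have [u [v [Xu gu Yv Jv crg]]] := gap_gtP problem Xw gw Jw cw.
set r := rgap _ _ _ _ _ _ _ _ in crg.
(* The margin is shared by the five terms of [rgap] that vary with [w]: [f], [g] and [Phi] at [xb],
   [Phi] and [J] at [yb]. *)
have e0 : 0 < (r - c) / 5 by rewrite divr_gt0 // subr_gt0.
have ffd := f_fin problem Xw.
have efw : edom f (xb w) by move: ffd.1; rewrite fin_numElt => /andP[].
have cP1 : {for xb w, continuous (Phi ^~ v)}.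
  exact: differentiable_continuous (Phi_differentiable_x problem Xw Yv).
have cP2 : {for yb w, continuous (fun z => - Phi u z)}.
  apply: continuousN; exact: differentiable_continuous (Phi_differentiable_y problem Xu Yw).
have [r1 r10 h1] := lsc_near (sp_f_ccp problem) efw e0.
have [r2 r20 h2] := lsc_near (sp_g_ccp problem) gw e0.
have [r3 r30 h3] := lsc_near (sp_J_ccp problem) Jw e0.
have [r4 r40 h4] := cont_near cP1 e0.
have [r5 r50 h5] := cont_near cP2 e0.
exists (Num.min r1 (Num.min r2 (Num.min r3 (Num.min r4 r5)))).
  by rewrite !lt_min r10 r20 r30 r40 r50.
move=> w'; rewrite !lt_min => /and5P[k1 k2 k3 k4 k5]; rewrite in_itv /= andbT.
have [Xw' gw'] := Dxb w'; have [Yw' Jw'] := Dyb w'.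
apply: lt_le_trans (rgap_le_gap problem Xw' gw' Jw' Xu gu Yv Jv).
have nx := normr_ge0 (xb w' - xb w); have ny := normr_ge0 (yb w' - yb w).
have ffd' := f_fin problem Xw'.
have efw' : edom f (xb w') by move: ffd'.1; rewrite fin_numElt => /andP[].
have l1 := h1 _ (le_lt_trans (_ : `|xb w' - xb w| <= _) k1) efw'.
have := l1 ltac:(by rewrite lerDl).
have := h2 _ (le_lt_trans (_ : `|xb w' - xb w| <= _) k2) gw'.
move=> /(_ ltac:(by rewrite lerDl)).
have := h3 _ (le_lt_trans (_ : `|yb w' - yb w| <= _) k3) Jw'.
move=> /(_ ltac:(by rewrite lerDr)).
have := h4 _ (le_lt_trans (_ : `|xb w' - xb w| <= _) k4).
move=> /(_ ltac:(by rewrite lerDl)).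
have := h5 _ (le_lt_trans (_ : `|yb w' - yb w| <= _) k5).
move=> /(_ ltac:(by rewrite lerDr)).
rewrite lte_fin /r /rgap; rewrite /r /rgap in crg *; lra.
Qed.

End GapMeasurable.

(** * The stochastic algorithm *)

Section Probability.
Context {R : realType} {d : measure_display} {Om : measurableType d}.
Variable P : probability Om R.

Lemma probability_ge_compl (B : set Om) (e : R) : measurable B ->
  (P (~` B) <= e%:E)%E -> ((1 - e)%:E <= P B)%E.
Proof.
move=> mB; rewrite probability_setC // => h.
have fP : P B \is a fin_num by exact: fin_num_measure.
move: h; rewrite -(fineK fP) -EFinB !lee_fin; lra.
Qed.

Lemma probability_setU_le (A B : set Om) (a b : R) : measurable A ->
  measurable B -> (P A <= a%:E)%E -> (P B <= b%:E)%E ->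
  (P (A `|` B) <= (a + b)%:E)%E.
Proof.
move=> mA mB hA hB; have mBA : measurable (B `\` A) by exact: measurableD.
have -> : A `|` B = A `|` (B `\` A).
  apply/seteqP; split => [w [Aw|Bw]|w [Aw|[Bw _]]]; [by left| |by left|by right].
  by have [Aw|nAw] := pselect (A w); [left|right].
rewrite measureU //; last by rewrite setDE setICA setICr setI0.
rewrite EFinD leeD //; apply: le_trans hB; apply: le_measure; rewrite ?inE //.
Qed.

Lemma measurable_gt (f : Om -> R) (c : R) : measurable_fun setT f ->
  measurable [set w | c < f w].
Proof.
move=> mf; rewrite (_ : [set w | _] = [set: Om] `&` f @^-1` `]c, +oo[%classic); first exact: mf.
by rewrite setTI; apply/seteqP; split => w; rewrite /= in_itv /= andbT.
Qed.

Section Noise.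
Context {E : normedModType R}.
Hypothesis fdE : finite_dim E.
Variable gens : set (set Om).
Hypothesis gens_meas : <<s gens >> `<=` measurable.
Local Notation GT := (g_sigma_algebraType gens).
Variables (delta : Om -> E -> R) (sigma : R).
Hypothesis sigma0 : 0 < sigma.
Hypothesis sdelta : forall w, scalar (delta w).
Hypothesis unb : cond_unbiased P <<s gens >> delta.

Let mdual : measurable_fun setT (fun w => dual_norm (delta w)).
Proof. by apply: dmeasurable_norm => //; exact: unbiased_dmeasurable unb. Qed.

Lemma variance_moments : cond_variance_le P <<s gens >> delta sigma ->
  [/\ L1 P (fun w => dual_norm (delta w)),
      L1 P (fun w => dual_norm (delta w) ^+ 2 / sigma ^+ 2) &
      Ex P (fun w => dual_norm (delta w) ^+ 2 / sigma ^+ 2) <= 1].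
Proof.
move=> hv; have [L2 Ex2] := cond_moment_le gens_meas (sqr_ge0 sigma)
  (measurable_funX 2 mdual) (fun w => sqr_ge0 _) hv.
have eqf : (fun w => dual_norm (delta w) ^+ 2 / sigma ^+ 2) =
    fun w => (sigma ^+ 2)^-1 * dual_norm (delta w) ^+ 2.
  by apply/funext => w; rewrite mulrC.
split.
- apply: (L1_le mdual _ (L1D (L1_cst P 1) L2)) => w.
  rewrite ger0_norm ?dual_norm_ge0 //; set a := dual_norm _.
  by have := sqr_ge0 (a - 1); have := sqr_ge0 a; lra.
- by rewrite eqf; exact: L1Z.
- by rewrite eqf ExZ // ler_pdivrMl ?exprn_gt0 // mulr1.
Qed.

Lemma centered_term (x : Om -> E) (B k : R) : vmeasurable (x : GT -> E) ->
  (forall w, `|x w| <= B) -> L1 P (fun w => dual_norm (delta w)) ->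
  L1 P (fun w => k * delta w (x w)) /\ Ex P (fun w => k * delta w (x w)) = 0.
Proof.
move=> mx xB L1d.
have mk : measurable_fun setT ((fun=> k) : GT -> R) by exact: measurable_cst.
exact: (Ex_unbiased_pairing gens_meas fdE sdelta mx unb mk xB (L1Z `|k| L1d)).
Qed.

End Noise.

End Probability.

Section Diameter.
Context {R : realType} {E : normedModType R}.
Variables (U : set E) (h : E -> \bar R) (u1 : E).
Hypotheses (hdgf : is_dgf U h) (Ofin : (bregman_diameter U h < +oo)%E).
Hypothesis core1 : dgf_core U h u1.

Lemma diameter_fin : exists D : R, [/\ 0 <= D, diameter U = D%:E &
  forall u v, U u -> U v -> `|u - v| <= D].
Proof.
set K := `|u1| + Num.sqrt (2 * fine (bregman_diameter U h)).
have hK u v : U u -> U v -> `|u - v| <= K + K.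
  move=> Uu Uv; apply: (le_trans (ler_normB _ _)).
  by rewrite lerD //; exact: (dgf_bounded hdgf Ofin core1).
have U1 := core1.1.
have ge0 : (0 <= diameter U)%E.
  apply: (@le_trans _ _ (`|u1 - u1|)%:E); first by rewrite subrr normr0.
  by apply: ereal_sup_ubound; exists (u1, u1).
have le : (diameter U <= (K + K)%:E)%E.
  by apply: ge_ereal_sup => _ [[u v] [/= Uu Uv] <-]; rewrite lee_fin hK.
have fD : diameter U \is a fin_num.
  by rewrite ge0_fin_numE // (le_lt_trans le) // ltry.
exists (fine (diameter U)); split; [by rewrite fine_ge0|by rewrite fineK|].
move=> u v Uu Uv; rewrite -lee_fin fineK //.
by apply: ereal_sup_ubound; exists (u, v).
Qed.

End Diameter.

Lemma weight_x_sumsq {R : realType} m :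
  \sum_(i < m) (i.+1%:R : R) ^+ 2 <= 2 * (m%:R ^+ 2 * m.+1%:R).
Proof.
apply: (@le_trans _ _ (\sum_(i < m) m%:R ^+ 2)).
  apply: ler_sum => i _; rewrite ler_sqr ?nnegrE // ler_nat; exact: ltn_ord.
rewrite sumr_const card_ord -[leLHS]mulr_natr [leRHS]mulrCA.
apply: ler_wpM2l; first exact: sqr_ge0.
by rewrite -[leLHS]mul1r ler_pM // ?ler1n // ler_nat.
Qed.

(** The last weight is [2 * m - 1], and the factor 2 makes room for its square. The bound is the
    same as for the [x] weights, so that one formula for the tail radius serves the three
    martingales. *)
Lemma weight_y_sumsq {R : realType} m : (0 < m)%N ->
  \sum_(i < m) (weight_y m i.+1 : R) ^+ 2 <= 2 * (m%:R ^+ 2 * m.+1%:R).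
Proof.
case: m => // n _; rewrite big_ord_recr /=.
have h1 : \sum_(i < n) (weight_y n.+1 i.+1 : R) ^+ 2 <= n%:R * n.+1%:R ^+ 2.
  apply: (@le_trans _ _ (\sum_(i < n) n.+1%:R ^+ 2)).
    apply: ler_sum => i _; have := ltn_ord i => im.
    rewrite /weight_y eqSS (ltn_eqF im) mul0r addr0 -natr1 addrK.
    by rewrite ler_sqr ?nnegrE // ler_nat leqW // ltnW.
  by rewrite sumr_const card_ord -[leLHS]mulr_natl.
have n0 : 0 <= n%:R :> R by [].
have h2 : (weight_y n.+1 n.+1 : R) ^+ 2 <= 4 * n.+1%:R ^+ 2.
  rewrite /weight_y eqxx mul1r (_ : 4 * n.+1%:R ^+ 2 = (2 * n.+1%:R) ^+ 2); last ring.
  rewrite -natr1 ler_sqr ?nnegrE; lra.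
apply: (le_trans (lerD h1 h2)).
rewrite -[n.+2%:R]natr1 -[n.+1%:R]natr1; have := sqr_ge0 (n%:R + 1 : R); nra.
Qed.

(** Each prox point is tested in the optimality condition of the other, and the sum meets the strong
    monotonicity of the gradient of [h] on the core. The form is that of [vmeasurable_argmax], the
    dual variable being [a] times the gradient at [y0], minus [l]. *)
Lemma prox_lipschitz {R : realType} {E : normedModType R} (U : set E)
    (h J : E -> \bar R) (u1 : E) (l l' : E -> R) (a : R) (y0 y0' z z' : E) :
  convex_set U -> ccp J -> is_dgf U h -> (bregman_diameter U h < +oo)%E ->
  dgf_core U h u1 -> 0 <= a -> scalar l -> scalar l' ->
  dgf_core U h z -> edom J z -> dgf_core U h z' -> edom J z' -> U y0 -> U y0' ->
  (forall v, U v -> (J z + (l (z - y0)%R)%:E + a%:E * bregman h z y0 <=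
     J v + (l (v - y0)%R)%:E + a%:E * bregman h v y0)%E) ->
  (forall v, U v -> (J z' + (l' (z' - y0')%R)%:E + a%:E * bregman h z' y0' <=
     J v + (l' (v - y0')%R)%:E + a%:E * bregman h v y0')%E) ->
  a * `|z' - z| ^+ 2 <=
    (a * egrad h y0' (z' - z) - l' (z' - z)) - (a * egrad h y0 (z' - z) - l (z' - z)).
Proof.
move=> cU cJ hdgf Ofin core1 a0 sl sl' cz Jz cz' Jz' Uy0 Uy0' opt opt'.
have hfin := dgf_fin hdgf Ofin core1.
have dz := dgf_differentiable hdgf cz.2; have dz' := dgf_differentiable hdgf cz'.2.
have p := prox_ineq cU cJ sl hfin cz.1 dz Jz cz'.1 Jz' Uy0 opt a0.
have p' := prox_ineq cU cJ sl' hfin cz'.1 dz' Jz' cz.1 Jz Uy0' opt' a0.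
have b := rbregman_ge hdgf Ofin core1 cz.1 cz'.
have b' := rbregman_ge hdgf Ofin core1 cz'.1 cz.
move: p p' b b'; rewrite /rbregman [`|z - z'|]distrC -[z - z']opprB.
have sg k := scalar_linear (egrad h k).
rewrite !(scalarN (sg _)) (scalarN sl) => p p' b b'.
have := ler_wpM2l a0 (lerD b b'); lra.
Qed.

Lemma egrad_dmeasurable {R : realType} {E : normedModType R} (U : set E)
    (h : E -> \bar R) d (T : measurableType d) (x : T -> E) :
  finite_dim E -> is_dgf U h -> vmeasurable x ->
  (forall w, dgf_core U h (x w)) ->
  dmeasurable (fun w => egrad h (x w) : E -> R).
Proof.
move=> fdE hdgf mx cx.
apply: (dmeasurable_controlled fdE (controlled_vector fdE mx)).
  by move=> w; exact: scalar_linear.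
move=> w e e0; have /cvgrPdist_lt /(_ _ e0) := dgf_C1 hdgf (cx w).2.
move=> /nbhs_ballP [r /= r0 hr]; exists r => // w' ww'.
have := hr (x w'); rewrite -ball_normE /= distrC => /(_ ww').
by rewrite sub0r normrN ger0_norm // dual_norm_ge0 //; apply: scalar_subf; exact: scalar_linear.
Qed.

(** * Measurability of the iterates and pathwise bounds *)

Section Iterates.
Context {R : realType} {X Y : normedModType R}.
Hypotheses (fdX : finite_dim X) (fdY : finite_dim Y).
Variables (XX : set X) (YY : set Y).
Variables (f g : X -> \bar R) (Phi : X -> Y -> R) (J : Y -> \bar R).
Variables (mu L Lxx Lyx Lyy : R).
Hypothesis problem : saddle_problem XX YY f g Phi J mu L Lxx Lyx Lyy.
Variables (hX : X -> \bar R) (hY : Y -> \bar R).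
Hypotheses (hX_dgf : is_dgf XX hX) (hY_dgf : is_dgf YY hY).
Hypothesis OmX_fin : (bregman_diameter XX hX < +oo)%E.
Hypothesis OmY_fin : (bregman_diameter YY hY < +oo)%E.
Context {d dx dy df : measure_display} {Om : measurableType d}.
Context {Zx : measurableType dx} {Zy : measurableType dy}.
Context {Zf : measurableType df}.
Variables (zx : nat -> Om -> Zx) (zy : nat -> Om -> Zy) (xi : nat -> Om -> Zf).
Hypothesis zx_meas : forall t, measurable_fun setT (zx t).
Hypothesis zy_meas : forall t, measurable_fun setT (zy t).
Hypothesis xi_meas : forall t, measurable_fun setT (xi t).
Variables (ox : X -> Y -> Zx -> {linear X -> R}).
Variables (oy : X -> Y -> Zy -> {linear Y -> R}).
Variables (of_ : X -> Zf -> {linear X -> R}).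
Hypothesis oracles_meas : measurable_oracles XX YY ox oy of_.
Variables (syPhi sxPhi sxf rho rho' : R).
Hypotheses (syPhi_gt0 : 0 < syPhi) (sxPhi_gt0 : 0 < sxPhi) (sxf_gt0 : 0 < sxf).
Hypotheses (rho_gt0 : 0 < rho) (rho'_gt0 : 0 < rho').
Variables (x1 : X) (y1 : Y).
Variables (x xb xt : nat -> Om -> X) (y yb : nat -> Om -> Y).
Variable s : nat -> Om -> Y -> R.
Hypothesis iterates : spd_iterates XX YY g J hX hY ox oy of_ zx zy xi
  beta_ (alpha_ Lyx Lyy syPhi rho) (tau_ L Lxx Lyx sxPhi sxf rho') theta_
  x1 y1 x xb xt y yb s.

Definition noise_generators (t : nat) : set (set Om) :=
  \bigcup_(i in [set i | (1 <= i <= t)%N])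
    (preimage_set_system setT (zx i) measurable `|`
     preimage_set_system setT (zy i) measurable `|`
     preimage_set_system setT (xi i) measurable).

Local Notation GT t := (g_sigma_algebraType (noise_generators t)).

Lemma noise_generators_measurable t : <<s noise_generators t >> `<=` measurable.
Proof.
apply: smallest_sub; first exact: sigma_algebra_measurable.
by move=> A [i _ [[|]|]] [B mB <-]; [exact: zx_meas|exact: zy_meas|exact: xi_meas].
Qed.

Lemma noise_generators_mono t t' : (t <= t')%N ->
  <<s noise_generators t >> `<=` <<s noise_generators t' >>.
Proof.
move=> tt'; apply: sub_sigma_algebra2 => A [i /andP[i1 it] h].
by exists i => //=; rewrite i1 (leq_trans it).
Qed.

Lemma noise_fun_mono d' (T : measurableType d') t t' (h : Om -> T) :
  (t <= t')%N -> measurable_fun setT (h : GT t -> T) ->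
  measurable_fun setT (h : GT t' -> T).
Proof.
move=> tt' mh _ B mB; have := mh measurableT B mB.
exact: noise_generators_mono.
Qed.

Lemma noise_dmeasurable_mono (E : normedModType R) t t' (p : Om -> E -> R) :
  (t <= t')%N -> dmeasurable (p : GT t -> E -> R) ->
  dmeasurable (p : GT t' -> E -> R).
Proof.
by move=> tt' [sp mp]; split => // v; apply: (noise_fun_mono tt'); exact: mp.
Qed.

Lemma zx_noise t : (1 <= t)%N -> measurable_fun setT (zx t : GT t -> Zx).
Proof.
move=> t1 _ B mB; apply: sub_sigma_algebra; exists t; first by rewrite /= t1 leqnn.
by left; left; exists B.
Qed.

Lemma zy_noise t : (1 <= t)%N -> measurable_fun setT (zy t : GT t -> Zy).
Proof.
move=> t1 _ B mB; apply: sub_sigma_algebra; exists t; first by rewrite /= t1 leqnn.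
by left; right; exists B.
Qed.

Lemma xi_noise t : (1 <= t)%N -> measurable_fun setT (xi t : GT t -> Zf).
Proof.
move=> t1 _ B mB; apply: sub_sigma_algebra; exists t; first by rewrite /= t1 leqnn.
by right; exists B.
Qed.

Lemma closed_borel (E : normedModType R) (A : set E) : closed A ->
  measurable (A : set (borel E)).
Proof.
move=> cA; rewrite -(setCK A); apply: measurableC.
by apply: sub_sigma_algebra; exact: closed_openC.
Qed.

Definition path_gx w t : X -> R := ox (x t w) (y t.+1 w) (zx t w).
Definition path_gf w t : X -> R := of_ (xt t.+1 w) (xi t w).
Definition path_gy w t : Y -> R := oy (x t w) (y t w) (zy t w).

Lemma path_trajectory w :
  trajectory XX YY g J L Lxx Lyx Lyy hX hY syPhi sxPhi sxf rho rho'
    (x ^~ w) (xb ^~ w) (xt ^~ w) (y ^~ w) (yb ^~ w) (fun t => s t w)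
    (path_gx w) (path_gf w) (path_gy w).
Proof.
split => /=.
- have [-> ->] := spd_x1 iterates w; split => //; exact: spd_x1_core iterates.
- have [-> ->] := spd_y1 iterates w; split => //; exact: spd_y1_core iterates.
- exact: spd_s1 iterates w.
- by move=> t v t1; rewrite (spd_s iterates).
- by move=> t t1; have [_ []] := spd_y iterates w t1.
- move=> t u t1 Yu; have [h _] := spd_y iterates w t1.
  have : argmin YY (y_objective J hY (alpha_ Lyx Lyy syPhi rho) y s t w) (y t.+1 w).
    by rewrite h.
  by move=> [_ /(_ _ Yu)].
- by move=> t t1; rewrite (spd_xt iterates).
- by move=> t t1; have [_ []] := spd_x iterates w t1.
- move=> t u t1 Xu; have [h _] := spd_x iterates w t1.
  have : argmin XX (x_objective g hX ox of_ zx xi (tau_ L Lxx Lyx sxPhi sxf rho') x xt y t w) (x t.+1 w).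
    by rewrite h.
  by move=> [_ /(_ _ Xu)].
- by move=> t t1; rewrite (spd_xb iterates).
- by move=> t t1; rewrite (spd_yb iterates).
Qed.

Let tr := path_trajectory.

Lemma alpha_inv_gt0 t : (1 <= t)%N -> 0 < (alpha_ Lyx Lyy syPhi rho t)^-1.
Proof.
move=> t1; rewrite /alpha_ div1r invrK.
have q0 : 0 < Num.sqrt t%:R :> R by rewrite sqrtr_gt0 ltr0n.
have := mulr_gt0 (mulr_gt0 rho_gt0 syPhi_gt0) q0.
by have := sp_Lyx_ge0 problem; have := sp_Lyy_ge0 problem; lra.
Qed.

Lemma tau_inv_gt0 t : (1 <= t)%N -> 0 < (tau_ L Lxx Lyx sxPhi sxf rho' t)^-1.
Proof.
move=> t1; have t0 : 0 < t%:R :> R by rewrite ltr0n.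
rewrite /tau_ invf_div powR_3half // divr_gt0 //.
have q0 : 0 < Num.sqrt t%:R :> R by rewrite sqrtr_gt0.
have h1 : 0 < rho' * (sxPhi + sxf) * (t%:R * Num.sqrt t%:R).
  by rewrite !mulr_gt0 // addr_gt0.
have h2 : 0 <= (Lxx + Lyx) * t%:R.
  by rewrite mulr_ge0 // addr_ge0 ?(sp_Lxx_ge0 problem) ?(sp_Lyx_ge0 problem).
by have := sp_L_ge0 problem; lra.
Qed.

Lemma path_gy_dmeasurable t : (1 <= t)%N ->
  vmeasurable (x t : GT t -> X) -> vmeasurable (y t : GT t -> Y) ->
  dmeasurable ((fun w => path_gy w t) : GT t -> Y -> R).
Proof.
move=> t1 mx my; split => [w|v]; first exact: scalar_linear.
have mD : measurable ((XX `*` YY) `*` setT : set (borel X * borel Y * Zy)).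
  apply: measurableX => //; apply: measurableX; apply: closed_borel.
    exact: sp_X_closed problem.
  exact: sp_Y_closed problem.
apply: (measurable_comp mD _ (mo_y oracles_meas v)
  (g := fun w : GT t => ((x t w : borel X), (y t w : borel Y), zy t w))).
  move=> _ [w _ <-] /=; split => //=; split => /=.
    exact: (in_x (tr w) t1).
  exact: (in_y (tr w) t1).
apply: measurable_fun_pair; last exact: zy_noise.
exact: measurable_fun_pair.
Qed.

Lemma path_gx_dmeasurable t : (1 <= t)%N ->
  vmeasurable (x t : GT t -> X) -> vmeasurable (y t.+1 : GT t -> Y) ->
  dmeasurable ((fun w => path_gx w t) : GT t -> X -> R).
Proof.
move=> t1 mx my; split => [w|v]; first exact: scalar_linear.
have mD : measurable ((XX `*` YY) `*` setT : set (borel X * borel Y * Zx)).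
  apply: measurableX => //; apply: measurableX; apply: closed_borel.
    exact: sp_X_closed problem.
  exact: sp_Y_closed problem.
apply: (measurable_comp mD _ (mo_x oracles_meas v)
  (g := fun w : GT t => ((x t w : borel X), (y t.+1 w : borel Y), zx t w))).
  move=> _ [w _ <-] /=; split => //=; split => /=.
    exact: (in_x (tr w) t1).
  exact: (in_y (tr w) (leqW t1)).
apply: measurable_fun_pair; last exact: zx_noise.
exact: measurable_fun_pair.
Qed.

Lemma path_gf_dmeasurable t : (1 <= t)%N -> vmeasurable (xt t.+1 : GT t -> X) ->
  dmeasurable ((fun w => path_gf w t) : GT t -> X -> R).
Proof.
move=> t1 mx; split => [w|v]; first exact: scalar_linear.
have mD : measurable (XX `*` setT : set (borel X * Zf)).
  by apply: measurableX => //; apply: closed_borel; exact: sp_X_closed problem.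
apply: (measurable_comp mD _ (mo_f oracles_meas v)
  (g := fun w : GT t => ((xt t.+1 w : borel X), xi t w))).
  move=> _ [w _ <-] /=; split => //=.
  exact: (in_xt problem (tr w) t1).
by apply: measurable_fun_pair => //; exact: xi_noise.
Qed.

Lemma y_step_measurable t : (1 <= t)%N -> vmeasurable (y t : GT t -> Y) ->
  dmeasurable (s t : GT t -> Y -> R) -> vmeasurable (y t.+1 : GT t -> Y).
Proof.
move=> t1 my ms; have a0 := alpha_inv_gt0 t1.
have me := egrad_dmeasurable fdY hY_dgf my (fun w => core_y (tr w) t1).
have mp := dmeasurableD (dmeasurableZ (alpha_ Lyx Lyy syPhi rho t)^-1 me) ms.
apply: (vmeasurable_argmax fdY a0 mp) => w w' /=.
have sns w0 : scalar (fun z => - s t w0 z).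
  by move=> a z z'; rewrite (ms.1 w0); ring.
have := prox_lipschitz (sp_Y_convex problem) (sp_J_ccp problem) hY_dgf OmY_fin
  (tr_y1 (tr w)).1 (ltW a0) (sns w) (sns w')
  (tr_y (tr w) t1).1 (tr_y (tr w) t1).2 (tr_y (tr w') t1).1 (tr_y (tr w') t1).2
  (in_y (tr w) t1) (in_y (tr w') t1) (fun z => tr_yopt (tr w) t1)
  (fun z => tr_yopt (tr w') t1).
by rewrite !opprK.
Qed.

Lemma x_step_measurable t : (1 <= t)%N -> vmeasurable (x t : GT t -> X) ->
  dmeasurable ((fun w => path_gx w t) : GT t -> X -> R) ->
  dmeasurable ((fun w => path_gf w t) : GT t -> X -> R) ->
  vmeasurable (x t.+1 : GT t -> X).
Proof.
move=> t1 mx mgx mgf; have a0 := tau_inv_gt0 t1.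
have me := egrad_dmeasurable fdX hX_dgf mx (fun w => core_x (tr w) t1).
have mp := dmeasurableB (dmeasurableZ (tau_ L Lxx Lyx sxPhi sxf rho' t)^-1 me)
  (dmeasurableD mgx mgf).
apply: (vmeasurable_argmax fdX a0 mp) => w w' /=.
exact: (prox_lipschitz (sp_X_convex problem) (sp_g_ccp problem) hX_dgf OmX_fin
  (tr_x1 (tr w)).1 (ltW a0) (scalar_addf (mgx.1 w) (mgf.1 w))
  (scalar_addf (mgx.1 w') (mgf.1 w'))
  (tr_x (tr w) t1).1 (tr_x (tr w) t1).2 (tr_x (tr w') t1).1 (tr_x (tr w') t1).2
  (in_x (tr w) t1) (in_x (tr w') t1) (fun z => tr_xopt (tr w) t1)
  (fun z => tr_xopt (tr w') t1)).
Qed.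

(** The indices are delicate: the iterates of index [t.+1] are determined by the samples up to [t],
    whereas [s t.+1] already contains the sample [zy t.+1]. *)
Lemma iterates_measurable t :
  [/\ vmeasurable (x t.+1 : GT t -> X), vmeasurable (y t.+1 : GT t -> Y),
      vmeasurable (xb t.+1 : GT t -> X), vmeasurable (yb t.+1 : GT t -> Y) &
      dmeasurable (s t.+1 : GT t.+1 -> Y -> R)].
Proof.
elim: t => [|t [mx my mxb myb ms]].
  have ex : x 1 = fun=> x1 by apply/funext => w; case: (spd_x1 iterates w).
  have exb : xb 1 = fun=> x1 by apply/funext => w; case: (spd_x1 iterates w).
  have ey : y 1 = fun=> y1 by apply/funext => w; case: (spd_y1 iterates w).
  have eyb : yb 1 = fun=> y1 by apply/funext => w; case: (spd_y1 iterates w).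
  rewrite exb eyb; split; rewrite ?ex ?ey; try exact: vmeasurable_cst.
  have -> : s 1 = fun w => path_gy w 1.
    by apply/funext => w; apply/funext => v; exact: spd_s1 iterates w v.
  by apply: path_gy_dmeasurable => //; rewrite ?ex ?ey; exact: vmeasurable_cst.
have tt : (t <= t.+1)%N by exact: leqnSn.
have mx' := noise_fun_mono tt mx; have my' := noise_fun_mono tt my.
have mxb' := noise_fun_mono tt mxb; have myb' := noise_fun_mono tt myb.
have t1 : (1 <= t.+1)%N by [].
have myn := y_step_measurable t1 my' ms.
have mxt : vmeasurable (xt t.+2 : GT t.+1 -> X).
  rewrite (_ : xt t.+2 = fun w => (1 - beta_ t.+1) *: xb t.+1 w + beta_ t.+1 *: x t.+1 w).
    exact: (vmeasurable_lincomb fdX).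
  by apply/funext => w; rewrite (spd_xt iterates).
have mxn := x_step_measurable t1 mx' (path_gx_dmeasurable t1 mx' myn)
  (path_gf_dmeasurable t1 mxt).
split => //.
- rewrite (_ : xb t.+2 = fun w => (1 - beta_ t.+1) *: xb t.+1 w + beta_ t.+1 *: x t.+2 w).
    exact: (vmeasurable_lincomb fdX).
  by apply/funext => w; rewrite (spd_xb iterates).
- rewrite (_ : yb t.+2 = fun w => (1 - beta_ t.+1) *: yb t.+1 w + beta_ t.+1 *: y t.+2 w).
    exact: (vmeasurable_lincomb fdY).
  by apply/funext => w; rewrite (spd_yb iterates).
- have tt2 : (t.+1 <= t.+2)%N by exact: leqnSn.
  have g1 := noise_dmeasurable_mono tt2 (path_gy_dmeasurable t1 mx' my').
  have g2 := path_gy_dmeasurable (isT : (1 <= t.+2)%N)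
    (noise_fun_mono tt2 mxn) (noise_fun_mono tt2 myn).
  rewrite (_ : s t.+2 = fun w => (fun v => (1 + theta_ t.+2) * path_gy w t.+2 v)
      \- (fun v => theta_ t.+2 * path_gy w t.+1 v)).
    by apply: dmeasurableB; exact: dmeasurableZ.
  by apply/funext => w; apply/funext => v; rewrite (spd_s iterates).
Qed.

Lemma xt_measurable t : vmeasurable (xt t.+2 : GT t.+1 -> X).
Proof.
have [mx _ mxb _ _] := iterates_measurable t.
have tt : (t <= t.+1)%N by exact: leqnSn.
rewrite (_ : xt t.+2 = fun w => (1 - beta_ t.+1) *: xb t.+1 w + beta_ t.+1 *: x t.+1 w).
  by apply: (vmeasurable_lincomb fdX); exact: (noise_fun_mono tt).
by apply/funext => w; rewrite (spd_xt iterates).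
Qed.

Local Notation dyP := (delta_yPhi Phi oy zy x y).
Local Notation dxP := (delta_xPhi Phi ox zx x y).
Local Notation dxf := (delta_xf f of_ xi xt).

Lemma dyP_dmeasurable t : dmeasurable (dyP t.+1 : GT t.+1 -> Y -> R).
Proof.
have [mx my _ _ _] := iterates_measurable t.
have tt : (t <= t.+1)%N by exact: leqnSn.
have mx' := noise_fun_mono tt mx; have my' := noise_fun_mono tt my.
apply: (@dmeasurableB _ _ (GT t.+1) _ (fun w => path_gy w t.+1)
  (fun w => grady_Phi Phi (x t.+1 w) (y t.+1 w))).
  exact: path_gy_dmeasurable.
have ck := controlledD (controlled_vector fdX mx') (controlled_vector fdY my').
apply: (dmeasurable_controlled fdY ck) => [w|w e e0]; first exact: scalar_linear.
have c0 : 0 < Lyx + Lyy + 1.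
  by rewrite ltr_wpDl // addr_ge0 ?(sp_Lyx_ge0 problem) ?(sp_Lyy_ge0 problem).
exists (e / (Lyx + Lyy + 1)) => [|w' h]; first by rewrite divr_gt0.
have t1 : (1 <= t.+1)%N by [].
apply: (le_lt_trans (grady_lipschitz fdY problem (in_x (tr w) t1) (in_x (tr w') t1)
  (in_y (tr w) t1) (in_y (tr w') t1))).
move: h; rewrite ltr_pdivlMr // => h; apply: le_lt_trans h.
have := sp_Lyx_ge0 problem; have := sp_Lyy_ge0 problem.
have := normr_ge0 (x t.+1 w' - x t.+1 w); have := normr_ge0 (y t.+1 w' - y t.+1 w).
nra.
Qed.

(** The gradient is evaluated at [y t.+2], which uses the [y] sample of step [t.+1]; it is therefore
    the filtration at [t.+1] that sees this form. *)
Lemma dxP_dmeasurable t : dmeasurable (dxP t.+1 : GT t.+1 -> X -> R).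
Proof.
have [mx my _ _ _] := iterates_measurable t; have [_ myn _ _ _] := iterates_measurable t.+1.
have tt : (t <= t.+1)%N by exact: leqnSn.
have mx' := noise_fun_mono tt mx.
apply: (@dmeasurableB _ _ (GT t.+1) _ (fun w => path_gx w t.+1)
  (fun w => gradx_Phi Phi (x t.+1 w) (y t.+2 w))).
  exact: path_gx_dmeasurable.
have ck := controlledD (controlled_vector fdX mx') (controlled_vector fdY myn).
apply: (dmeasurable_controlled fdX ck) => [w|w e e0]; first exact: scalar_linear.
have c0 : 0 < Lxx + Lyx + 1.
  by rewrite ltr_wpDl // addr_ge0 ?(sp_Lyx_ge0 problem) ?(sp_Lxx_ge0 problem).
exists (e / (Lxx + Lyx + 1)) => [|w' h]; first by rewrite divr_gt0.
have t1 : (1 <= t.+1)%N by [].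
have t2 : (1 <= t.+2)%N by [].
apply: (le_lt_trans (gradx_lipschitz fdX problem (in_x (tr w) t1) (in_x (tr w') t1)
  (in_y (tr w) t2) (in_y (tr w') t2))).
move: h; rewrite ltr_pdivlMr // => h; apply: le_lt_trans h.
have := sp_Lyx_ge0 problem; have := sp_Lxx_ge0 problem.
have := normr_ge0 (x t.+1 w' - x t.+1 w); have := normr_ge0 (y t.+2 w' - y t.+2 w).
nra.
Qed.

Lemma dxf_dmeasurable t : dmeasurable (dxf t.+1 : GT t.+1 -> X -> R).
Proof.
have mxt := @xt_measurable t.
apply: (@dmeasurableB _ _ (GT t.+1) _ (fun w => path_gf w t.+1)
  (fun w => egrad f (xt t.+2 w))).
  exact: path_gf_dmeasurable.
have ck := controlled_vector fdX mxt.
apply: (dmeasurable_controlled fdX ck) => [w|w e e0]; first exact: scalar_linear.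
have c0 : 0 < L + 1 by rewrite ltr_wpDl // (sp_L_ge0 problem).
exists (e / (L + 1)) => [|w' h]; first by rewrite divr_gt0.
have t1 : (1 <= t.+1)%N by [].
apply: (le_lt_trans (sp_f_lipschitz problem (in_xt problem (tr w') t1) (in_xt problem (tr w) t1))).
move: h; rewrite ltr_pdivlMr // => h; apply: le_lt_trans h.
by rewrite mulrC ler_wpM2l // lerDl.
Qed.

Variable m : nat.
Hypothesis m1 : (1 <= m)%N.

Definition xhat_path i w : X := xhat XX f Phi hX sxPhi sxf rho'
  (x ^~ w) (xt ^~ w) (y ^~ w) (path_gx w) (path_gf w) m i.
Definition yhat_path i w : Y := yhat YY Phi hY syPhi rho
  (x ^~ w) (y ^~ w) (path_gy w) m i.

Let sx0 : 0 < sxPhi + sxf. Proof. exact: addr_gt0. Qed.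
Let m0 : 0 < m%:R :> R. Proof. by rewrite ltr0n. Qed.
Let q0 : 0 < Num.sqrt m.+1%:R :> R. Proof. by rewrite sqrtr_gt0 ltr0n. Qed.

Let step_x_gt0 : 0 < step_x sxPhi sxf rho' m.
Proof. by rewrite !mulr_gt0. Qed.

Let step_y_gt0 : 0 < step_y syPhi rho m.
Proof. by rewrite !mulr_gt0. Qed.

Lemma xhat_measurable i : vmeasurable (xhat_path i : GT i -> X).
Proof.
have mp : dmeasurable ((fun w v => \sum_(j < i) j.+1%:R * (dxP j.+1 w v + dxf j.+1 w v))
    : GT i -> X -> R).
  apply: (@dmeasurable_sum _ _ (GT i) _ i
    (fun j w v => j.+1%:R * (dxP j.+1 w v + dxf j.+1 w v))) => j ji.
  apply: (@dmeasurableZ _ _ (GT i) _ _ (fun w => dxP j.+1 w \+ dxf j.+1 w)).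
  apply: dmeasurableD; apply: (noise_dmeasurable_mono ji).
    exact: dxP_dmeasurable.
  exact: dxf_dmeasurable.
apply: (vmeasurable_argmax fdX step_x_gt0 mp) => w w'.
rewrite /xhat_path /xhat.
have e0 : x 1 w = x1 by case: (spd_x1 iterates w).
have e0' : x 1 w' = x1 by case: (spd_x1 iterates w').
rewrite e0 e0'; apply: (mirror_lipschitz fdX (sp_X_closed problem)
  (sp_X_convex problem) hX_dgf OmX_fin (spd_x1_core iterates) _ _ (ltW step_x_gt0)).
  exact: mp.1.
exact: mp.1.
Qed.

Lemma yhat_measurable i : vmeasurable (yhat_path i : GT i -> Y).
Proof.
have mp : dmeasurable ((fun w v => \sum_(j < i) - weight_y m j.+1 * dyP j.+1 w v)
    : GT i -> Y -> R).
  apply: (@dmeasurable_sum _ _ (GT i) _ i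
    (fun j w v => - weight_y m j.+1 * dyP j.+1 w v)) => j ji.
  apply: (@dmeasurableZ _ _ (GT i) _ _ (dyP j.+1)).
  by apply: (noise_dmeasurable_mono ji); exact: dyP_dmeasurable.
apply: (vmeasurable_argmax fdY step_y_gt0 mp) => w w'.
rewrite /yhat_path /yhat.
have e0 : y 1 w = y1 by case: (spd_y1 iterates w).
have e0' : y 1 w' = y1 by case: (spd_y1 iterates w').
rewrite e0 e0'; apply: (mirror_lipschitz fdY (sp_Y_closed problem)
  (sp_Y_convex problem) hY_dgf OmY_fin (spd_y1_core iterates) _ _ (ltW step_y_gt0)).
  exact: mp.1.
exact: mp.1.
Qed.

Lemma xhat_in i w : XX (xhat_path i w).
Proof.
have h := mirrorP fdX (sp_X_closed problem) (sp_X_convex problem) hX_dgf OmX_fin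
  (tr_x1 (tr w)).1 _ (ltW step_x_gt0).
apply: (h _ _).1.
move=> a u v; rewrite mulr_sumr -big_split; apply: eq_bigr => j _ /=.
by rewrite (scalar_noise_x f Phi (x ^~ w) (xt ^~ w) (y ^~ w) (fun t => scalar_linear _)
  (fun t => scalar_linear _)); ring.
Qed.

Lemma yhat_in i w : YY (yhat_path i w).
Proof.
have h := mirrorP fdY (sp_Y_closed problem) (sp_Y_convex problem) hY_dgf OmY_fin
  (tr_y1 (tr w)).1 _ (ltW step_y_gt0).
apply: (h _ _).1.
move=> a u v; rewrite mulr_sumr -big_split; apply: eq_bigr => j _ /=.
by rewrite (scalar_noise_y Phi (x ^~ w) (y ^~ w) (fun t => scalar_linear _)); ring.
Qed.

Definition mart_xP w := \sum_(i < m) i.+1%:R * dxP i.+1 w (xhat_path i w - x i.+1 w).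
Definition mart_xf w := \sum_(i < m) i.+1%:R * dxf i.+1 w (xhat_path i w - x i.+1 w).
Definition mart_y w := \sum_(i < m) weight_y m i.+1 * dyP i.+1 w (y i.+1 w - yhat_path i w).
Definition sqr_xP i w := dual_norm (dxP i.+1 w) ^+ 2 / sxPhi ^+ 2.
Definition sqr_xf i w := dual_norm (dxf i.+1 w) ^+ 2 / sxf ^+ 2.
Definition sqr_y i w := dual_norm (dyP i.+1 w) ^+ 2 / syPhi ^+ 2.

Definition noise_bound w :=
  mart_xP w + mart_xf w + mart_y w
  + Num.sqrt m.+1%:R / (2 * rho') *
      (sxPhi * \sum_(i < m) sqr_xP i w + sxf * \sum_(i < m) sqr_xf i w)
  + Num.sqrt m.+1%:R / (2 * rho) * (syPhi * \sum_(i < m) sqr_y i w).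

Lemma noise_total_le w :
  noise_total XX YY f Phi hX hY syPhi sxPhi sxf rho rho' (x ^~ w) (xt ^~ w) (y ^~ w)
    (path_gx w) (path_gf w) (path_gy w) m <= noise_bound w.
Proof.
rewrite /noise_bound /mart_xP /mart_xf /mart_y !mulr_sumr -!big_split !mulr_sumr -!big_split /=.
apply: ler_sum => i _.
have sP : scalar (dxP i.+1 w) by exact: (dxP_dmeasurable i).1.
have sf : scalar (dxf i.+1 w) by exact: (dxf_dmeasurable i).1.
rewrite -/(xhat_path i w) -/(yhat_path i w).
have tri : dual_norm (noise_x f Phi (x ^~ w) (xt ^~ w) (y ^~ w) (path_gx w) (path_gf w) i.+1)
    <= dual_norm (dxP i.+1 w) + dual_norm (dxf i.+1 w) by exact: (dual_normD fdX sP sf).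
have tri0 : 0 <= dual_norm (noise_x f Phi (x ^~ w) (xt ^~ w) (y ^~ w) (path_gx w) (path_gf w) i.+1).
  by apply: dual_norm_ge0 => //; exact: (scalar_addf sP sf).
have e1 : noise_x f Phi (x ^~ w) (xt ^~ w) (y ^~ w) (path_gx w) (path_gf w) i.+1
    (xhat_path i w - x i.+1 w) = dxP i.+1 w (xhat_path i w - x i.+1 w)
      + dxf i.+1 w (xhat_path i w - x i.+1 w) by [].
rewrite e1.
have e2 : noise_y Phi (x ^~ w) (y ^~ w) (path_gy w) i.+1 = dyP i.+1 w by [].
rewrite e2 /sqr_xP /sqr_xf /sqr_y.
set A := dual_norm (noise_x _ _ _ _ _ _ _ _) in tri tri0 *.
move: tri; set a := dual_norm (dxP _ _); set b := dual_norm (dxf _ _) => tri.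
set c := dual_norm (dyP _ _).
(* The two noises in [x] are separated by Cauchy-Schwarz in the form [(a + b) ^+ 2 / (sxPhi + sxf)
   <= a ^+ 2 / sxPhi + b ^+ 2 / sxf], which costs no constant. *)
have hx : Num.sqrt m.+1%:R / (2 * (rho' * (sxPhi + sxf))) * A ^+ 2 <=
    Num.sqrt m.+1%:R / (2 * rho') * (sxPhi * (a ^+ 2 / sxPhi ^+ 2) + sxf * (b ^+ 2 / sxf ^+ 2)).
  have -> : Num.sqrt m.+1%:R / (2 * (rho' * (sxPhi + sxf))) * A ^+ 2 =
      Num.sqrt m.+1%:R / (2 * rho') * (A ^+ 2 / (sxPhi + sxf)).
    by field; rewrite !gt_eqF.
  rewrite ler_wpM2l ?divr_ge0 ?mulr_ge0 // ?(ltW q0) ?(ltW rho'_gt0) //.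
  rewrite ler_pdivrMr //; apply: (@le_trans _ _ ((a + b) ^+ 2)).
    by rewrite ler_sqr // nnegrE // (le_trans tri0).
  have -> : (sxPhi * (a ^+ 2 / sxPhi ^+ 2) + sxf * (b ^+ 2 / sxf ^+ 2)) * (sxPhi + sxf) =
      (a + b) ^+ 2 + sxPhi * sxf * (a / sxPhi - b / sxf) ^+ 2.
    by field; rewrite !gt_eqF.
  by rewrite lerDl mulr_ge0 ?sqr_ge0 // mulr_ge0 // ltW.
have hy : Num.sqrt m.+1%:R / (2 * (rho * syPhi)) * c ^+ 2 =
    Num.sqrt m.+1%:R / (2 * rho) * (syPhi * (c ^+ 2 / syPhi ^+ 2)).
  by field; rewrite !gt_eqF.
rewrite hy mulrDr in hx *; lra.
Qed.

Let OX := fine (bregman_diameter XX hX).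
Let OY := fine (bregman_diameter YY hY).
Let TT : R := m.+1%:R.
Let q := Num.sqrt TT.

Let T_E : TT = m%:R + 1. Proof. by rewrite /TT natr1. Qed.
Let q2 : q ^+ 2 = TT. Proof. by rewrite sqr_sqrtr. Qed.
Let mn0 : m%:R != 0 :> R. Proof. by rewrite gt_eqF. Qed.
Let qn0 : q != 0. Proof. by rewrite gt_eqF. Qed.

Let weight_E : weight m = m%:R * q ^+ 2 / 2.
Proof. by rewrite q2 T_E. Qed.

Let weight_gt0 : 0 < weight m :> R.
Proof. by rewrite weight_E divr_gt0 // mulr_gt0 // exprn_gt0. Qed.

Let OX0 : 0 <= OX.
Proof.
have [w _] : [set: Om] !=set0 by exists point.
exact: (Omega_bounds hX_dgf OmX_fin (tr_x1 (tr w)).1).1.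
Qed.

Let OY0 : 0 <= OY.
Proof.
have [w _] : [set: Om] !=set0 by exists point.
exact: (Omega_bounds hY_dgf OmY_fin (tr_y1 (tr w)).1).1.
Qed.

Definition deterministic_part : R :=
  (coefX L Lxx Lyx sxPhi sxf rho' m%:R + step_x sxPhi sxf rho' m) * OX
  + (coefY Lyx Lyy syPhi rho m%:R + step_y syPhi rho m) * OY.

Local Notation Gap w := (gap XX YY f g Phi J (xb m.+1 w) (yb m.+1 w)).

Let Dxb w : XX (xb m.+1 w) /\ edom g (xb m.+1 w).
Proof.
split; first exact: (in_xb problem (tr w)).
exact: (dom_xb problem (tr w)).
Qed.

Let Dyb w : YY (yb m.+1 w) /\ edom J (yb m.+1 w).
Proof.
split; first exact: (in_yb problem (tr w)).
exact: (dom_yb problem (tr w)).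
Qed.

Lemma gap_path_bound w :
  (Gap w <= ((deterministic_part + noise_bound w) / weight m)%:E)%E.
Proof.
have [Xb gb] := Dxb w; have [Yb Jb] := Dyb w.
apply: (gap_le problem) => // u v Xu gu Yv Jv.
rewrite ler_pdivlMr // mulrC.
apply: (@le_trans _ _ (deterministic_part + noise_total XX YY f Phi hX hY syPhi sxPhi sxf rho rho'
  (x ^~ w) (xt ^~ w) (y ^~ w) (path_gx w) (path_gf w) (path_gy w) m)); last first.
  by rewrite lerD2l noise_total_le.
exact: (path_bound fdX fdY problem hX_dgf hY_dgf OmX_fin OmY_fin syPhi_gt0 sxPhi_gt0
  sxf_gt0 rho_gt0 rho'_gt0 (fun t => scalar_linear _) (fun t => scalar_linear _)
  (fun t => scalar_linear _) (tr w) m1 Xu gu Yv Jv).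
Qed.

Lemma gap_fin w : Gap w \is a fin_num.
Proof.
have [Xb gb] := Dxb w; have [Yb Jb] := Dyb w.
rewrite ge0_fin_numE; first exact: le_lt_trans (gap_path_bound w) (ltry _).
exact: (gap_ge0 problem).
Qed.

Lemma gap_measurable : measurable_fun setT (fun w => Gap w).
Proof.
have [_ _ mxb myb _] := iterates_measurable m.
have gm := noise_generators_measurable (t := m).
by apply: (measurable_gap fdX fdY problem) => //; exact: (sub_measurable_fun gm).
Qed.

Definition B_real : R :=
  16 * L / (TT * m%:R) * OX + 8 * (Lxx + Lyx) / TT * OX
  + 128 * (Lyx + Lyy) / TT * OY
  + 8 * syPhi / q * (rho^-1 + 16 * rho * OY)
  + 8 * (sxf + sxPhi) / q * (rho'^-1 + rho' * OX).

(** The level [m * (1 + l)] bounds each sum of normalized squared norms: [l = 0] in expectation,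
    [l = ln vs^-1] for the tails. Division by [weight m] produces the rates of the theorem. The
    tightest comparison is that of the noise part in front of [OX], where
    [2 * m * sqrt m + 2 * m * q] faces [4 * m * q]. *)
Lemma budget (l : R) : 0 <= l ->
  deterministic_part
  + (q / (2 * rho') * (sxPhi * (m%:R * (1 + l)) + sxf * (m%:R * (1 + l)))
     + q / (2 * rho) * (syPhi * (m%:R * (1 + l)))) <=
  weight m * (B_real + 8 * syPhi / q * (l / rho) + 8 * (sxPhi + sxf) / q * (l / rho')).
Proof.
move=> l0.
have -> : weight m * (B_real + 8 * syPhi / q * (l / rho)
    + 8 * (sxPhi + sxf) / q * (l / rho')) =
    (8 * L + 4 * m%:R * (Lxx + Lyx) + 4 * m%:R * q * (sxPhi + sxf) * rho') * OX
    + (64 * m%:R * (Lyx + Lyy) + 64 * m%:R * q * syPhi * rho) * OY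
    + 4 * m%:R * q * syPhi * (1 + l) / rho
    + 4 * m%:R * q * (sxPhi + sxf) * (1 + l) / rho'.
  rewrite weight_E /B_real -q2.
  move: (q) (m%:R : R) qn0 mn0 => a b an bn.
  by field; rewrite an bn !gt_eqF.
have -> : q / (2 * rho') * (sxPhi * (m%:R * (1 + l)) + sxf * (m%:R * (1 + l))) =
    m%:R * q * (sxPhi + sxf) * (1 + l) / rho' / 2 by field; rewrite gt_eqF.
have -> : q / (2 * rho) * (syPhi * (m%:R * (1 + l))) =
    m%:R * q * syPhi * (1 + l) / rho / 2 by field; rewrite gt_eqF.
have p1 : 0 <= m%:R * q * syPhi * (1 + l) / rho.
  by rewrite divr_ge0 ?(ltW rho_gt0) // !mulr_ge0 ?(ltW m0) ?(ltW q0) ?(ltW syPhi_gt0) // addr_ge0.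
have p2 : 0 <= m%:R * q * (sxPhi + sxf) * (1 + l) / rho'.
  by rewrite divr_ge0 ?(ltW rho'_gt0) // !mulr_ge0 ?(ltW m0) ?(ltW q0) ?(ltW sx0) // addr_ge0.
have sm : Num.sqrt m%:R <= q by rewrite ler_wsqrtr // ler_nat.
have Lx := sp_Lxx_ge0 problem; have Ly := sp_Lyx_ge0 problem; have Lyy0 := sp_Lyy_ge0 problem.
have L0 := sp_L_ge0 problem.
have r1 : 0 <= m%:R * (Lxx + Lyx) by rewrite mulr_ge0 ?(ltW m0) // addr_ge0.
have r2 : 0 <= m%:R * (Lyx + Lyy) by rewrite mulr_ge0 ?(ltW m0) // addr_ge0.
have r3 : rho' * (sxPhi + sxf) * (m%:R * Num.sqrt m%:R) <= rho' * (sxPhi + sxf) * (m%:R * q).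
  by rewrite ler_wpM2l ?ler_wpM2l ?(ltW m0) // mulr_ge0 // ltW.
have r4 : m%:R * (rho * syPhi) * Num.sqrt m%:R <= m%:R * (rho * syPhi) * q.
  by rewrite ler_wpM2l // !mulr_ge0 // ltW.
have r5 : 0 <= m%:R * (rho * syPhi) * q by rewrite !mulr_ge0 // ltW.
have h1 : (coefX L Lxx Lyx sxPhi sxf rho' m%:R + step_x sxPhi sxf rho' m) * OX <=
    (8 * L + 4 * m%:R * (Lxx + Lyx) + 4 * m%:R * q * (sxPhi + sxf) * rho') * OX.
  apply: ler_wpM2r => //; rewrite /coefX /step_x -/TT -/q.
  clear p1 p2 r2 r4 r5; lra.
have h2 : (coefY Lyx Lyy syPhi rho m%:R + step_y syPhi rho m) * OY <=
    (64 * m%:R * (Lyx + Lyy) + 64 * m%:R * q * syPhi * rho) * OY.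
  apply: ler_wpM2r => //; rewrite /coefY /step_y -/TT -/q.
  clear p1 p2 r1 r3 h1; lra.
rewrite /deterministic_part; move: h1 h2 p1 p2.
move: ((coefX _ _ _ _ _ _ _ + _) * OX) ((coefY _ _ _ _ _ + _) * OY) => a b.
clear r1 r2 r3 r4 r5 sm; lra.
Qed.

(** * Expectation and tail bounds for the gap *)

Section UnbiasedNoise.
Variable P : probability Om R.
Hypothesis unb_xP : forall i, cond_unbiased P <<s noise_generators i >> (dxP i.+1).
Hypothesis unb_xf : forall i, cond_unbiased P <<s noise_generators i >> (dxf i.+1).
Hypothesis unb_y : forall i, cond_unbiased P <<s noise_generators i >> (dyP i.+1).

Let gm i := noise_generators_measurable (t := i).
Let sP i w : scalar (dxP i.+1 w). Proof. exact: (dxP_dmeasurable i).1. Qed.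
Let sf i w : scalar (dxf i.+1 w). Proof. exact: (dxf_dmeasurable i).1. Qed.
Let sy i w : scalar (dyP i.+1 w). Proof. exact: (dyP_dmeasurable i).1. Qed.

(** Both the mirror point of index [i] and [x i.+1] are determined by the first [i] steps, as the
    conditional hypotheses on the noise of index [i.+1] require. *)
Let mdx i : vmeasurable ((fun w => xhat_path i w - x i.+1 w) : GT i -> X).
Proof.
have [mx _ _ _ _] := iterates_measurable i.
have := vmeasurable_lincomb fdX 1 (- 1) (@xhat_measurable i) mx.
by under eq_fun do rewrite scale1r scaleN1r.
Qed.

Let mdy i : vmeasurable ((fun w => y i.+1 w - yhat_path i w) : GT i -> Y).
Proof.
have [_ my _ _ _] := iterates_measurable i.
have := vmeasurable_lincomb fdY 1 (- 1) my (@yhat_measurable i).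
by under eq_fun do rewrite scale1r scaleN1r.
Qed.

Let diamX : exists D : R, [/\ 0 <= D, diameter XX = D%:E &
  forall u v, XX u -> XX v -> `|u - v| <= D].
Proof. exact: (diameter_fin hX_dgf OmX_fin (spd_x1_core iterates)). Qed.

Let diamY : exists D : R, [/\ 0 <= D, diameter YY = D%:E &
  forall u v, YY u -> YY v -> `|u - v| <= D].
Proof. exact: (diameter_fin hY_dgf OmY_fin (spd_y1_core iterates)). Qed.

Let B_gt0 : 0 < B_real.
Proof.
have T0 : 0 < TT by rewrite /TT ltr0n.
have a1 : 0 <= 16 * L / (TT * m%:R) * OX.
  by rewrite mulr_ge0 // divr_ge0 ?mulr_ge0 ?(sp_L_ge0 problem) // ltW.
have a2 : 0 <= 8 * (Lxx + Lyx) / TT * OX.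
  by rewrite mulr_ge0 // divr_ge0 ?(ltW T0) // mulr_ge0 // addr_ge0
    ?(sp_Lxx_ge0 problem) ?(sp_Lyx_ge0 problem).
have a3 : 0 <= 128 * (Lyx + Lyy) / TT * OY.
  by rewrite mulr_ge0 // divr_ge0 ?(ltW T0) // mulr_ge0 // addr_ge0
    ?(sp_Lyy_ge0 problem) ?(sp_Lyx_ge0 problem).
have a4 : 0 < 8 * syPhi / q * (rho^-1 + 16 * rho * OY).
  rewrite mulr_gt0 ?divr_gt0 ?mulr_gt0 // ltr_pwDl ?invr_gt0 //.
  by rewrite !mulr_ge0 // ltW.
have a5 : 0 <= 8 * (sxf + sxPhi) / q * (rho'^-1 + rho' * OX).
  rewrite mulr_ge0 ?divr_ge0 ?mulr_ge0 ?addr_ge0 ?invr_ge0 ?mulr_ge0 //;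
    exact: ltW.
rewrite /B_real ltr_wpDr // ltr_wpDl //; apply: addr_ge0 => //; exact: addr_ge0.
Qed.

Section BoundedVariance.
Hypothesis var_xP : forall i, cond_variance_le P <<s noise_generators i >> (dxP i.+1) sxPhi.
Hypothesis var_xf : forall i, cond_variance_le P <<s noise_generators i >> (dxf i.+1) sxf.
Hypothesis var_y : forall i, cond_variance_le P <<s noise_generators i >> (dyP i.+1) syPhi.

Lemma noise_bound_expectation : L1 P noise_bound /\ Ex P noise_bound <=
  q / (2 * rho') * (sxPhi * m%:R + sxf * m%:R) + q / (2 * rho) * (syPhi * m%:R).
Proof.
have [DX [DX0 _ hDX]] := diamX; have [DY [DY0 _ hDY]] := diamY.
have vP i := variance_moments fdX (@gm i) sxPhi_gt0 (sP i) (unb_xP i) (var_xP i).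
have vf i := variance_moments fdX (@gm i) sxf_gt0 (sf i) (unb_xf i) (var_xf i).
have vy i := variance_moments fdY (@gm i) syPhi_gt0 (sy i) (unb_y i) (var_y i).
have bX i w : `|xhat_path i w - x i.+1 w| <= DX.
  by apply: hDX; [exact: xhat_in|exact: (in_x (tr w))].
have bY i w : `|y i.+1 w - yhat_path i w| <= DY.
  by apply: hDY; [exact: (in_y (tr w))|exact: yhat_in].
have cP i := centered_term fdX (@gm i) (sP i) (unb_xP i) i.+1%:R (@mdx i) (bX i)
  (let: And3 h _ _ := vP i in h).
have cf i := centered_term fdX (@gm i) (sf i) (unb_xf i) i.+1%:R (@mdx i) (bX i)
  (let: And3 h _ _ := vf i in h).
have cy i := centered_term fdY (@gm i) (sy i) (unb_y i) (weight_y m i.+1) (@mdy i) (bY i)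
  (let: And3 h _ _ := vy i in h).
have L1xP : L1 P mart_xP by apply: L1_sum => i; exact: (cP i).1.
have L1xf : L1 P mart_xf by apply: L1_sum => i; exact: (cf i).1.
have L1y : L1 P mart_y by apply: L1_sum => i; exact: (cy i).1.
have E1 : Ex P mart_xP = 0.
  by rewrite Ex_sum ?big1 // => i; [move=> _; exact: (cP i).2|exact: (cP i).1].
have E2 : Ex P mart_xf = 0.
  by rewrite Ex_sum ?big1 // => i; [move=> _; exact: (cf i).2|exact: (cf i).1].
have E3 : Ex P mart_y = 0.
  by rewrite Ex_sum ?big1 // => i; [move=> _; exact: (cy i).2|exact: (cy i).1].
have sumN (N : nat -> Om -> R) : (forall i, L1 P (N i) /\ Ex P (N i) <= 1) ->
    L1 P (fun w => \sum_(i < m) N i w) /\ Ex P (fun w => \sum_(i < m) N i w) <= m%:R.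
  move=> hN; split; first by apply: L1_sum => i; exact: (hN i).1.
  rewrite Ex_sum; last by move=> i; exact: (hN i).1.
  rewrite -[leRHS]mulr1 mulr_natl -[in leRHS](card_ord m) -sumr_const.
  by apply: ler_sum => i _; exact: (hN i).2.
have [LNP ENP] := sumN sqr_xP (fun i => let: And3 _ h h' := vP i in conj h h').
have [LNf ENf] := sumN sqr_xf (fun i => let: And3 _ h h' := vf i in conj h h').
have [LNy ENy] := sumN sqr_y (fun i => let: And3 _ h h' := vy i in conj h h').
have La := L1D L1xP L1xf; have Lb := L1D La L1y.
have Lc := L1D (L1Z sxPhi LNP) (L1Z sxf LNf).
have Ld := L1D Lb (L1Z (q / (2 * rho')) Lc).
have Le := L1Z (q / (2 * rho)) (L1Z syPhi LNy).
split; first exact: L1D Ld Le.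
rewrite (ExD Ld Le) (ExD Lb (L1Z _ Lc)) (ExD La L1y) (ExD L1xP L1xf) E1 E2 E3 !add0r.
rewrite (ExZ _ Lc) (ExD (L1Z sxPhi LNP) (L1Z sxf LNf)) !(ExZ _ LNP) !(ExZ _ LNf).
rewrite (ExZ _ (L1Z syPhi LNy)) (ExZ _ LNy).
have c1 : 0 <= q / (2 * rho') by rewrite divr_ge0 ?mulr_ge0 // ltW.
have c2 : 0 <= q / (2 * rho) by rewrite divr_ge0 ?mulr_ge0 // ltW.
by rewrite lerD // ler_wpM2l // ?lerD // ler_wpM2l // ltW.
Qed.

Lemma expectation_bound : (\int[P]_w Gap w <= B_real%:E)%E.
Proof.
have [LH EH] := noise_bound_expectation.
have LK : L1 P (fun w => (weight m)^-1 * (deterministic_part + noise_bound w)).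
  by apply: L1Z; apply: L1D => //; exact: L1_cst.
have EK : Ex P (fun w => (weight m)^-1 * (deterministic_part + noise_bound w)) <= B_real.
  rewrite ExZ; last by apply: L1D => //; exact: L1_cst.
  rewrite (ExD (L1_cst P _) LH) Ex_cst ler_pdivrMl //.
  have := budget (lexx 0); rewrite !mul0r !mulr0 !addr0 !mulr1.
  by apply: le_trans; rewrite lerD2l.
apply: (@le_trans _ _ (\int[P]_w ((weight m)^-1 * (deterministic_part + noise_bound w))%:E)%E).
  apply: ge0_le_integral => //.
  - by move=> w _; have [Xb gb] := Dxb w; have [Yb Jb] := Dyb w; exact: (gap_ge0 problem).
  - exact: gap_measurable.
  - by apply/measurable_EFinP; exact: L1_measurable LK.
  - by move=> w _; rewrite mulrC; exact: gap_path_bound.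
by rewrite ExE // lee_fin.
Qed.

Lemma markov_bound (vs : R) : 0 < vs <= 1 ->
  ((1 - vs)%:E <= P [set w | Gap w <= (vs^-1 * B_real)%:E])%E.
Proof.
move=> /andP[vs0 vs1].
pose Gr w := fine (Gap w).
have GE w : Gap w = (Gr w)%:E by rewrite /Gr fineK // gap_fin.
have mGr : measurable_fun setT Gr.
  have -> : Gr = fine \o (fun w => Gap w) by [].
  apply: measurableT_comp => //; exact: gap_measurable.
have Gr0 w : 0 <= Gr w.
  rewrite -lee_fin -GE; have [Xb gb] := Dxb w; have [Yb Jb] := Dyb w.
  exact: (gap_ge0 problem).
have IG : (\int[P]_w (Gr w)%:E <= B_real%:E)%E.
  by under eq_integral do rewrite -GE; exact: expectation_bound.
have c0 : 0 < vs^-1 * B_real by rewrite mulr_gt0 ?invr_gt0.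
have := markov_gt mGr Gr0 IG c0.
rewrite (_ : B_real / (vs^-1 * B_real) = vs); last first.
  by field; rewrite (gt_eqF vs0) gt_eqF.
have mA := measurable_gt (vs^-1 * B_real) mGr.
rewrite (_ : [set w | (Gap w <= _)%E] = ~` [set w | vs^-1 * B_real < Gr w]).
  move=> h; apply: probability_ge_compl; first exact: measurableC.
  by rewrite setCK.
apply/seteqP; split => w /=; rewrite GE lee_fin leNgt; [by move/negP|by move/negP].
Qed.

End BoundedVariance.

Section SubGaussianNoise.
Hypothesis sg_xP : forall i, cond_subgaussian P <<s noise_generators i >> (dxP i.+1) sxPhi.
Hypothesis sg_xf : forall i, cond_subgaussian P <<s noise_generators i >> (dxf i.+1) sxf.
Hypothesis sg_y : forall i, cond_subgaussian P <<s noise_generators i >> (dyP i.+1) syPhi.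

Let exp_moment (E : normedModType R) (fdE : finite_dim E) i (delta : Om -> E -> R)
    (sigma : R) : (forall w, scalar (delta w)) ->
  cond_unbiased P <<s noise_generators i >> delta ->
  cond_subgaussian P <<s noise_generators i >> delta sigma ->
  let N w := dual_norm (delta w) ^+ 2 / sigma ^+ 2 in
  measurable_fun setT N /\
  (L1 P (fun w => expR (N w)) /\ Ex P (fun w => expR (N w)) <= expR 1).
Proof.
move=> sd ub sg N.
have mN : measurable_fun setT N.
  apply: measurable_funM; last exact: measurable_cst.
  by apply: measurable_funX; apply: dmeasurable_norm => //; exact: unbiased_dmeasurable ub.
split => //; apply: (cond_moment_le (@gm i)) => //.
by apply: measurableT_comp => //; exact: measurable_expR.
Qed.

Let gmono i : <<s noise_generators i >> `<=` <<s noise_generators i.+1 >>.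
Proof. exact: noise_generators_mono. Qed.

Lemma high_probability_bound (vs DX DY : R) : 0 < vs <= 6^-1 ->
  diameter XX = DX%:E -> diameter YY = DY%:E ->
  ((1 - 6 * vs)%:E <= P [set w | Gap w <= (B_real
     + (8 * syPhi / q * (ln vs^-1 / rho + Num.sqrt (ln vs^-1) * DY)
        + 8 * (sxPhi + sxf) / q * (ln vs^-1 / rho' + Num.sqrt (ln vs^-1) * DX)))%:E])%E.
Proof.
move=> /andP[vs0 vs6] dX dY.
have [DX' [DX0 dX' hDX]] := diamX; have [DY' [DY0 dY' hDY]] := diamY.
have eX : DX' = DX by apply: EFin_inj; rewrite -dX'.
have eY : DY' = DY by apply: EFin_inj; rewrite -dY'.
rewrite eX in DX0 hDX; rewrite eY in DY0 hDY.
set l := ln vs^-1.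
have l0 : 0 <= l.
  by rewrite ln_ge0 // invf_ge1 //; lra.
have el : expR (- l) = vs by rewrite expRN lnK ?invrK // posrE invr_gt0.
set sl := Num.sqrt l; have sl0 : 0 <= sl by exact: sqrtr_ge0.
have sl2 : sl ^+ 2 = l by rewrite sqr_sqrtr.
have bX i w : (i < m)%N -> `|xhat_path i w - x i.+1 w| <= DX.
  by move=> _; apply: hDX; [exact: xhat_in|exact: (in_x (tr w))].
have bY i w : (i < m)%N -> `|y i.+1 w - yhat_path i w| <= DY.
  by move=> _; apply: hDY; [exact: (in_y (tr w))|exact: yhat_in].
(* The Chernoff radius for weights whose squares sum to at most [2 * m ^+ 2 * TT]; divided by
   [weight m] it is [8 * sigma / q * sl * D], the diameter term of the claim. *)
pose r (sigma D : R) := 4 * sigma * (m%:R * q) * sl * D.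
have r0 sigma D : 0 < sigma -> 0 <= D -> 0 <= r sigma D.
  by move=> s0 D0; rewrite /r !mulr_ge0 ?(ltW m0) ?(ltW q0) ?(ltW s0).
have rl sigma D : 8 * l * (sigma ^+ 2 * D ^+ 2 * (2 * (m%:R ^+ 2 * TT))) <= r sigma D ^+ 2.
  by rewrite /r -sl2 -q2 le_eqVlt; apply/orP; left; apply/eqP; ring.
have tP : (P [set w | r sxPhi DX < mart_xP w]%R <= vs%:E)%E.
  rewrite -el; apply: (martingale_tail fdX gm gmono sxPhi_gt0 (fun i => ler0n R i.+1)
    sP (fun i _ => dxP_dmeasurable i) (fun i _ => @mdx i) bX (fun i _ => unb_xP i)
    DX0 (fun i _ => sg_xP i) (weight_x_sumsq m) (r0 _ _ sxPhi_gt0 DX0) (rl _ _)).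
have tf : (P [set w | r sxf DX < mart_xf w]%R <= vs%:E)%E.
  rewrite -el; apply: (martingale_tail fdX gm gmono sxf_gt0 (fun i => ler0n R i.+1)
    sf (fun i _ => dxf_dmeasurable i) (fun i _ => @mdx i) bX (fun i _ => unb_xf i)
    DX0 (fun i _ => sg_xf i) (weight_x_sumsq m) (r0 _ _ sxf_gt0 DX0) (rl _ _)).
have wy0 i : 0 <= weight_y m i.+1 :> R.
  by rewrite /weight_y addr_ge0 ?mulr_ge0 // -natr1 addrK.
have ty : (P [set w | r syPhi DY < mart_y w]%R <= vs%:E)%E.
  rewrite -el; apply: (martingale_tail fdY gm gmono syPhi_gt0 wy0
    sy (fun i _ => dyP_dmeasurable i) (fun i _ => @mdy i) bY (fun i _ => unb_y i)
    DY0 (fun i _ => sg_y i) (weight_y_sumsq m1) (r0 _ _ syPhi_gt0 DY0) (rl _ _)).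
have eP i := exp_moment fdX (sP i) (unb_xP i) (sg_xP i).
have ef i := exp_moment fdX (sf i) (unb_xf i) (sg_xf i).
have ey i := exp_moment fdY (sy i) (unb_y i) (sg_y i).
have nP : (P [set w | m%:R * (1 + l) < \sum_(i < m) sqr_xP i w]%R <= vs%:E)%E.
  by rewrite -el; apply: exp_average_tail => // i _; [exact: (eP i).2|exact: (eP i).1].
have nf : (P [set w | m%:R * (1 + l) < \sum_(i < m) sqr_xf i w]%R <= vs%:E)%E.
  by rewrite -el; apply: exp_average_tail => // i _; [exact: (ef i).2|exact: (ef i).1].
have ny : (P [set w | m%:R * (1 + l) < \sum_(i < m) sqr_y i w]%R <= vs%:E)%E.
  by rewrite -el; apply: exp_average_tail => // i _; [exact: (ey i).2|exact: (ey i).1].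
have mMP : measurable_fun setT mart_xP.
  have h := martingale_measurable fdX gmono (fun i => i.+1%:R)
    (fun i _ => dxP_dmeasurable i) (fun i _ => @mdx i) (leqnn m).
  exact: (sub_measurable_fun (@gm m) h).
have mMf : measurable_fun setT mart_xf.
  have h := martingale_measurable fdX gmono (fun i => i.+1%:R)
    (fun i _ => dxf_dmeasurable i) (fun i _ => @mdx i) (leqnn m).
  exact: (sub_measurable_fun (@gm m) h).
have mMy : measurable_fun setT mart_y.
  have h := martingale_measurable fdY gmono (fun i => weight_y m i.+1)
    (fun i _ => dyP_dmeasurable i) (fun i _ => @mdy i) (leqnn m).
  exact: (sub_measurable_fun (@gm m) h).
have mS (N : nat -> Om -> R) : (forall i, measurable_fun setT (N i)) ->
    measurable [set w | m%:R * (1 + l) < \sum_(i < m) N i w].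
  by move=> mN; apply: measurable_gt; apply: measurable_sum => i.
have sP' := mS sqr_xP (fun i => (eP i).1); have sf' := mS sqr_xf (fun i => (ef i).1).
have sy' := mS sqr_y (fun i => (ey i).1).
have m1' := measurable_gt (r sxPhi DX) mMP; have m2' := measurable_gt (r sxf DX) mMf.
have m3' := measurable_gt (r syPhi DY) mMy.
have u1 := probability_setU_le m1' m2' tP tf; have n1 := measurableU _ _ m1' m2'.
have u2 := probability_setU_le n1 m3' u1 ty; have n2 := measurableU _ _ n1 m3'.
have u3 := probability_setU_le n2 sP' u2 nP; have n3 := measurableU _ _ n2 sP'.
have u4 := probability_setU_le n3 sf' u3 nf; have n4 := measurableU _ _ n3 sf'.
have u5 := probability_setU_le n4 sy' u4 ny; have n5 := measurableU _ _ n4 sy'.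
set B := B_real + _.
have mG : measurable [set w | (Gap w <= B%:E)%E].
  rewrite -[X in measurable X]setTI.
  exact: (emeasurable_fun_infty_c measurableT gap_measurable).
apply: probability_ge_compl => //.
have -> : (6 * vs)%:E = (vs + vs + vs + vs + vs + vs)%:E by congr _%:E; ring.
apply: le_trans u5; apply: le_measure; rewrite ?inE //; first exact: measurableC.
(* By contraposition: outside the six exceptional events, [gap_path_bound] and [budget] give the
   bound at [w]. *)
move=> w /= nG; apply: contrapT => nU; apply: nG.
have h6 : ~ (m%:R * (1 + l) < \sum_(i < m) sqr_y i w) by move=> h; apply: nU; right.
have h5 : ~ (m%:R * (1 + l) < \sum_(i < m) sqr_xf i w) by move=> h; apply: nU; left; right.
have h4 : ~ (m%:R * (1 + l) < \sum_(i < m) sqr_xP i w) by move=> h; apply: nU; left; left; right.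
have h3 : ~ (r syPhi DY < mart_y w) by move=> h; apply: nU; left; left; left; right.
have h2 : ~ (r sxf DX < mart_xf w) by move=> h; apply: nU; do 4 left; right.
have h1 : ~ (r sxPhi DX < mart_xP w) by move=> h; apply: nU; do 5 left.
move/negP: h1; move/negP: h2; move/negP: h3; move/negP: h4; move/negP: h5; move/negP: h6.
rewrite -!leNgt => k6 k5 k4 k3 k2 k1.
apply: (le_trans (gap_path_bound w)); rewrite lee_fin ler_pdivrMr // [leRHS]mulrC.
have -> : weight m * B = weight m * (B_real + 8 * syPhi / q * (l / rho)
      + 8 * (sxPhi + sxf) / q * (l / rho')) + (r sxPhi DX + r sxf DX + r syPhi DY).
  rewrite /B weight_E /r; move: (q) qn0 => a an.
  by field; rewrite an !gt_eqF.
have := budget l0.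
have c1 : 0 <= q / (2 * rho') by rewrite divr_ge0 ?mulr_ge0 // ltW.
have c2 : 0 <= q / (2 * rho) by rewrite divr_ge0 ?mulr_ge0 // ltW.
have j1 := ler_wpM2l c1 (lerD (ler_wpM2l (ltW sxPhi_gt0) k4) (ler_wpM2l (ltW sxf_gt0) k5)).
have j2 := ler_wpM2l c2 (ler_wpM2l (ltW syPhi_gt0) k6).
rewrite /noise_bound -/TT -/q.
move: j1 j2 k1 k2 k3.
move: (q / (2 * rho') * _) (q / (2 * rho') * _) (q / (2 * rho) * _) (q / (2 * rho) * _) => a1 a2 a3 a4.
move: (mart_xP w) (mart_xf w) (mart_y w) (r sxPhi _) (r sxf _) (r syPhi _) (weight m * _) => b1 b2 b3 b4 b5 b6 b7.
move: deterministic_part => b8 *; lra.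
Qed.

End SubGaussianNoise.

End UnbiasedNoise.

End Iterates.

Theorem theorem3p1
  (R : realType) (X Y : normedModType R)
  (X_findim : finite_dim X) (Y_findim : finite_dim Y)
  (XX : set X) (YY : set Y)
  (f g : X -> \bar R) (Phi : X -> Y -> R) (J : Y -> \bar R)
  (mu L Lxx Lyx Lyy : R)
  (problem : saddle_problem XX YY f g Phi J mu L Lxx Lyx Lyy)
  (hX : X -> \bar R) (hY : Y -> \bar R)
  (hX_dgf : is_dgf XX hX) (hY_dgf : is_dgf YY hY)
  (OmX_fin : (bregman_diameter XX hX < +oo)%E)
  (OmY_fin : (bregman_diameter YY hY < +oo)%E)
  (d dx dy df : measure_display) (Om : measurableType d)
  (P : probability Om R)
  (Zx : measurableType dx) (Zy : measurableType dy) (Zf : measurableType df)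
  (zx : nat -> Om -> Zx) (zy : nat -> Om -> Zy) (xi : nat -> Om -> Zf)
  (zx_meas : forall t, measurable_fun setT (zx t))
  (zy_meas : forall t, measurable_fun setT (zy t))
  (xi_meas : forall t, measurable_fun setT (xi t))
  (ox : X -> Y -> Zx -> {linear X -> R})
  (oy : X -> Y -> Zy -> {linear Y -> R})
  (of_ : X -> Zf -> {linear X -> R})
  (oracles_meas : measurable_oracles XX YY ox oy of_)
  (syPhi sxPhi sxf rho rho' : R)
  (syPhi_gt0 : 0 < syPhi) (sxPhi_gt0 : 0 < sxPhi) (sxf_gt0 : 0 < sxf)
  (rho_gt0 : 0 < rho) (rho'_gt0 : 0 < rho')
  (x1 : X) (y1 : Y)
  (x xb xt : nat -> Om -> X) (y yb : nat -> Om -> Y) (s : nat -> Om -> Y -> R)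
  (iterates : spd_iterates XX YY g J hX hY ox oy of_ zx zy xi
     beta_ (alpha_ Lyx Lyy syPhi rho) (tau_ L Lxx Lyx sxPhi sxf rho') theta_
     x1 y1 x xb xt y yb s)
  (F := noise_filtration zx zy xi)
  (dy_Phi := delta_yPhi Phi oy zy x y)
  (dx_Phi := delta_xPhi Phi ox zx x y)
  (dx_f := delta_xf f of_ xi xt)
  (unbiased : forall t, (1 <= t)%N ->
     [/\ cond_unbiased P (F t.-1) (dy_Phi t),
         cond_unbiased P (F t.-1) (dx_Phi t)
       & cond_unbiased P (F t.-1) (dx_f t)])
  (OmX := bregman_diameter XX hX) (OmY := bregman_diameter YY hY)
  (G := gap XX YY f g Phi J)
  (BE := B_E L Lxx Lyx Lyy syPhi sxPhi sxf rho rho' OmX OmY) :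
  ((forall t, (1 <= t)%N ->
      [/\ cond_variance_le P (F t.-1) (dy_Phi t) syPhi,
          cond_variance_le P (F t.-1) (dx_Phi t) sxPhi
        & cond_variance_le P (F t.-1) (dx_f t) sxf]) ->
    forall T : nat, (3 <= T)%N ->
      (\int[P]_w G (xb T w) (yb T w) <= BE T)%E /\
      forall vs : R, 0 < vs <= 1 ->
        ((1 - vs)%:E
           <= P [set w | G (xb T w) (yb T w) <= (vs^-1)%:E * BE T])%E)
  /\
  ((forall t, (1 <= t)%N ->
      [/\ cond_subgaussian P (F t.-1) (dy_Phi t) syPhi,
          cond_subgaussian P (F t.-1) (dx_Phi t) sxPhi
        & cond_subgaussian P (F t.-1) (dx_f t) sxf]) ->
    forall (T : nat) (vs : R), (3 <= T)%N -> 0 < vs <= 6^-1 ->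
      ((1 - 6 * vs)%:E
         <= P [set w | G (xb T w) (yb T w)
              <= BE T + B_sG syPhi sxPhi sxf rho rho'
                          (diameter XX) (diameter YY) T vs])%E).

Proof.
have [OmX0 OmXE] := Omega_bounds hX_dgf OmX_fin (spd_x1_core iterates).
have [OmY0 OmYE] := Omega_bounds hY_dgf OmY_fin (spd_y1_core iterates).
have [DX [DX0 DXE _]] := diameter_fin hX_dgf OmX_fin (spd_x1_core iterates).
have [DY [DY0 DYE _]] := diameter_fin hY_dgf OmY_fin (spd_y1_core iterates).
(* With finite diameters the bound is a real number. [T] is written [m.+1], because the average of
   index [m.+1] results from [m] steps. *)
have BE_real m : BE m.+1 = (B_real XX YY L Lxx Lyx Lyy hX hY syPhi sxPhi sxf rho rho' m)%:E.
  rewrite /BE /B_E /OmX /OmY OmXE OmYE /B_real -!EFinM -!EFinD.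
  by rewrite -[m.+1%:R]natr1 addrK natr1.
have uP i := let: And3 _ h _ := unbiased _ (ltn0Sn i) in h.
have uf i := let: And3 _ _ h := unbiased _ (ltn0Sn i) in h.
have uy i := let: And3 h _ _ := unbiased _ (ltn0Sn i) in h.
split.
- move=> variance [|m] // T3; have m1 : (1 <= m)%N by exact: ltnW.
  have vP i := let: And3 _ h _ := variance _ (ltn0Sn i) in h.
  have vf i := let: And3 _ _ h := variance _ (ltn0Sn i) in h.
  have vy i := let: And3 h _ _ := variance _ (ltn0Sn i) in h.
  rewrite BE_real; split.
    exact: (expectation_bound X_findim Y_findim problem hX_dgf hY_dgf OmX_fin OmY_fin
      zx_meas zy_meas xi_meas oracles_meas syPhi_gt0 sxPhi_gt0 sxf_gt0 rho_gt0 rho'_gt0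
      iterates m1 uP uf uy vP vf vy).
  move=> vs vs01; rewrite -EFinM.
  exact: (markov_bound X_findim Y_findim problem hX_dgf hY_dgf OmX_fin OmY_fin
    zx_meas zy_meas xi_meas oracles_meas syPhi_gt0 sxPhi_gt0 sxf_gt0 rho_gt0 rho'_gt0
    iterates m1 uP uf uy vP vf vy vs01).
- move=> subg [|m] vs // T3 vs01; have m1 : (1 <= m)%N by exact: ltnW.
  have gP i := let: And3 _ h _ := subg _ (ltn0Sn i) in h.
  have gf i := let: And3 _ _ h := subg _ (ltn0Sn i) in h.
  have gy i := let: And3 h _ _ := subg _ (ltn0Sn i) in h.
  rewrite BE_real /B_sG DXE DYE -!EFinM -!EFinD.
  exact: (high_probability_bound X_findim Y_findim problem hX_dgf hY_dgf OmX_fin OmY_fin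
    zx_meas zy_meas xi_meas oracles_meas syPhi_gt0 sxPhi_gt0 sxf_gt0 rho_gt0 rho'_gt0
    iterates m1 uP uf uy gP gf gy vs01 DXE DYE).
Qed.
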